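(* Let $\lambda<1$. Then $$\{\gamma\in\mathbb{C}:\ I_\gamma[f]\in\mathcal{S}\text{ for all } f\in\mathcal{K}(\lambda)\}=\left\{\gamma\in\mathbb{C}:\,|\gamma|\le \frac{1}{2(1-\lambda)}\right\}\bigcup \left[\frac{1}{2(1-\lambda)},\frac{3}{2(1-\lambda)}\right].$$
   Context: $\mathbb{D}=\{z\in\mathbb{C}:|z|<1\}$. $\mathcal{A}$ is the class of analytic functions $f$ on $\mathbb{D}$ with $f(0)=0$, $f'(0)=1$; $\mathcal{S}\subset\mathcal{A}$ is the subclass of univalent functions. For $\lambda<1$, $\mathcal{K}(\lambda)=\{f\in\mathcal{A}: f'\neq0 \text{ on }\mathbb{D},\ \mathrm{Re}\,(1+zf''(z)/f'(z))>\lambda \text{ for } z\in\mathbb{D}\}$. For $\gamma\in\mathbb{C}$ and $f\in\mathcal{A}$ with $f'$ nonvanishing on $\mathbb{D}$, the Hornich scalar multiplication is $I_\gamma[f](z)=\int_0^z \{f'(w)\}^\gamma\,dw$, where $\{f'(w)\}^\gamma=\exp(\gamma\log f'(w))$ with the branch chosen so that $\{f'(0)\}^\gamma=1$. For real $a<b$, $[a,b]$ denotes the real segment. *)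

(* Defs.v *)
From Stdlib Require Import Reals.
From Coquelicot Require Import Coquelicot.
Open Scope R_scope.
Open Scope C_scope.

Definition inD (z : C) : Prop := (Cmod z < 1)%R.

Definition Cexp (z : C) : C :=
  (exp (Re z) * cos (Im z), exp (Re z) * sin (Im z))%R.

Definition cderiv (f : C -> C) (z l : C) : Prop :=
  @is_derive C_AbsRing C_NormedModule f z l.

Definition analytic_on_D (f : C -> C) : Prop :=
  forall z, inD z -> exists l, cderiv f z l.

Definition classA (f : C -> C) : Prop :=
  analytic_on_D f /\ f 0 = 0 /\ cderiv f 0 1.

Definition classS (f : C -> C) : Prop :=
  classA f /\ (forall z w, inD z -> inD w -> f z = f w -> z = w).

(* Class K(lambda): f in A, f' nonvanishing on D and
   Re (1 + z f''(z)/f'(z)) > lambda on D.  f1, f2 are f', f''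
   (complex derivatives are unique, so quantifying existentially is literal). *)
Definition classK (lam : R) (f : C -> C) : Prop :=
  classA f /\
  exists f1 f2 : C -> C,
    (forall z, inD z -> cderiv f z (f1 z)) /\
    (forall z, inD z -> cderiv f1 z (f2 z)) /\
    (forall z, inD z -> f1 z <> 0) /\
    (forall z, inD z -> (lam < Re (1 + z * f2 z / f1 z))%R).

(* g is the branch of log f' on D normalized by g(0) = 0
   (continuous, hence holomorphic; unique since D is connected),
   for f1 = f'. *)
Definition log_branch (f1 g : C -> C) : Prop :=
  (forall z, inD z -> continuous g z) /\
  (forall z, inD z -> Cexp (g z) = f1 z) /\ g 0 = 0.

(* Hornich scalar multiple: I_gamma[f](z) = int_0^z exp(gamma g(w)) dw,
   integral along the segment [0,z] (w = t z, t in [0,1]). *)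
Definition Hornich (gam : C) (g : C -> C) (z : C) : C :=
  @RInt C_R_CompleteNormedModule
    (fun t : R => Cexp (gam * g (RtoC t * z)) * z) 0 1.

(* Main.v *)
Require Import Defs.
From Stdlib Require Import Reals Ranalysis5 Lra Lia Classical ClassicalEpsilon.
From Coquelicot Require Import Coquelicot.
Open Scope R_scope.
Open Scope C_scope.

(** Writing [h = log f' / (1 - lam)] and [kap = (1 - lam) gam], the function [I_gam f] has derivative
    [exp (kap h)], where [Re (1 + z h') > 0] on the unit disc.

    Sufficiency.  For [g] and a nonvanishing [k], consider the chain
    [A_s u = s^n g u + (1 - s^n) u k u] on the disc [|u| <= r s].  If
    [s^n g' / k + (1 - s^n) (1 + u k' / k)] stays in the disc of centre and radius [n / 2], then a collision
    [A_s u = A_s u'] with [u <> u'] propagates to slightly smaller [s]; by compactness the least [s] admitting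
    a collision would be attained, and there is none for small [s], so [g = A_1] is injective.
    For [|kap| <= 1/2] take [n = 2] and [k = g' / (1 + c)], [c = -2 kap r^2]: the condition follows from the
    Schwarz lemma applied to the [w] with [z h' = 2 w / (1 - w)].  For real [kap] in [[1/2, 3/2]] take
    [k = exp h] and [n] large: both [1 + u k' / k] and [g' / k = exp ((kap - 1) h)] have positive real part,
    the latter because [|Im h| < PI].

    Necessity.  [(1 - z)^(-2 (1 - lam) mu)] is the derivative of a function in [K(lam)] for [0 < mu <= 1], and
    its image under [I_gam] is an affine function of [(1 - z)^beta], [beta = 1 - 2 kap mu], which is not
    injective when [|beta - 1| > 1] and [|beta + 1| > 1]; for [gam] outside the stated set some [mu]
    achieves both. *)

(** * Complex derivatives and continuity *)

(** [exp h] is the derivative of a convex function, so everything is about powers of such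
    derivatives. The two choices of [n] and [k] are two classical Loewner chains, written with
    [s = exp (- t)] and multiplied by [s^n]: that of the Ahlfors-Becker criterion, which accepts
    complex exponents, and that of close-to-convex functions, which needs [g' / k] in the right
    half-plane. As [|Im h| < PI], the latter holds for real exponents within 1/2 of the exponent 1
    of the convex function itself; this is where the end 3/2 comes from. The disc condition is a
    condition on speed. A value X of that disc has [Re (1 / X) > 1 / n]; when [s] becomes
    [s (1 - e)], a point [u] must move to about [u (1 - n e / X)] to keep its image up to a common
    factor, so its modulus drops faster than the radius [r s]. This first-order displacement and
    compactness take the place of the Loewner differential equation. Working on [|u| <= r] with
    [r < 1] makes all inequalities strict, and two given points always lie in such a disc. *)

Lemma Cmod_sub_sym (x y : C) : Cmod (x - y) = Cmod (y - x).
Proof. replace (x - y) with (- (y - x)) by ring. apply Cmod_opp. Qed.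

Lemma Cmod_triangle_sub (x y z : C) : (Cmod (x - z) <= Cmod (x - y) + Cmod (y - z))%R.
Proof. replace (x - z) with ((x - y) + (y - z)) by ring. apply Cmod_triangle. Qed.

Lemma Cmod_le_add (x y : C) : (Cmod x <= Cmod y + Cmod (x - y))%R.
Proof. replace x with (y + (x - y)) at 1 by ring. apply Cmod_triangle. Qed.

Lemma Cmod_sqr (z : C) : (Cmod z * Cmod z = Re z * Re z + Im z * Im z)%R.
Proof. generalize (Cmod2_alt z); simpl; rewrite !Rmult_1_r; auto. Qed.

Lemma im_le_Cmod (z : C) : (Rabs (Im z) <= Cmod z)%R.
Proof.
eapply Rle_trans; [ | apply Rmax_Cmod ]. apply Rmax_r.
Qed.

Lemma Cmod_le_Re_Im (z : C) : (Cmod z <= Rabs (Re z) + Rabs (Im z))%R.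
Proof.
replace z with (RtoC (Re z) + Ci * RtoC (Im z)) at 1.
- eapply Rle_trans; [apply Cmod_triangle | ].
  rewrite Cmod_mult, Cmod_Ci, !Cmod_R; lra.
- destruct z as [x y]; unfold Ci, Re, Im, RtoC, Cplus, Cmult; simpl; f_equal; ring.
Qed.

Lemma Cmod_pair_lt (x y e : R) : (Rabs x < e -> Rabs y < e -> Cmod (x, y) < 2 * e)%R.
Proof. intros; generalize (Cmod_le_Re_Im (x, y)); unfold Re, Im; simpl; lra. Qed.

Lemma ball_of_Cmod (x y : C) (e : posreal) : (Cmod (y - x) < e)%R -> @ball C_UniformSpace x e y.
Proof.
intros H; split; unfold ball; simpl; unfold AbsRing_ball, abs, minus, plus, opp; simpl.
- eapply Rle_lt_trans; [apply (re_le_Cmod (y - x)) | exact H].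
- eapply Rle_lt_trans; [apply (im_le_Cmod (y - x)) | exact H].
Qed.

Lemma Cmod_of_ball (x y : C) (e : posreal) : @ball C_UniformSpace x e y -> (Cmod (y - x) < 2 * e)%R.
Proof.
intros [H1 H2]; apply Cmod_pair_lt; [exact H1 | exact H2].
Qed.

(** The uniform structure of [C] is that of the product, whose balls are squares, while all
    estimates below use discs. The square of half-side [d / 2] lies in the disc of radius [d], which
    lies in the square of half-side [d]. *)
Lemma locally_CmodP (z : C) (P : C -> Prop) :
  @locally C_UniformSpace z P <-> exists d : posreal, forall y, (Cmod (y - z) < d)%R -> P y.
Proof.
split; intros [d Hd].
- exists d; intros y Hy; apply Hd, ball_of_Cmod, Hy.
- assert (0 < d / 2)%R by (generalize (cond_pos d); lra).
  exists (mkposreal _ H); intros y Hy; apply Hd.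
  apply Cmod_of_ball in Hy; simpl in Hy; lra.
Qed.

Lemma continuous_C {U : UniformSpace} (f : U -> C) (x : U) :
  @continuous U C_UniformSpace f x <->
  forall eps : posreal, locally x (fun y => (Cmod (f y - f x) < eps)%R).
Proof.
split.
- intros H eps. apply (H (fun w => (Cmod (w - f x) < eps)%R)).
  apply locally_CmodP; exists eps; auto.
- intros H P HP. apply locally_CmodP in HP; destruct HP as [d Hd].
  unfold filtermap; generalize (H d); apply filter_imp; intros y Hy; apply Hd, Hy.
Qed.

Lemma continuous_CC (f : C -> C) (z : C) :
  continuous f z <->
  forall eps : posreal, exists d : posreal, forall y, (Cmod (y - z) < d)%R -> (Cmod (f y - f z) < eps)%R.
Proof.
split; intros H.
- intros eps. apply locally_CmodP. now apply (proj1 (continuous_C f z) H).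
- apply continuous_C; intros eps; apply locally_CmodP, H.
Qed.

Lemma cderiv_eps (f : C -> C) (z l : C) :
  cderiv f z l <->
  forall eps : posreal, exists d : posreal, forall y, (Cmod (y - z) < d)%R ->
    (Cmod (f y - f z - l * (y - z)) <= eps * Cmod (y - z))%R.
Proof.
split.
- intros [_ H] eps.
  destruct (H z (fun P HP => HP) eps) as [d Hd].
  exists d; intros y Hy.
  specialize (Hd y Hy).
  unfold minus, plus, opp, scal, norm in Hd; simpl in Hd.
  unfold mult, abs in Hd; simpl in Hd.
  replace (f y - f z - l * (y - z)) with (f y + - f z + - ((y + - z) * l)) by ring.
  exact Hd.
- intros H; split; [apply is_linear_scal_l | ].
  intros x Hx.
  assert (x = z) as ->.
  { apply (is_filter_lim_locally_unique (V := AbsRing_NormedModule C_AbsRing)) in Hx; auto. }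
  intros eps; destruct (H eps) as [d Hd].
  exists d; intros y Hy; specialize (Hd y Hy).
  unfold minus, plus, opp, scal, norm; simpl; unfold mult, abs; simpl.
  replace (f y + - f z + - ((y + - z) * l)) with (f y - f z - l * (y - z)) by ring.
  exact Hd.
Qed.

Lemma cderivP (f : C -> C) (z l : C) :
  cderiv f z l <->
  forall eps : R, (0 < eps)%R -> exists d : R, (0 < d)%R /\ forall y, (Cmod (y - z) < d)%R ->
    (Cmod (f y - f z - l * (y - z)) <= eps * Cmod (y - z))%R.
Proof.
rewrite cderiv_eps; split; intros H.
- intros eps He; destruct (H (mkposreal eps He)) as [d Hd]; exists d; split; [apply cond_pos | exact Hd].
- intros eps; destruct (H eps (cond_pos eps)) as [d [Hd1 Hd]]; exists (mkposreal d Hd1); exact Hd.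
Qed.

Lemma continuousP (f : C -> C) (z : C) :
  continuous f z <->
  forall eps : R, (0 < eps)%R -> exists d : R, (0 < d)%R /\
    forall y, (Cmod (y - z) < d)%R -> (Cmod (f y - f z) < eps)%R.
Proof.
rewrite continuous_CC; split; intros H.
- intros eps He; destruct (H (mkposreal eps He)) as [d Hd]; exists d; split; [apply cond_pos | exact Hd].
- intros eps; destruct (H eps (cond_pos eps)) as [d [Hd1 Hd]]; exists (mkposreal d Hd1); exact Hd.
Qed.

Lemma Rmin_pos (x y : R) : (0 < x -> 0 < y -> 0 < Rmin x y)%R.
Proof. intros; apply Rmin_glb_lt; auto. Qed.

Lemma cderiv_lipschitz (f : C -> C) (z l : C) : cderiv f z l ->
  exists d : R, (0 < d)%R /\ forall y, (Cmod (y - z) < d)%R ->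
    (Cmod (f y - f z) <= (Cmod l + 1) * Cmod (y - z))%R.
Proof.
intros H; apply cderivP with (eps := 1%R) in H; [ | lra].
destruct H as [d [Hd H]]; exists d; split; auto; intros y Hy; specialize (H y Hy).
generalize (Cmod_le_add (f y - f z) (l * (y - z))); rewrite Cmod_mult; lra.
Qed.

Lemma cderiv_continuous (f : C -> C) (z l : C) : cderiv f z l -> continuous f z.
Proof.
intros H; apply continuousP; intros eps He.
destruct (cderiv_lipschitz f z l H) as [d [Hd Hl]].
assert (0 < Cmod l + 1)%R by (generalize (Cmod_ge_0 l); lra).
exists (Rmin d (eps / (Cmod l + 1))); split.
- apply Rmin_pos; auto. now apply Rdiv_lt_0_compat.
- intros y Hy. eapply Rle_lt_trans; [apply Hl | ].
  + eapply Rlt_le_trans; [exact Hy | apply Rmin_l].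
  + assert (Cmod (y - z) < eps / (Cmod l + 1))%R by (eapply Rlt_le_trans; [exact Hy | apply Rmin_r]).
    apply Rmult_lt_compat_l with (r := (Cmod l + 1)%R) in H1; auto.
    replace ((Cmod l + 1) * (eps / (Cmod l + 1)))%R with eps in H1 by (field; lra). exact H1.
Qed.

Lemma cderiv_ext_loc (f g : C -> C) (z l : C) (d : R) : (0 < d)%R ->
  (forall y, (Cmod (y - z) < d)%R -> f y = g y) -> cderiv f z l -> cderiv g z l.
Proof.
intros Hd E H; apply cderivP; intros eps He.
destruct (proj1 (cderivP f z l) H eps He) as [d' [Hd' H']].
exists (Rmin d d'); split; [now apply Rmin_pos | ].
intros y Hy. rewrite <- !E.
- apply H'. eapply Rlt_le_trans; [exact Hy | apply Rmin_r].
- replace (z - z) with (RtoC 0) by ring. now rewrite Cmod_0.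
- eapply Rlt_le_trans; [exact Hy | apply Rmin_l].
Qed.

Lemma cderiv_ext (f g : C -> C) (z l : C) :
  (forall y, f y = g y) -> cderiv f z l -> cderiv g z l.
Proof. intros E; apply (cderiv_ext_loc f g z l 1); auto; lra. Qed.

Lemma cderiv_eq (f : C -> C) (z l m : C) : l = m -> cderiv f z l -> cderiv f z m.
Proof. now intros ->. Qed.

Lemma cderiv_unique (f : C -> C) (z l m : C) : cderiv f z l -> cderiv f z m -> l = m.
Proof.
intros H1 H2.
assert (E : Cmod (l - m) = 0%R).
{ apply Rle_antisym; [ | apply Cmod_ge_0].
  apply le_epsilon; intros eps He.
  destruct (proj1 (cderivP f z l) H1 (eps / 2)%R ltac:(lra)) as [d1 [Hd1 K1]].
  destruct (proj1 (cderivP f z m) H2 (eps / 2)%R ltac:(lra)) as [d2 [Hd2 K2]].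
  set (e := (Rmin d1 d2 / 2)%R).
  assert (He0 : (0 < e)%R) by (generalize (Rmin_pos _ _ Hd1 Hd2); unfold e; lra).
  assert (Hy : Cmod (z + RtoC e - z) = e).
  { replace (z + RtoC e - z) with (RtoC e) by ring. rewrite Cmod_R. apply Rabs_pos_eq; lra. }
  generalize (Rmin_l d1 d2) (Rmin_r d1 d2); intros L1 L2.
  specialize (K1 (z + RtoC e)); specialize (K2 (z + RtoC e)); rewrite Hy in K1, K2.
  specialize (K1 ltac:(unfold e; unfold e in He0; lra)).
  specialize (K2 ltac:(unfold e; unfold e in He0; lra)).
  assert (K : (Cmod ((l - m) * RtoC e) <= eps * e)%R).
  { replace ((l - m) * RtoC e) with ((f (z + RtoC e) - f z - m * (z + RtoC e - z)) + - (f (z + RtoC e) - f z - l * (z + RtoC e - z))) by ring.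
    eapply Rle_trans; [apply Cmod_triangle | ]. rewrite Cmod_opp. lra. }
  rewrite Cmod_mult, Cmod_R, (Rabs_pos_eq e) in K by lra.
  rewrite Rplus_0_l. apply Rmult_le_reg_r with e; auto. }
apply Cmod_eq_0 in E. replace l with ((l - m) + m) by ring. rewrite E; ring.
Qed.

Lemma cderiv_const (c z : C) : cderiv (fun _ => c) z 0.
Proof.
apply cderivP; intros eps He; exists 1%R; split; [lra | ]; intros y _.
replace (c - c - 0 * (y - z)) with (RtoC 0) by ring. rewrite Cmod_0.
apply Rmult_le_pos; [lra | apply Cmod_ge_0].
Qed.

Lemma cderiv_id (z : C) : cderiv (fun y => y) z 1.
Proof.
apply cderivP; intros eps He; exists 1%R; split; [lra | ]; intros y _.
replace (y - z - 1 * (y - z)) with (RtoC 0) by ring. rewrite Cmod_0.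
apply Rmult_le_pos; [lra | apply Cmod_ge_0].
Qed.

Lemma cderiv_plus (f g : C -> C) (z l m : C) :
  cderiv f z l -> cderiv g z m -> cderiv (fun y => f y + g y) z (l + m).
Proof.
intros H1 H2; apply cderivP; intros eps He.
destruct (proj1 (cderivP f z l) H1 (eps / 2)%R ltac:(lra)) as [d1 [Hd1 K1]].
destruct (proj1 (cderivP g z m) H2 (eps / 2)%R ltac:(lra)) as [d2 [Hd2 K2]].
exists (Rmin d1 d2); split; [now apply Rmin_pos | ]; intros y Hy.
generalize (Rmin_l d1 d2) (Rmin_r d1 d2); intros L1 L2.
specialize (K1 y ltac:(lra)); specialize (K2 y ltac:(lra)).
replace (f y + g y - (f z + g z) - (l + m) * (y - z)) with
  ((f y - f z - l * (y - z)) + (g y - g z - m * (y - z))) by ring.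
eapply Rle_trans; [apply Cmod_triangle | lra].
Qed.

Lemma cderiv_mult (f g : C -> C) (z l m : C) :
  cderiv f z l -> cderiv g z m -> cderiv (fun y => f y * g y) z (l * g z + f z * m).
Proof.
intros H1 H2; apply cderivP; intros eps He.
(* [M] dominates each of the three factors that multiply an error term; the summand 1 absorbs the
   passage from [g z] to [g y]. *)
set (M := (Cmod (g z) + 1 + Cmod l + Cmod (f z))%R).
assert (HM : (1 <= M)%R) by (unfold M; generalize (Cmod_ge_0 (g z)) (Cmod_ge_0 l) (Cmod_ge_0 (f z)); lra).
assert (He' : (0 < eps / (3 * M))%R) by (apply Rdiv_lt_0_compat; lra).
set (e := Rmin (eps / (3 * M))%R 1%R).
assert (He0 : (0 < e)%R) by (apply Rmin_pos; lra).
destruct (proj1 (cderivP f z l) H1 e He0) as [d1 [Hd1 K1]].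
destruct (proj1 (cderivP g z m) H2 e He0) as [d2 [Hd2 K2]].
destruct (proj1 (continuousP g z) (cderiv_continuous _ _ _ H2) e He0) as [d3 [Hd3 K3]].
exists (Rmin d1 (Rmin d2 d3)); split; [repeat apply Rmin_pos; auto | ]; intros y Hy.
generalize (Rmin_l d1 (Rmin d2 d3)) (Rmin_r d1 (Rmin d2 d3)) (Rmin_l d2 d3) (Rmin_r d2 d3); intros L1 L2 L3 L4.
specialize (K1 y ltac:(lra)); specialize (K2 y ltac:(lra)); specialize (K3 y ltac:(lra)).
assert (Ee : (e * M <= eps / 3)%R).
{ apply Rle_trans with (eps / (3 * M) * M)%R; [ | right; field; lra].
  apply Rmult_le_compat_r; [lra | apply Rmin_l]. }
assert (E1 : (e <= 1)%R) by apply Rmin_r.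
replace (f y * g y - f z * g z - (l * g z + f z * m) * (y - z)) with
  ((f y - f z - l * (y - z)) * g y + ((l * (y - z)) * (g y - g z) + f z * (g y - g z - m * (y - z)))) by ring.
eapply Rle_trans; [apply Cmod_triangle | ].
eapply Rle_trans; [apply Rplus_le_compat_l, Cmod_triangle | ].
rewrite !Cmod_mult.
assert (Gy : (Cmod (g y) <= M)%R).
{ generalize (Cmod_le_add (g y) (g z)); unfold M; generalize (Cmod_ge_0 l) (Cmod_ge_0 (f z)); lra. }
assert (Ml : (Cmod l <= M)%R) by (unfold M; generalize (Cmod_ge_0 (g z)) (Cmod_ge_0 (f z)); lra).
assert (Mf : (Cmod (f z) <= M)%R) by (unfold M; generalize (Cmod_ge_0 (g z)) (Cmod_ge_0 l); lra).
set (D := Cmod (y - z)) in *. assert (HD : (0 <= D)%R) by apply Cmod_ge_0.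
assert (A1 : (Cmod (f y - f z - l * (y - z)) * Cmod (g y) <= (e * D) * M)%R)
  by (apply Rmult_le_compat; auto; apply Cmod_ge_0).
assert (A2 : (Cmod l * D * Cmod (g y - g z) <= M * D * e)%R).
{ apply Rmult_le_compat; [apply Rmult_le_pos; auto; apply Cmod_ge_0 | apply Cmod_ge_0 | | lra].
  apply Rmult_le_compat_r; auto. }
assert (A3 : (Cmod (f z) * Cmod (g y - g z - m * (y - z)) <= M * (e * D))%R)
  by (apply Rmult_le_compat; auto; apply Cmod_ge_0).
assert (A4 : (e * M * D <= eps / 3 * D)%R) by (apply Rmult_le_compat_r; auto).
nra.
Qed.

Lemma cderiv_comp (f g : C -> C) (z l m : C) :
  cderiv f (g z) l -> cderiv g z m -> cderiv (fun y => f (g y)) z (l * m).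
Proof.
intros H1 H2; apply cderivP; intros eps He.
destruct (cderiv_lipschitz _ _ _ H2) as [d1 [Hd1 K1]].
generalize (Cmod_ge_0 m) (Cmod_ge_0 l); intros Pm Pl.
assert (He1 : (0 < eps / (2 * (Cmod m + 1)))%R) by (apply Rdiv_lt_0_compat; lra).
assert (He2 : (0 < eps / (2 * (Cmod l + 1)))%R) by (apply Rdiv_lt_0_compat; lra).
destruct (proj1 (cderivP _ _ _) H1 _ He1) as [d2 [Hd2 K2]].
destruct (proj1 (cderivP _ _ _) H2 _ He2) as [d3 [Hd3 K3]].
destruct (proj1 (continuousP g z) (cderiv_continuous _ _ _ H2) d2 Hd2) as [d4 [Hd4 K4]].
exists (Rmin (Rmin d1 d3) d4); split; [repeat apply Rmin_pos; auto | ]; intros y Hy.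
generalize (Rmin_l (Rmin d1 d3) d4) (Rmin_r (Rmin d1 d3) d4) (Rmin_l d1 d3) (Rmin_r d1 d3); intros L1 L2 L3 L4.
specialize (K1 y ltac:(lra)); specialize (K3 y ltac:(lra)); specialize (K4 y ltac:(lra)).
specialize (K2 _ K4).
replace (f (g y) - f (g z) - l * m * (y - z)) with
  ((f (g y) - f (g z) - l * (g y - g z)) + l * (g y - g z - m * (y - z))) by ring.
eapply Rle_trans; [apply Cmod_triangle | ]. rewrite Cmod_mult.
set (D := Cmod (y - z)) in *. assert (HD : (0 <= D)%R) by apply Cmod_ge_0.
assert (A1 : (eps / (2 * (Cmod m + 1)) * Cmod (g y - g z) <= eps / 2 * D)%R).
{ apply Rle_trans with (eps / (2 * (Cmod m + 1)) * ((Cmod m + 1) * D))%R.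
  - apply Rmult_le_compat_l; lra.
  - right; field; lra. }
assert (A2 : (Cmod l * Cmod (g y - g z - m * (y - z)) <= (Cmod l + 1) * (eps / (2 * (Cmod l + 1)) * D))%R).
{ apply Rmult_le_compat; auto; try lra; apply Cmod_ge_0. }
replace ((Cmod l + 1) * (eps / (2 * (Cmod l + 1)) * D))%R with (eps / 2 * D)%R in A2 by (field; lra).
lra.
Qed.

Lemma Cinv_nonzero (z : C) : z <> 0 -> / z <> 0.
Proof.
intros H E. apply C1_nz. rewrite <- (Cinv_r z H), E. ring.
Qed.

Lemma cderiv_Cinv (w : C) : w <> 0 -> cderiv (fun y => / y) w (- / (w * w)).
Proof.
intros Hw; apply cderivP; intros eps He.
assert (Pw : (0 < Cmod w)%R) by now apply Cmod_gt_0.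
set (W := Cmod w) in *.
exists (Rmin (W / 2) (eps * (W * W * W) / 2)); split.
- apply Rmin_pos; [lra | ]. repeat apply Rmult_lt_0_compat; auto; lra.
- intros y Hy.
  generalize (Rmin_l (W / 2) (eps * (W * W * W) / 2)) (Rmin_r (W / 2) (eps * (W * W * W) / 2)); intros L1 L2.
  assert (Py : (W / 2 < Cmod y)%R).
  { generalize (Cmod_le_add w y); rewrite Cmod_sub_sym; fold W; lra. }
  assert (Hy0 : y <> 0) by (apply Cmod_gt_0; lra).
  replace (/ y - / w - - / (w * w) * (y - w)) with ((y - w) * (y - w) / (w * w * y)) by (field; auto).
  rewrite Cmod_div by (repeat apply Cmult_neq_0; auto).
  rewrite !Cmod_mult; fold W.
  set (D := Cmod (y - w)) in *. assert (HD : (0 <= D)%R) by apply Cmod_ge_0.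
  assert (WW : (0 < W * W)%R) by now apply Rmult_lt_0_compat.
  assert (A : (0 < W * W * Cmod y)%R) by (apply Rmult_lt_0_compat; auto; lra).
  apply Rmult_le_reg_r with (W * W * Cmod y)%R; auto.
  replace (D * D / (W * W * Cmod y) * (W * W * Cmod y))%R with (D * D)%R by (field; split; lra).
  assert (D <= eps * (W * W * Cmod y))%R.
  { apply Rle_trans with (eps * (W * W * W) / 2)%R; [lra | ].
    assert (W * W * (W / 2) <= W * W * Cmod y)%R by (apply Rmult_le_compat_l; lra).
    apply Rmult_le_compat_l with (r := eps) in H; [ | lra]. lra. }
  apply Rmult_le_compat_l with (r := D) in H; auto. lra.
Qed.

Lemma cderiv_opp (f : C -> C) (z l : C) : cderiv f z l -> cderiv (fun y => - f y) z (- l).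
Proof.
intros H. apply cderiv_ext with (fun y => (- (1)) * f y); [intros; ring | ].
apply cderiv_eq with (0 * f z + (- (1)) * l); [ring | ].
apply (cderiv_mult (fun _ => - (1))); [apply cderiv_const | auto].
Qed.

Lemma cderiv_minus (f g : C -> C) (z l m : C) :
  cderiv f z l -> cderiv g z m -> cderiv (fun y => f y - g y) z (l - m).
Proof. intros; apply cderiv_plus; auto. now apply cderiv_opp. Qed.

Lemma cderiv_scal (c : C) (f : C -> C) (z l : C) : cderiv f z l -> cderiv (fun y => c * f y) z (c * l).
Proof.
intros H. apply cderiv_eq with (0 * f z + c * l); [ring | ].
apply (cderiv_mult (fun _ => c)); [apply cderiv_const | auto].
Qed.

Lemma cderiv_inv (f : C -> C) (z l : C) : f z <> 0 -> cderiv f z l ->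
  cderiv (fun y => / f y) z (- l / (f z * f z)).
Proof.
intros H0 H. apply cderiv_eq with (- / (f z * f z) * l); [field; auto | ].
apply (cderiv_comp (fun y => / y)); auto. now apply cderiv_Cinv.
Qed.

Lemma cderiv_div (f g : C -> C) (z l m : C) : g z <> 0 -> cderiv f z l -> cderiv g z m ->
  cderiv (fun y => f y / g y) z ((l * g z - f z * m) / (g z * g z)).
Proof.
intros H0 H1 H2. apply cderiv_eq with (l * / g z + f z * (- m / (g z * g z))); [field; auto | ].
apply (cderiv_mult f (fun y => / g y)); auto. now apply cderiv_inv.
Qed.

Lemma cderiv_pow (f : C -> C) (z l : C) (n : nat) : cderiv f z l ->
  cderiv (fun y => f y ^ n) z (INR n * f z ^ (pred n) * l).
Proof.
intros H; induction n as [ | n IH].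
- apply cderiv_eq with (RtoC 0); [simpl; ring | ]. apply (cderiv_const 1).
- apply cderiv_eq with (l * f z ^ n + f z * (INR n * f z ^ (pred n) * l)).
  + rewrite S_INR, RtoC_plus. destruct n; simpl; ring.
  + apply (cderiv_mult f (fun y => f y ^ n)); auto.
Qed.

(** * Continuity of complex-valued maps on an arbitrary uniform space *)

Lemma continuous_Cplus {U : UniformSpace} (f g : U -> C) (x : U) :
  continuous f x -> continuous g x -> continuous (fun y => f y + g y) x.
Proof. intros; apply (continuous_plus (V := C_R_NormedModule) f g); auto. Qed.

Lemma continuous_Copp {U : UniformSpace} (f : U -> C) (x : U) :
  continuous f x -> continuous (fun y => - f y) x.
Proof. intros; apply (continuous_opp (V := C_R_NormedModule) f); auto. Qed.

Lemma continuous_Cminus {U : UniformSpace} (f g : U -> C) (x : U) :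
  continuous f x -> continuous g x -> continuous (fun y => f y - g y) x.
Proof. intros; apply continuous_Cplus; auto. now apply continuous_Copp. Qed.

Lemma continuous_Cpair {U : UniformSpace} (f g : U -> R) (x : U) :
  continuous f x -> continuous g x -> @continuous U C_UniformSpace (fun y => (f y, g y)) x.
Proof.
intros Hf Hg. apply (continuous_comp_2 f g (fun a b => (a, b) : C) x); auto.
intros P HP; apply filter_imp with (2 := HP). intros [a b]; auto.
Qed.

Lemma continuous_Re {U : UniformSpace} (f : U -> C) (x : U) :
  @continuous U C_UniformSpace f x -> continuous (fun y => Re (f y)) x.
Proof. intros H; apply (continuous_comp f (fun p : C => fst p)); auto. apply continuous_fst. Qed.

Lemma continuous_Im {U : UniformSpace} (f : U -> C) (x : U) :
  @continuous U C_UniformSpace f x -> continuous (fun y => Im (f y)) x.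
Proof. intros H; apply (continuous_comp f (fun p : C => snd p)); auto. apply continuous_snd. Qed.

Lemma continuous_RtoC {U : UniformSpace} (f : U -> R) (x : U) :
  continuous f x -> @continuous U C_UniformSpace (fun y => RtoC (f y)) x.
Proof. intros H; apply continuous_Cpair; auto. apply continuous_const. Qed.

Lemma continuous_Cmult {U : UniformSpace} (f g : U -> C) (x : U) :
  @continuous U C_UniformSpace f x -> @continuous U C_UniformSpace g x ->
  @continuous U C_UniformSpace (fun y => f y * g y) x.
Proof.
intros Hf Hg; apply continuous_Cpair.
- apply (continuous_minus (V := R_NormedModule)); apply (continuous_mult (K := R_AbsRing));
   apply continuous_Re || apply continuous_Im; auto.
- apply (continuous_plus (V := R_NormedModule)); apply (continuous_mult (K := R_AbsRing));
   apply continuous_Re || apply continuous_Im; auto.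
Qed.

Lemma continuous_Cinv {U : UniformSpace} (f : U -> C) (x : U) :
  f x <> 0 -> @continuous U C_UniformSpace f x -> @continuous U C_UniformSpace (fun y => / f y) x.
Proof.
intros H0 H. apply (continuous_comp f Cinv); auto.
eapply cderiv_continuous, cderiv_Cinv, H0.
Qed.

Lemma continuous_Cpow {U : UniformSpace} (f : U -> C) (x : U) (n : nat) :
  @continuous U C_UniformSpace f x -> @continuous U C_UniformSpace (fun y => f y ^ n) x.
Proof.
intros H; induction n; simpl; [apply continuous_const | now apply continuous_Cmult].
Qed.

(** * The exponential *)

Lemma Cexp_add (x y : C) : Cexp (x + y) = Cexp x * Cexp y.
Proof.
destruct x as [a b], y as [c d]; unfold Cexp, Cmult, Cplus, Re, Im; simpl.
rewrite exp_plus, cos_plus, sin_plus; f_equal; ring.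
Qed.

Lemma Cexp_0 : Cexp 0 = 1.
Proof. unfold Cexp, RtoC, Re, Im; simpl. rewrite exp_0, cos_0, sin_0. f_equal; ring. Qed.

Lemma Cmod_Cexp (z : C) : Cmod (Cexp z) = exp (Re z).
Proof.
unfold Cmod, Cexp; simpl.
replace (_ + _)%R with (Rsqr (exp (Re z)) * (Rsqr (sin (Im z)) + Rsqr (cos (Im z))))%R by (unfold Rsqr; ring).
rewrite sin2_cos2, Rmult_1_r. apply sqrt_Rsqr. left; apply exp_pos.
Qed.

Lemma Cexp_neq_0 (z : C) : Cexp z <> 0.
Proof. apply Cmod_gt_0; rewrite Cmod_Cexp; apply exp_pos. Qed.

Lemma Cexp_opp (z : C) : Cexp (- z) = / Cexp z.
Proof.
assert (E : Cexp z * Cexp (- z) = 1) by (rewrite <- Cexp_add, <- Cexp_0; f_equal; ring).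
rewrite <- (Cmult_1_l (/ Cexp z)), <- E. field. apply Cexp_neq_0.
Qed.

Lemma Cexp_minus (x y : C) : Cexp (x - y) = Cexp x / Cexp y.
Proof. unfold Cminus, Cdiv; now rewrite Cexp_add, Cexp_opp. Qed.

Lemma derivable_pt_lim_linear (f : R -> R) (x l : R) : derivable_pt_lim f x l ->
  forall eps, (0 < eps)%R -> exists d, (0 < d)%R /\ forall h, (Rabs h < d)%R ->
    (Rabs (f (x + h) - f x - l * h) <= eps * Rabs h)%R.
Proof.
intros H eps He; destruct (H eps He) as [d Hd].
exists d; split; [apply cond_pos | ]; intros h Hh.
destruct (Req_dec h 0) as [-> | h0].
- rewrite Rplus_0_r, Rabs_R0. replace (f x - f x - l * 0)%R with 0%R by ring. rewrite Rabs_R0; lra.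
- specialize (Hd h h0 Hh).
  replace (f (x + h) - f x - l * h)%R with (((f (x + h) - f x) / h - l) * h)%R by (field; auto).
  rewrite Rabs_mult. apply Rmult_le_compat_r; [apply Rabs_pos | lra].
Qed.

(** Componentwise, from the derivatives of [exp], [sin] and [cos] at 0: for instance
    [exp x * cos y - 1 - x] is [exp x * (cos y - 1) + (exp x - 1 - x)]. The addition formula then
    carries differentiability from 0 to every point. *)
Lemma Cexp_linear_at_0 (eps : R) : (0 < eps)%R -> exists d, (0 < d)%R /\
  forall h, (Cmod h < d)%R -> (Cmod (Cexp h - 1 - h) <= eps * Cmod h)%R.
Proof.
intros He.
set (e := Rmin (eps / 8) 1).
assert (He0 : (0 < e)%R) by (apply Rmin_pos; lra).
assert (e <= 1 /\ e <= eps / 8)%R as [E1 E2] by (split; [apply Rmin_r | apply Rmin_l]).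
destruct (derivable_pt_lim_linear exp 0 1 derivable_pt_lim_exp_0 e He0) as [d1 [P1 H1]].
destruct (derivable_pt_lim_linear sin 0 1) with (eps := e) as [d2 [P2 H2]]; auto.
{ apply derivable_pt_lim_sin_0. }
destruct (derivable_pt_lim_linear cos 0 0) with (eps := e) as [d3 [P3 H3]]; auto.
{ generalize (derivable_pt_lim_cos 0). now rewrite sin_0, Ropp_0. }
exists (Rmin (Rmin d1 d2) (Rmin d3 (e/2))); split; [repeat apply Rmin_pos; auto; lra | ].
intros h Hh.
generalize (Rmin_l (Rmin d1 d2) (Rmin d3 (e/2))) (Rmin_r (Rmin d1 d2) (Rmin d3 (e/2)))
  (Rmin_l d1 d2) (Rmin_r d1 d2) (Rmin_l d3 (e/2)) (Rmin_r d3 (e/2)); intros L1 L2 L3 L4 L5 L6.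
generalize (re_le_Cmod h) (im_le_Cmod h); intros R1 R2.
destruct h as [x y]; unfold Re, Im in *; simpl in R1, R2.
set (m := Cmod (x, y)) in *.
specialize (H1 x ltac:(lra)); specialize (H2 y ltac:(lra)); specialize (H3 y ltac:(lra)).
rewrite !Rplus_0_l, exp_0, Rmult_1_l in H1.
rewrite !Rplus_0_l, sin_0, Rmult_1_l, Rminus_0_r in H2.
rewrite !Rplus_0_l, cos_0, Rmult_0_l, Rminus_0_r in H3.
generalize (Rabs_pos x) (Rabs_pos y); intros.
assert (Ex : (Rabs (exp x - 1) <= 2 * Rabs x)%R).
{ replace (exp x - 1)%R with ((exp x - 1 - x) + x)%R by ring.
  eapply Rle_trans; [apply Rabs_triang | ].
  assert (e * Rabs x <= 1 * Rabs x)%R by (apply Rmult_le_compat_r; auto). lra. }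
assert (Ex2 : (exp x <= 2)%R) by (generalize (Rle_abs (exp x - 1)); lra).
generalize (exp_pos x); intros.
assert (M1 : (e * Rabs x <= e * m)%R) by (apply Rmult_le_compat_l; lra).
assert (M2 : (e * Rabs y <= e * m)%R) by (apply Rmult_le_compat_l; lra).
assert (M3 : (0 <= e * m)%R) by (apply Rle_trans with (e * Rabs x)%R; auto; apply Rmult_le_pos; lra).
assert (M4 : (e * m <= eps / 8 * m)%R) by (apply Rmult_le_compat_r; lra).
assert (A1 : (Rabs (exp x * cos y - 1 - x) <= 3 * (e * m))%R).
{ replace (exp x * cos y - 1 - x)%R with (exp x * (cos y - 1) + (exp x - 1 - x))%R by ring.
  eapply Rle_trans; [apply Rabs_triang | ].
  rewrite Rabs_mult, (Rabs_pos_eq (exp x)) by lra.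
  assert (exp x * Rabs (cos y - 1) <= 2 * (e * m))%R
    by (apply Rmult_le_compat; auto; try lra; apply Rabs_pos). lra. }
assert (A2 : (Rabs (exp x * sin y - y) <= 3 * (e * m))%R).
{ replace (exp x * sin y - y)%R with (exp x * (sin y - y) + (exp x - 1) * y)%R by ring.
  eapply Rle_trans; [apply Rabs_triang | ].
  rewrite !Rabs_mult, (Rabs_pos_eq (exp x)) by lra.
  assert (exp x * Rabs (sin y - y) <= 2 * (e * m))%R
    by (apply Rmult_le_compat; auto; try lra; apply Rabs_pos).
  assert (Rabs (exp x - 1) * Rabs y <= e * m)%R
    by (apply Rmult_le_compat; auto; try lra; apply Rabs_pos). lra. }
eapply Rle_trans; [apply Cmod_le_Re_Im | ].
replace (Re (Cexp (x, y) - 1 - (x, y))) with (exp x * cos y - 1 - x)%R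
  by (unfold Cexp, Cminus, Cplus, Copp, RtoC, Re, Im; simpl; ring).
replace (Im (Cexp (x, y) - 1 - (x, y))) with (exp x * sin y - y)%R
  by (unfold Cexp, Cminus, Cplus, Copp, RtoC, Re, Im; simpl; ring).
lra.
Qed.

Lemma cderiv_Cexp (z : C) : cderiv Cexp z (Cexp z).
Proof.
apply cderivP; intros eps He.
assert (P : (0 < Cmod (Cexp z))%R) by apply Cmod_gt_0, Cexp_neq_0.
destruct (Cexp_linear_at_0 (eps / Cmod (Cexp z))) as [d [Hd H]]; [now apply Rdiv_lt_0_compat | ].
exists d; split; auto; intros y Hy; specialize (H _ Hy).
replace (Cexp y - Cexp z - Cexp z * (y - z)) with (Cexp z * (Cexp (y - z) - 1 - (y - z))).
- rewrite Cmod_mult. apply Rmult_le_compat_l with (r := Cmod (Cexp z)) in H; [ | lra].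
  replace (Cmod (Cexp z) * (eps / Cmod (Cexp z) * Cmod (y - z)))%R with (eps * Cmod (y - z))%R in H by (field; lra).
  exact H.
- rewrite Cexp_minus. field. apply Cexp_neq_0.
Qed.

Lemma cderiv_exp (f : C -> C) (z l : C) : cderiv f z l ->
  cderiv (fun y => Cexp (f y)) z (Cexp (f z) * l).
Proof. intros H; apply (cderiv_comp Cexp f); auto. apply cderiv_Cexp. Qed.

Lemma continuous_Cexp {U : UniformSpace} (f : U -> C) (x : U) :
  @continuous U C_UniformSpace f x -> @continuous U C_UniformSpace (fun y => Cexp (f y)) x.
Proof.
intros H; apply (continuous_comp f Cexp); auto. eapply cderiv_continuous, cderiv_Cexp.
Qed.

(* A continuous logarithm is differentiable, because [Cexp] is a local homeomorphism. *)
Lemma cderiv_log_branch (f g : C -> C) (z l : C) (d0 : R) : (0 < d0)%R ->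
  (forall y, (Cmod (y - z) < d0)%R -> Cexp (g y) = f y) ->
  continuous g z -> cderiv f z l -> cderiv g z (l / f z).
Proof.
intros Hd0 E Hg Hf.
assert (Ez : Cexp (g z) = f z).
{ apply E. replace (z - z) with (RtoC 0) by ring. now rewrite Cmod_0. }
assert (F0 : f z <> 0) by (rewrite <- Ez; apply Cexp_neq_0).
assert (PF : (0 < Cmod (f z))%R) by now apply Cmod_gt_0.
set (m := l / f z).
apply cderivP; intros eps He.
generalize (Cmod_ge_0 m); intros Pm.
set (e := Rmin (1/2) (eps / (4 * (Cmod m + 1)))).
assert (He0 : (0 < e)%R) by (apply Rmin_pos; [lra | apply Rdiv_lt_0_compat; lra]).
destruct (Cexp_linear_at_0 e He0) as [d1 [P1 H1]].
destruct (proj1 (continuousP g z) Hg d1 P1) as [d2 [P2 H2]].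
assert (Q : (0 < Rmin 1 (eps / 2) * Cmod (f z))%R)
  by (apply Rmult_lt_0_compat; auto; apply Rmin_pos; lra).
destruct (proj1 (cderivP f z l) Hf _ Q) as [d3 [P3 H3]].
exists (Rmin d0 (Rmin d2 d3)); split; [repeat apply Rmin_pos; auto | ]; intros y Hy.
generalize (Rmin_l d0 (Rmin d2 d3)) (Rmin_r d0 (Rmin d2 d3)) (Rmin_l d2 d3) (Rmin_r d2 d3); intros L1 L2 L3 L4.
specialize (H2 y ltac:(lra)); specialize (H3 y ltac:(lra)); specialize (H1 _ H2).
set (D := Cmod (y - z)) in *. assert (HD : (0 <= D)%R) by apply Cmod_ge_0.
set (d := g y - g z) in *.
assert (Ed : Cexp d - 1 = (f y - f z) / f z).
{ unfold d; rewrite Cexp_minus, Ez, (E y) by (fold D; lra). field; auto. }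
assert (K : (Cmod (Cexp d - 1 - m * (y - z)) <= Rmin 1 (eps / 2) * D)%R).
{ rewrite Ed. replace ((f y - f z) / f z - m * (y - z)) with ((f y - f z - l * (y - z)) / f z)
   by (unfold m; field; auto).
  rewrite Cmod_div by auto. apply Rmult_le_reg_r with (Cmod (f z)); auto.
  replace (Cmod (f y - f z - l * (y - z)) / Cmod (f z) * Cmod (f z))%R with (Cmod (f y - f z - l * (y - z))) by (field; lra).
  lra. }
(* A crude bound comes before the sharp one: [Cexp d - 1] differs from [d] by at most half of
   [Cmod d], so [d] is controlled by the increment of [f], and an error [e * Cmod d] becomes an
   error in [Cmod (y - z)]. *)
assert (Kd : (Cmod d <= 2 * (Cmod m + 1) * D)%R).
{ assert (Cmod (Cexp d - 1) <= (Cmod m + 1) * D)%R.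
  { generalize (Cmod_le_add (Cexp d - 1) (m * (y - z))); rewrite Cmod_mult; fold D.
    assert (Rmin 1 (eps / 2) * D <= 1 * D)%R by (apply Rmult_le_compat_r; auto; apply Rmin_l). lra. }
  generalize (Cmod_le_add d (Cexp d - 1)). rewrite (Cmod_sub_sym d).
  assert (e * Cmod d <= 1/2 * Cmod d)%R by (apply Rmult_le_compat_r; [apply Cmod_ge_0 | apply Rmin_l]). lra. }
replace (d - m * (y - z)) with ((Cexp d - 1 - m * (y - z)) + - (Cexp d - 1 - d)) by ring.
eapply Rle_trans; [apply Cmod_triangle | ]. rewrite Cmod_opp.
assert (Rmin 1 (eps / 2) * D <= eps / 2 * D)%R by (apply Rmult_le_compat_r; auto; apply Rmin_r).
assert (e * Cmod d <= eps / (4 * (Cmod m + 1)) * (2 * (Cmod m + 1) * D))%R.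
{ apply Rmult_le_compat; auto; [lra | apply Cmod_ge_0 | apply Rmin_r]. }
replace (eps / (4 * (Cmod m + 1)) * (2 * (Cmod m + 1) * D))%R with (eps / 2 * D)%R in H0 by (field; lra).
lra.
Qed.

(** * Paths and the mean value inequality *)

Lemma norm_C_R (x : C) : @norm R_AbsRing C_R_NormedModule x = Cmod x.
Proof.
destruct x as [a b]. unfold norm; simpl; unfold prod_norm, Cmod, norm; simpl; unfold abs; simpl.
f_equal. rewrite !Rmult_1_r. rewrite <- !Rabs_mult, !Rabs_pos_eq; auto; apply Rle_0_sqr.
Qed.

Lemma is_derive_CP (F : R -> C) (t : R) (l : C) :
  @is_derive R_AbsRing C_R_NormedModule F t l <->
  forall eps : R, (0 < eps)%R -> exists d : R, (0 < d)%R /\ forall s, (Rabs (s - t) < d)%R ->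
    (Cmod (F s - F t - RtoC (s - t) * l) <= eps * Rabs (s - t))%R.
Proof.
assert (N : forall s, Cmod (F s - F t - RtoC (s - t) * l) =
  @norm R_AbsRing C_R_NormedModule (minus (minus (F s) (F t)) (scal (minus s t) l))).
{ intros s. rewrite norm_C_R.
  f_equal. destruct (F s), (F t), l; unfold minus, plus, opp, scal; simpl.
  unfold mult, minus, plus, opp, Cminus, Cmult, Cplus, Copp, RtoC; simpl. unfold scal; simpl; unfold mult; simpl. f_equal; ring. }
split.
- intros [_ H] eps He.
  destruct (H t (fun P HP => HP) (mkposreal eps He)) as [d Hd].
  exists d; split; [apply cond_pos | ]; intros s Hs. rewrite N. exact (Hd s Hs).
- intros H; split; [apply is_linear_scal_l | ].
  intros x Hx.
  assert (x = t) as ->.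
  { apply (is_filter_lim_locally_unique (V := R_NormedModule)) in Hx; auto. }
  intros [eps He]; destruct (H eps He) as [d [Hd K]].
  exists (mkposreal d Hd); intros s Hs. specialize (K s Hs). rewrite N in K. exact K.
Qed.

Lemma is_derive_C_pair (x y : R -> R) (t a b : R) : is_derive x t a -> is_derive y t b ->
  @is_derive R_AbsRing C_R_NormedModule (fun s => (x s, y s)) t (a, b).
Proof.
intros Hx Hy. apply is_derive_Reals in Hx; apply is_derive_Reals in Hy.
apply is_derive_CP; intros eps He.
destruct (derivable_pt_lim_linear _ _ _ Hx (eps / 2)%R ltac:(lra)) as [d1 [P1 H1]].
destruct (derivable_pt_lim_linear _ _ _ Hy (eps / 2)%R ltac:(lra)) as [d2 [P2 H2]].
exists (Rmin d1 d2); split; [now apply Rmin_pos | ]; intros s Hs.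
generalize (Rmin_l d1 d2) (Rmin_r d1 d2); intros L1 L2.
specialize (H1 (s - t)%R ltac:(lra)); specialize (H2 (s - t)%R ltac:(lra)).
replace (t + (s - t))%R with s in H1, H2 by ring.
eapply Rle_trans; [apply Cmod_le_Re_Im | ].
unfold Cminus, Cplus, Copp, Cmult, RtoC, Re, Im; simpl.
replace (x s + - x t + - ((s - t) * a - 0 * b))%R with (x s - x t - a * (s - t))%R by ring.
replace (y s + - y t + - ((s - t) * b + 0 * a))%R with (y s - y t - b * (s - t))%R by ring.
lra.
Qed.

Lemma is_derive_C_comp (f : C -> C) (p : R -> C) (t : R) (l q : C) :
  cderiv f (p t) l -> @is_derive R_AbsRing C_R_NormedModule p t q ->
  @is_derive R_AbsRing C_R_NormedModule (fun s => f (p s)) t (l * q).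
Proof.
intros Hf Hp. apply is_derive_CP; intros eps He.
generalize (Cmod_ge_0 l) (Cmod_ge_0 q); intros Pl Pq.
assert (He1 : (0 < eps / (2 * (Cmod q + 1)))%R) by (apply Rdiv_lt_0_compat; lra).
destruct (proj1 (cderivP _ _ _) Hf _ He1) as [d1 [P1 H1]].
assert (He2 : (0 < Rmin 1 (eps / (2 * (Cmod l + 1))))%R) by (apply Rmin_pos; [lra | apply Rdiv_lt_0_compat; lra]).
destruct (proj1 (is_derive_CP _ _ _) Hp _ He2) as [d2 [P2 H2]].
assert (He3 : (0 < d1 / (Cmod q + 1))%R) by (apply Rdiv_lt_0_compat; lra).
exists (Rmin d2 (d1 / (Cmod q + 1))); split; [now apply Rmin_pos | ]; intros s Hs.
generalize (Rmin_l d2 (d1 / (Cmod q + 1))) (Rmin_r d2 (d1 / (Cmod q + 1))); intros L1 L2.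
specialize (H2 s ltac:(lra)).
set (D := Rabs (s - t)) in *. assert (HD : (0 <= D)%R) by apply Rabs_pos.
assert (B : (Cmod (p s - p t) <= (Cmod q + 1) * D)%R).
{ generalize (Cmod_le_add (p s - p t) (RtoC (s - t) * q)). rewrite Cmod_mult, Cmod_R. fold D.
  assert (Rmin 1 (eps / (2 * (Cmod l + 1))) * D <= 1 * D)%R by (apply Rmult_le_compat_r; auto; apply Rmin_l). lra. }
assert (B1 : (Cmod (p s - p t) < d1)%R).
{ assert (D < d1 / (Cmod q + 1))%R by lra.
  apply Rmult_lt_compat_l with (r := (Cmod q + 1)%R) in H; [ | lra].
  replace ((Cmod q + 1) * (d1 / (Cmod q + 1)))%R with d1 in H by (field; lra). lra. }
specialize (H1 _ B1).
replace (f (p s) - f (p t) - RtoC (s - t) * (l * q)) with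
 ((f (p s) - f (p t) - l * (p s - p t)) + l * (p s - p t - RtoC (s - t) * q)) by ring.
eapply Rle_trans; [apply Cmod_triangle | ]. rewrite Cmod_mult.
assert (A1 : (eps / (2 * (Cmod q + 1)) * Cmod (p s - p t) <= eps / (2 * (Cmod q + 1)) * ((Cmod q + 1) * D))%R)
  by (apply Rmult_le_compat_l; lra).
replace (eps / (2 * (Cmod q + 1)) * ((Cmod q + 1) * D))%R with (eps / 2 * D)%R in A1 by (field; lra).
assert (A2 : (Cmod l * Cmod (p s - p t - RtoC (s - t) * q) <= (Cmod l + 1) * (eps / (2 * (Cmod l + 1)) * D))%R).
{ apply Rmult_le_compat; auto; try lra; [apply Cmod_ge_0 | ].
  eapply Rle_trans; [exact H2 | ]. apply Rmult_le_compat_r; auto; apply Rmin_r. }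
replace ((Cmod l + 1) * (eps / (2 * (Cmod l + 1)) * D))%R with (eps / 2 * D)%R in A2 by (field; lra).
lra.
Qed.

Lemma is_derive_C_line (a d : C) (t : R) :
  @is_derive R_AbsRing C_R_NormedModule (fun s => a + RtoC s * d) t d.
Proof.
apply is_derive_CP; intros eps He; exists 1%R; split; [lra | ]; intros s _.
replace (a + RtoC s * d - (a + RtoC t * d) - RtoC (s - t) * d) with (RtoC 0) by (rewrite RtoC_minus; ring).
rewrite Cmod_0. apply Rmult_le_pos; [lra | apply Rabs_pos].
Qed.

Lemma is_derive_C_Re (F : R -> C) (t : R) (l : C) :
  @is_derive R_AbsRing C_R_NormedModule F t l -> is_derive (fun s => Re (F s)) t (Re l).
Proof.
intros H. apply is_derive_Reals. intros eps He.
destruct (proj1 (is_derive_CP _ _ _) H (eps / 2)%R ltac:(lra)) as [d [Hd K]].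
exists (mkposreal d Hd); intros h h0 Hh. simpl in Hh.
specialize (K (t + h)%R). replace (t + h - t)%R with h in K by ring. specialize (K Hh).
replace ((Re (F (t + h)%R) - Re (F t)) / h - Re l)%R with (Re (F (t + h)%R - F t - RtoC h * l) / h)%R.
- unfold Rdiv at 1; rewrite Rabs_mult, Rabs_inv.
  assert (0 < Rabs h)%R by now apply Rabs_pos_lt.
  apply Rmult_lt_reg_r with (Rabs h); auto.
  rewrite Rmult_assoc, Rinv_l, Rmult_1_r by lra.
  generalize (re_le_Cmod (F (t + h)%R - F t - RtoC h * l)).
  assert (0 < eps * Rabs h)%R by now apply Rmult_lt_0_compat. lra.
- unfold Cminus, Cplus, Copp, Cmult, RtoC, Re, Im; simpl. field; auto.
Qed.

Lemma is_derive_C_continuous (F : R -> C) (t : R) (l : C) :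
  @is_derive R_AbsRing C_R_NormedModule F t l -> @continuous R_UniformSpace C_UniformSpace F t.
Proof. intros H; apply (ex_derive_continuous (V := C_R_NormedModule) F t); now exists l. Qed.

Lemma Re_conj_mult_self (v : C) : Re (Cconj v * v) = (Cmod v * Cmod v)%R.
Proof. rewrite Cmod_sqr; destruct v; unfold Cconj, Cmult, Re, Im; simpl; ring. Qed.

(* The pairing with the error vector itself reduces this to the real mean value theorem. *)
Lemma cderiv_mean_value (f f1 : C -> C) (a b l : C) (M : R) :
  (forall t, (0 <= t <= 1)%R -> cderiv f (a + RtoC t * (b - a)) (f1 (a + RtoC t * (b - a)))) ->
  (forall t, (0 <= t <= 1)%R -> (Cmod (f1 (a + RtoC t * (b - a))%C - l) <= M)%R) ->
  (Cmod (f b - f a - l * (b - a)) <= M * Cmod (b - a))%R.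
Proof.
intros H HM.
set (v := f b - f a - l * (b - a)).
set (P := fun t : R => a + RtoC t * (b - a)) in *.
set (phi := fun t : R => Re (Cconj v * (f (P t) - l * P t))).
assert (D : forall t, (0 <= t <= 1)%R -> is_derive phi t (Re (Cconj v * (f1 (P t) - l) * (b - a)))).
{ intros t Ht. unfold phi.
  apply (is_derive_C_Re (fun s => Cconj v * (f (P s) - l * P s))).
  apply (is_derive_C_comp (fun y => Cconj v * (f y - l * y))).
  - apply cderiv_scal, cderiv_minus; [now apply H | ].
    apply cderiv_eq with (l * 1); [ring | ]. apply cderiv_scal, cderiv_id.
  - apply is_derive_C_line. }
destruct (MVT_gen phi 0 1 (fun t => Re (Cconj v * (f1 (P t) - l) * (b - a)))) as [c [Hc E]].
- intros t Ht. rewrite Rmin_left, Rmax_right in Ht by lra. apply D; lra.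
- intros t Ht. rewrite Rmin_left, Rmax_right in Ht by lra.
  apply continuity_pt_filterlim. apply (ex_derive_continuous phi). eexists; apply D; lra.
- rewrite Rmin_left, Rmax_right in Hc by lra.
  assert (E1 : (phi 1 - phi 0 = Cmod v * Cmod v)%R).
  { rewrite <- Re_conj_mult_self. unfold phi, P.
    replace (a + RtoC 1 * (b - a)) with b by ring.
    replace (a + RtoC 0 * (b - a)) with a by ring.
    replace (Cconj v * v) with (Cconj v * (f b - l * b) - Cconj v * (f a - l * a)) by (unfold v; ring).
    unfold Cminus, Cplus, Copp, Re; simpl. ring. }
  rewrite E1 in E.
  destruct (Req_dec (Cmod v) 0) as [Z | NZ].
  + rewrite Z. apply Rmult_le_pos; [ | apply Cmod_ge_0].
    eapply Rle_trans; [apply Cmod_ge_0 | apply (HM c Hc)].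
  + assert (0 < Cmod v)%R by (generalize (Cmod_ge_0 v); lra).
    apply Rmult_le_reg_l with (Cmod v); auto.
    rewrite E, Rminus_0_r, Rmult_1_r.
    eapply Rle_trans; [apply Rle_abs | ].
    eapply Rle_trans; [apply re_le_Cmod | ].
    rewrite !Cmod_mult, Cmod_conj, Rmult_assoc.
    apply Rmult_le_compat_l; [lra | ].
    apply Rmult_le_compat_r; [apply Cmod_ge_0 | apply HM, Hc].
Qed.

Lemma Cmod_segment_lt (a b c : C) (r t : R) : (0 <= t <= 1)%R ->
  (Cmod (a - c) < r)%R -> (Cmod (b - c) < r)%R -> (Cmod (a + RtoC t * (b - a) - c) < r)%R.
Proof.
intros Ht Ha Hb.
replace (a + RtoC t * (b - a) - c) with (RtoC (1 - t) * (a - c) + RtoC t * (b - c)) by (rewrite RtoC_minus; ring).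
eapply Rle_lt_trans; [apply Cmod_triangle | ].
rewrite !Cmod_mult, !Cmod_R, !Rabs_pos_eq by lra.
destruct (Rlt_dec t 1).
- assert ((1 - t) * Cmod (a - c) < (1 - t) * r)%R by (apply Rmult_lt_compat_l; lra).
  assert (t * Cmod (b - c) <= t * r)%R by (apply Rmult_le_compat_l; lra). lra.
- assert (t = 1)%R as -> by lra. lra.
Qed.

Lemma cderiv_zero_segment (f : C -> C) (a b : C) :
  (forall t, (0 <= t <= 1)%R -> cderiv f (a + RtoC t * (b - a)) 0) -> f b = f a.
Proof.
intros H.
assert (E : Cmod (f b - f a - 0 * (b - a)) = 0%R).
{ apply Rle_antisym; [ | apply Cmod_ge_0].
  eapply Rle_trans; [apply (cderiv_mean_value f (fun _ => 0) a b 0 0); auto | right; ring].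
  intros t Ht. replace (RtoC 0 - RtoC 0) with (RtoC 0) by ring. rewrite Cmod_0. lra. }
apply Cmod_eq_0 in E. replace (f b) with (f b - f a - 0 * (b - a) + f a) by ring. rewrite E. ring.
Qed.

Lemma cderiv_zero_const (f : C -> C) (R0 : R) (z : C) :
  (forall y, (Cmod y < R0)%R -> cderiv f y 0) -> (Cmod z < R0)%R -> f z = f 0.
Proof.
intros H Hz. apply cderiv_zero_segment.
intros t Ht; apply H.
replace (0 + RtoC t * (z - 0)) with (0 + RtoC t * (z - 0) - 0) by ring.
apply Cmod_segment_lt; auto.
- replace (RtoC 0 - RtoC 0) with (RtoC 0) by ring. rewrite Cmod_0.
  eapply Rle_lt_trans; [apply Cmod_ge_0 | exact Hz].
- replace (z - RtoC 0) with z by ring. exact Hz.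
Qed.

(** * Compactness and integrals depending on a parameter *)

(** A local constant, decreasing which does no harm, becomes uniform on a box. The local constants
    form a gauge, selected by description; [compactness_value] states its conclusion under a double
    negation, whence the classical step. *)
Lemma compact_uniform (n : nat) (a b : Compactness.Tn n R) (Q : R -> Compactness.Tn n R -> Prop) :
  (forall d d' y, (0 < d' <= d)%R -> Q d y -> Q d' y) ->
  (forall x, bounded_n n a b x -> exists d : R, (0 < d)%R /\ forall y, close_n n d y x -> Q d y) ->
  exists d : R, (0 < d)%R /\ forall x, bounded_n n a b x -> Q d x.
Proof.
intros Qmono H.
assert (H' : forall x, exists d : posreal, bounded_n n a b x -> forall y, close_n n d y x -> Q d y).
{ intros x. destruct (classic (bounded_n n a b x)) as [B | B].
  - destruct (H x B) as [d [Hd K]]. exists (mkposreal d Hd); intros _; exact K.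
  - exists (mkposreal 1 Rlt_0_1). intros; contradiction. }
set (delta := fun x => proj1_sig (constructive_indefinite_description _ (H' x))).
destruct (compactness_value n a b delta) as [d Hd].
exists d; split; [apply cond_pos | ]; intros x Hx.
apply NNPP; intros N; apply (Hd x Hx); intros [t [Ht [Hc Hdt]]]; apply N.
apply Qmono with (delta t); [split; [apply cond_pos | exact Hdt] | ].
apply (proj2_sig (constructive_indefinite_description _ (H' t)) Ht). exact Hc.
Qed.

Lemma compact_interval (a b : R) (Q : R -> R -> Prop) :
  (forall d d' y, (0 < d' <= d)%R -> Q d y -> Q d' y) ->
  (forall x, (a <= x <= b)%R -> exists d : R, (0 < d)%R /\ forall y, (Rabs (y - x) < d)%R -> Q d y) ->
  exists d : R, (0 < d)%R /\ forall x, (a <= x <= b)%R -> Q d x.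
Proof.
intros Qmono H.
destruct (compact_uniform 1 (a, tt) (b, tt) (fun d x => Q d (fst x))) as [d [Hd K]].
- intros d d' [y []]; apply Qmono.
- intros [x []] [B _]. destruct (H x B) as [d [Hd K]]. exists d; split; auto.
  intros [y []] [C _]. apply K, C.
- exists d; split; auto; intros x Hx. apply (K (x, tt)). simpl; auto.
Qed.

Lemma compact_disc2 (r : R) (Q : R -> C -> C -> Prop) :
  (forall d d' y y', (0 < d' <= d)%R -> Q d y y' -> Q d' y y') ->
  (forall x x', (Cmod x <= r)%R -> (Cmod x' <= r)%R ->
     exists d : R, (0 < d)%R /\ forall y y', (Cmod (y - x) < d)%R -> (Cmod (y' - x') < d)%R -> Q d y y') ->
  exists d : R, (0 < d)%R /\ forall x x', (Cmod x <= r)%R -> (Cmod x' <= r)%R -> Q d x x'.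
Proof.
intros Qmono H.
set (T := fun x : Compactness.Tn 4 R => let '(p, (q, (p', (q', _)))) := x in ((p, q) : C, (p', q') : C)).
(* The two discs are placed in a four-dimensional cube. At a point of the cube outside them [Q'] is
   vacuous, and stays so nearby because the complement of a closed disc is open. *)
set (Q' := fun d x => (Cmod (fst (T x)) <= r)%R -> (Cmod (snd (T x)) <= r)%R -> Q d (fst (T x)) (snd (T x))).
destruct (compact_uniform 4 ((- r)%R, ((- r)%R, ((- r)%R, ((- r)%R, tt)))) (r, (r, (r, (r, tt)))) Q') as [d [Hd K]].
- intros d d' y Hd HQ B1 B2. apply Qmono with d; auto.
- intros [p [q [p' [q' []]]]] _.
  assert (Tri : forall x y : C, (Cmod x <= Cmod y + Cmod (y - x))%R).
  { intros x y. rewrite Cmod_sub_sym. apply Cmod_le_add. }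
  destruct (Rle_dec (Cmod (p, q)) r) as [B1 | B1].
  + destruct (Rle_dec (Cmod (p', q')) r) as [B2 | B2].
    * destruct (H _ _ B1 B2) as [d [Hd K]].
      exists (d / 2)%R; split; [lra | ].
      intros [u [v [u' [v' []]]]] [C1 [C2 [C3 [C4 _]]]] _ _. simpl.
      apply Qmono with d; [lra | ]. apply K.
      -- generalize (Cmod_pair_lt _ _ _ C1 C2). unfold Cminus, Cplus, Copp; simpl. unfold Rminus; lra.
      -- generalize (Cmod_pair_lt _ _ _ C3 C4). unfold Cminus, Cplus, Copp; simpl. unfold Rminus; lra.
    * exists ((Cmod (p', q') - r) / 2)%R; split; [lra | ].
      intros [u [v [u' [v' []]]]] [C1 [C2 [C3 [C4 _]]]] _ B3. exfalso; simpl in B3.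
      generalize (Cmod_pair_lt _ _ _ C3 C4) (Tri (p', q') (u', v')). unfold Cminus, Cplus, Copp; simpl. unfold Rminus; lra.
  + exists ((Cmod (p, q) - r) / 2)%R; split; [lra | ].
    intros [u [v [u' [v' []]]]] [C1 [C2 [C3 [C4 _]]]] B3 _. exfalso; simpl in B3.
    generalize (Cmod_pair_lt _ _ _ C1 C2) (Tri (p, q) (u, v)). unfold Cminus, Cplus, Copp; simpl. unfold Rminus; lra.
- exists d; split; auto. intros [p q] [p' q'] B1 B2.
  apply (K (p, (q, (p', (q', tt))))); auto.
  generalize (re_le_Cmod (p, q)) (im_le_Cmod (p, q)) (re_le_Cmod (p', q')) (im_le_Cmod (p', q')).
  unfold Re, Im; simpl; intros.
  repeat match goal with H : (Rabs _ <= _)%R |- _ => apply Rabs_le_between in H end.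
  repeat split; lra.
Qed.

Lemma compact_disc (r : R) (Q : R -> C -> Prop) :
  (forall d d' y, (0 < d' <= d)%R -> Q d y -> Q d' y) ->
  (forall x, (Cmod x <= r)%R ->
     exists d : R, (0 < d)%R /\ forall y, (Cmod (y - x) < d)%R -> Q d y) ->
  exists d : R, (0 < d)%R /\ forall x, (Cmod x <= r)%R -> Q d x.
Proof.
intros Qmono H.
destruct (compact_disc2 r (fun d y _ => Q d y)) as [d [Hd K]].
- intros d d' y y'; apply Qmono.
- intros x x' Hx _. destruct (H x Hx) as [d [Hd K]]. exists d; split; auto.
- exists d; split; auto. intros x Hx. apply (K x x); auto.
Qed.

(** * Integrals of complex-valued functions of a real variable *)

Notation CInt := (@RInt C_R_CompleteNormedModule).
Notation is_CInt := (@is_RInt C_R_NormedModule).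

Lemma CInt_correct (F : R -> C) (a b : R) : (a <= b)%R ->
  (forall t, (a <= t <= b)%R -> @continuous R_UniformSpace C_UniformSpace F t) ->
  is_CInt F a b (CInt F a b).
Proof.
intros Hab H. apply (RInt_correct (V := C_R_CompleteNormedModule)).
apply (ex_RInt_continuous (V := C_R_CompleteNormedModule)).
rewrite Rmin_left, Rmax_right by auto. exact H.
Qed.

Lemma CInt_unique (F : R -> C) (a b : R) (l : C) : is_CInt F a b l -> CInt F a b = l.
Proof. apply (is_RInt_unique (V := C_R_CompleteNormedModule)). Qed.

Lemma is_CInt_scal (c : C) (F : R -> C) (a b : R) (l : C) :
  is_CInt F a b l -> is_CInt (fun t => c * F t) a b (c * l).
Proof.
intros H.
generalize (is_RInt_fct_extend_fst (U := R_NormedModule) (V := R_NormedModule) F a b l H)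
  (is_RInt_fct_extend_snd (U := R_NormedModule) (V := R_NormedModule) F a b l H); intros H1 H2.
apply (is_RInt_fct_extend_pair (U := R_NormedModule) (V := R_NormedModule)).
- apply (is_RInt_minus (V := R_NormedModule)); now apply (is_RInt_scal (V := R_NormedModule)).
- apply (is_RInt_plus (V := R_NormedModule)); now apply (is_RInt_scal (V := R_NormedModule)).
Qed.

Lemma is_CInt_minus (F G : R -> C) (a b : R) (l m : C) :
  is_CInt F a b l -> is_CInt G a b m -> is_CInt (fun t => F t - G t) a b (l - m).
Proof. apply (is_RInt_minus (V := C_R_NormedModule)). Qed.

Lemma is_CInt_ext (F G : R -> C) (a b : R) (l : C) : (a <= b)%R ->
  (forall t, (a < t < b)%R -> F t = G t) -> is_CInt F a b l -> is_CInt G a b l.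
Proof. intros Hab H; apply is_RInt_ext. rewrite Rmin_left, Rmax_right by auto. exact H. Qed.

Lemma is_CInt_Cmod_le (F : R -> C) (a b M : R) (l : C) : (a <= b)%R ->
  (forall t, (a <= t <= b)%R -> (Cmod (F t) <= M)%R) -> is_CInt F a b l ->
  (Cmod l <= (b - a) * M)%R.
Proof.
intros Hab H HI. rewrite <- norm_C_R.
apply (norm_RInt_le_const F a b l M Hab); auto.
intros t Ht; rewrite norm_C_R; auto.
Qed.

Lemma is_CInt_derive (F F1 : R -> C) (a b : R) : (a <= b)%R ->
  (forall t, (a <= t <= b)%R -> @is_derive R_AbsRing C_R_NormedModule F t (F1 t)) ->
  (forall t, (a <= t <= b)%R -> @continuous R_UniformSpace C_UniformSpace F1 t) ->
  is_CInt F1 a b (F b - F a).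
Proof.
intros Hab H1 H2.
apply (is_RInt_derive (V := C_R_CompleteNormedModule) F F1); rewrite Rmin_left, Rmax_right by auto; auto.
Qed.

(** The mean value inequality bounds the linearization error of [K _ t] by the oscillation of
    [K1 _ t] near [z0]; joint continuity and compactness of [[a, b]] make this oscillation small
    uniformly in [t]. *)
Lemma cderiv_CInt_param (K K1 : C -> R -> C) (z0 : C) (a b d0 : R) : (a <= b)%R -> (0 < d0)%R ->
  (forall z t, (Cmod (z - z0) < d0)%R -> (a <= t <= b)%R -> cderiv (fun y => K y t) z (K1 z t)) ->
  (forall z t, (Cmod (z - z0) < d0)%R -> (a <= t <= b)%R -> @continuous R_UniformSpace C_UniformSpace (K z) t) ->
  (forall t, (a <= t <= b)%R -> 
     @continuous (prod_UniformSpace C_UniformSpace R_UniformSpace) C_UniformSpace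
       (fun p => K1 (fst p) (snd p)) (z0, t)) ->
  cderiv (fun z => CInt (K z) a b) z0 (CInt (K1 z0) a b).
Proof.
intros Hab Hd0 HD HC HJ.
assert (HZ : (Cmod (z0 - z0) < d0)%R).
{ replace (z0 - z0) with (RtoC 0) by ring. now rewrite Cmod_0. }
assert (HC1 : forall t, (a <= t <= b)%R -> @continuous R_UniformSpace C_UniformSpace (K1 z0) t).
{ intros t Ht. apply (continuous_comp_2 (fun _ : R => z0) (fun s : R => s) K1 t).
  - apply continuous_const.
  - apply continuous_id.
  - now apply HJ. }
apply cderivP; intros eps He.
set (e := (eps / (b - a + 1))%R).
assert (He0 : (0 < e)%R) by (apply Rdiv_lt_0_compat; lra).
destruct (compact_interval a b (fun d t => forall z, (Cmod (z - z0) < d)%R -> (Cmod (K1 z t - K1 z0 t) <= e)%R))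
  as [d [Hd U]].
{ intros d d' t Hdd Hz z H. apply Hz; lra. }
{ intros t Ht.
  assert (He2 : (0 < e / 2)%R) by lra.
  generalize (proj1 (continuous_C _ _) (HJ t Ht) (mkposreal _ He2)); simpl; intros [d1 L1].
  exists d1; split; [apply cond_pos | ]; intros s Hs z Hz.
  assert (B1 := L1 (z, s) (conj (ball_of_Cmod _ _ _ Hz) Hs)).
  assert (B2 := L1 (z0, s) (conj (ball_center (z0 : C_UniformSpace) d1) Hs)).
  simpl in B1, B2.
  eapply Rle_trans; [apply (Cmod_triangle_sub _ (K1 z0 t)) | ].
  rewrite (Cmod_sub_sym (K1 z0 t)). lra. }
exists (Rmin d d0); split; [now apply Rmin_pos | ]; intros y Hy.
generalize (Rmin_l d d0) (Rmin_r d d0); intros L1 L2.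
apply Rle_trans with ((b - a) * (e * Cmod (y - z0)))%R.
- assert (I : is_CInt (fun t => K y t - K z0 t - (y - z0) * K1 z0 t) a b
     (CInt (K y) a b - CInt (K z0) a b - (y - z0) * CInt (K1 z0) a b)).
  { apply is_CInt_minus; [apply is_CInt_minus | apply is_CInt_scal]; apply CInt_correct; auto.
    intros t Ht; apply HC; auto; lra. }
  rewrite (Cmult_comm (CInt (K1 z0) a b)).
  apply is_CInt_Cmod_le with (3 := I); auto.
  intros t Ht. rewrite Cmult_comm.
  apply (cderiv_mean_value (fun w => K w t) (fun w => K1 w t)).
  + intros s Hs. apply HD; auto. apply Cmod_segment_lt; auto. lra.
  + intros s Hs. apply U; auto. apply Cmod_segment_lt; auto; try lra.
    replace (z0 - z0) with (RtoC 0) by ring. now rewrite Cmod_0.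
- rewrite <- Rmult_assoc. apply Rmult_le_compat_r; [apply Cmod_ge_0 | ].
  unfold e. apply Rmult_le_reg_r with (b - a + 1)%R; [lra | ].
  replace ((b - a) * (eps / (b - a + 1)) * (b - a + 1))%R with ((b - a) * eps)%R by (field; lra).
  nra.
Qed.

(** * Cauchy's formula *)

(** The derivative is carried along and is continuous by definition, so that Cauchy's formula can be
    proved by differentiation under the integral sign, without Goursat's argument. *)
Definition hol (R0 : R) (f f1 : C -> C) : Prop :=
  forall z, (Cmod z < R0)%R -> cderiv f z (f1 z) /\ continuous f1 z.

Definition circ (r t : R) : C := (r * cos t, r * sin t)%R.

Lemma Cmod_circ (r t : R) : (0 <= r)%R -> Cmod (circ r t) = r.
Proof.
intros H. unfold Cmod, circ; simpl.
replace (_ + _)%R with (Rsqr r * (Rsqr (sin t) + Rsqr (cos t)))%R by (unfold Rsqr; ring).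
rewrite sin2_cos2, Rmult_1_r. now apply sqrt_Rsqr.
Qed.

Lemma circ_2PI (r : R) : circ r (2 * PI) = circ r 0.
Proof. unfold circ. now rewrite cos_2PI, sin_2PI, cos_0, sin_0. Qed.

Lemma is_derive_circ (r t : R) : @is_derive R_AbsRing C_R_NormedModule (circ r) t (Ci * circ r t).
Proof.
replace (Ci * circ r t) with ((r * - sin t)%R, (r * cos t)%R)
  by (unfold Ci, circ, Cmult; simpl; f_equal; ring).
apply is_derive_C_pair; auto_derive; auto; ring.
Qed.

Lemma continuous_circ (r t : R) : @continuous R_UniformSpace C_UniformSpace (circ r) t.
Proof. eapply is_derive_C_continuous, is_derive_circ. Qed.

Lemma circ_sub_neq_0 (r t : R) (z : C) : (Cmod z < r)%R -> circ r t - z <> 0.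
Proof.
intros H E. assert (E' : circ r t = z) by (replace (circ r t) with (circ r t - z + z) by ring; rewrite E; ring).
assert (0 <= r)%R by (generalize (Cmod_ge_0 z); lra).
rewrite <- E', Cmod_circ in H; lra.
Qed.

Lemma two_PI_pos : (0 <= 2 * PI)%R.
Proof. generalize PI_RGT_0; lra. Qed.

Lemma Cpow_neq_0 (z : C) (n : nat) : z <> 0 -> z ^ n <> 0.
Proof. intros H; induction n; simpl; [apply C1_nz | now apply Cmult_neq_0]. Qed.

Lemma Cmod_lt_neighborhood (z y : C) (r : R) : (Cmod (y - z) < r - Cmod z)%R -> (Cmod y < r)%R.
Proof. intros H. generalize (Cmod_le_add y z); lra. Qed.

(** Integration is over the angle. The line element is [Ci * circ r t] times that of the angle: its
    factor [circ r t] is put into [F] and the factor [Ci] is dropped, so Cauchy's formula has the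
    constant [2 * PI]. *)
Definition cauchy_transform (r : R) (n : nat) (F : R -> C) (z : C) : C :=
  CInt (fun t => F t / (circ r t - z) ^ n) 0 (2 * PI).

Lemma cderiv_cauchy_transform (r : R) (n : nat) (F : R -> C) (z : C) :
  (forall t, @continuous R_UniformSpace C_UniformSpace F t) -> (Cmod z < r)%R ->
  cderiv (cauchy_transform r n F) z (cauchy_transform r (S n) (fun t => INR n * F t) z).
Proof.
intros HF Hz. unfold cauchy_transform.
apply (cderiv_CInt_param (fun y t => F t / (circ r t - y) ^ n)
   (fun y t => INR n * F t / (circ r t - y) ^ S n) z 0 (2 * PI) (r - Cmod z)).
- apply two_PI_pos.
- lra.
- intros y t Hy _. apply Cmod_lt_neighborhood in Hy.
  generalize (circ_sub_neq_0 r t y Hy); intros N.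
  apply cderiv_eq with (F t * (- (INR n * (circ r t - y) ^ pred n * (0 - 1)) / ((circ r t - y) ^ n * (circ r t - y) ^ n))).
  + destruct n as [ | n]; [simpl; field; auto | ].
    change (pred (S n)) with n. simpl Cpow. field. split; auto. now apply Cpow_neq_0.
  + apply (cderiv_scal (F t) (fun y => / (circ r t - y) ^ n)).
    apply (cderiv_inv (fun y => (circ r t - y) ^ n)); [now apply Cpow_neq_0 | ].
    apply (cderiv_pow (fun y => circ r t - y)).
    apply cderiv_minus; [apply cderiv_const | apply cderiv_id].
- intros y t Hy _. apply Cmod_lt_neighborhood in Hy.
  apply continuous_Cmult; auto. apply continuous_Cinv.
  + now apply Cpow_neq_0, circ_sub_neq_0.
  + apply continuous_Cpow, continuous_Cminus; [apply continuous_circ | apply continuous_const].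
- intros t _. apply continuous_Cmult.
  + apply continuous_Cmult; [apply continuous_const | ].
    apply (continuous_comp snd F); [apply continuous_snd | apply HF].
  + apply continuous_Cinv; [now apply Cpow_neq_0, circ_sub_neq_0 | ].
    apply continuous_Cpow, continuous_Cminus; [ | apply continuous_fst].
    apply (continuous_comp snd (circ r)); [apply continuous_snd | apply continuous_circ].
Qed.

Lemma is_CInt_unique2 (F : R -> C) (a b : R) (l m : C) : is_CInt F a b l -> is_CInt F a b m -> l = m.
Proof. intros H1 H2. now rewrite <- (CInt_unique _ _ _ _ H1), (CInt_unique _ _ _ _ H2). Qed.

Lemma is_CInt_derive_loop (F F1 : R -> C) (a b : R) : (a <= b)%R -> F b = F a ->
  (forall t, (a <= t <= b)%R -> @is_derive R_AbsRing C_R_NormedModule F t (F1 t)) ->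
  (forall t, (a <= t <= b)%R -> @continuous R_UniformSpace C_UniformSpace F1 t) ->
  is_CInt F1 a b (RtoC 0).
Proof.
intros Hab E H1 H2. replace (RtoC 0) with (F b - F a) by (rewrite E; ring). now apply is_CInt_derive.
Qed.

Lemma is_CInt_const (c : C) (a b : R) : is_CInt (fun _ => c) a b (RtoC (b - a) * c).
Proof.
replace (RtoC (b - a) * c) with (@scal R_AbsRing C_R_NormedModule (b - a)%R c).
- apply (is_RInt_const (V := C_R_NormedModule)).
- destruct c as [x y]; transitivity (((b - a) * x)%R, ((b - a) * y)%R); [reflexivity | ].
  unfold Cmult, RtoC; simpl; f_equal; ring.
Qed.

(** The derivative in [z] integrates the total derivative of [Ci / (circ r t - z)] around the
    circle, hence vanishes; at [z = 0] the integrand is 1. *)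
Lemma cauchy_transform_circ (r : R) (z : C) : (Cmod z < r)%R ->
  cauchy_transform r 1 (circ r) z = RtoC (2 * PI).
Proof.
intros Hz.
assert (Hr : (0 < r)%R) by (generalize (Cmod_ge_0 z); lra).
rewrite (cderiv_zero_const (cauchy_transform r 1 (circ r)) r z); auto.
- unfold cauchy_transform. apply CInt_unique.
  replace (RtoC (2 * PI)) with (RtoC (2 * PI - 0) * 1) by (rewrite Rminus_0_r; ring).
  apply is_CInt_ext with (fun _ => RtoC 1); [apply two_PI_pos | | apply is_CInt_const].
  intros t _. simpl. field.
  replace (circ r t) with (circ r t - 0) by ring. apply circ_sub_neq_0. now rewrite Cmod_0.
- intros y Hy. eapply cderiv_eq; [ | apply cderiv_cauchy_transform; auto; apply continuous_circ].
  unfold cauchy_transform. apply CInt_unique.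
  assert (EC : Ci * Ci = - (1)) by (unfold Ci, Cmult, RtoC, Copp; simpl; f_equal; ring).
  assert (N := fun t => circ_sub_neq_0 r t y Hy).
  apply (is_CInt_derive_loop (fun t => Ci / (circ r t - y)) (fun t => INR 1 * circ r t / (circ r t - y) ^ 2));
    [apply two_PI_pos | now rewrite circ_2PI | | ].
  + intros t _.
    replace (INR 1 * circ r t / (circ r t - y) ^ 2) with
      (Ci * (- (1) / ((circ r t - y) * (circ r t - y))) * (Ci * circ r t)).
    * apply (is_derive_C_comp (fun w => Ci / (w - y)) (circ r)); [ | apply is_derive_circ].
      apply (cderiv_scal Ci (fun w => / (w - y))).
      apply (cderiv_inv (fun w => w - y)); auto.
      apply cderiv_eq with (1 - 0); [ring | ]. apply cderiv_minus; [apply cderiv_id | apply cderiv_const].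
    * change (INR 1) with 1%R. simpl.
      replace (Ci * (- (1) / ((circ r t - y) * (circ r t - y))) * (Ci * circ r t)) with
        (- (Ci * Ci) * circ r t / ((circ r t - y) * (circ r t - y))) by (field; auto).
      rewrite EC. field; auto.
  + intros t _. apply continuous_Cmult.
    * apply continuous_Cmult; [apply continuous_const | apply continuous_circ].
    * apply continuous_Cinv; [apply Cpow_neq_0; auto | ].
      apply continuous_Cpow, continuous_Cminus; [apply continuous_circ | apply continuous_const].
Qed.

Lemma hol_continuous (R0 : R) (f f1 : C -> C) (z : C) : hol R0 f f1 -> (Cmod z < R0)%R -> continuous f z.
Proof. intros H Hz. eapply cderiv_continuous, (proj1 (H z Hz)). Qed.

(* [fun s => CInt (f (z + s (c - z)) c / (c - z))] is constant on [[0,1]]: its derivative is the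
   integral of a total derivative around the circle. *)
Lemma cauchy_formula (R0 r : R) (f f1 : C -> C) (z : C) :
  hol R0 f f1 -> (r < R0)%R -> (Cmod z < r)%R ->
  cauchy_transform r 1 (fun t => f (circ r t) * circ r t) z = RtoC (2 * PI) * f z.
Proof.
intros Hf HR Hz.
assert (Hr : (0 < r)%R) by (generalize (Cmod_ge_0 z); lra).
assert (N := fun t => circ_sub_neq_0 r t z Hz).
set (K := fun (s : C) (t : R) => f (z + s * (circ r t - z)) * (circ r t / (circ r t - z))).
set (K1 := fun (s : C) (t : R) => f1 (z + s * (circ r t - z)) * circ r t).
(* The parameter [s] is complex, so that [cderiv] applies, and must be allowed in a neighbourhood of
   [[0, 1]]. Since [Cmod (circ r t - z) <= 2 * r], the stated distance moves the point by less than
   [R0 - r]. *)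
assert (In : forall (u : R) (s : C) (t : R), (0 <= u <= 1)%R ->
   (Cmod (s - RtoC u) < (R0 - r) / (2 * r))%R -> (Cmod (z + s * (circ r t - z)) < R0)%R).
{ intros u s t Hu Hs.
  replace (z + s * (circ r t - z)) with
    ((z + RtoC u * (circ r t - z) - 0) + (s - RtoC u) * (circ r t - z)) by ring.
  eapply Rle_lt_trans; [apply Cmod_triangle | ]. rewrite Cmod_mult.
  assert (B1 : (Cmod (circ r t - z) <= 2 * r)%R).
  { unfold Cminus; eapply Rle_trans; [apply Cmod_triangle | ]. rewrite Cmod_opp, Cmod_circ; lra. }
  assert (B2 : (Cmod (z + RtoC u * (circ r t - z) - 0) <= r)%R).
  { apply le_epsilon; intros e He. left. apply Cmod_segment_lt; auto.
    - replace (z - 0) with z by ring. lra.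
    - replace (circ r t - 0) with (circ r t) by ring. rewrite Cmod_circ; lra. }
  assert (B3 : (Cmod (s - RtoC u) * Cmod (circ r t - z) <= Cmod (s - RtoC u) * (2 * r))%R)
    by (apply Rmult_le_compat_l; auto; apply Cmod_ge_0).
  assert (B4 : (Cmod (s - RtoC u) * (2 * r) < (R0 - r) / (2 * r) * (2 * r))%R)
    by (apply Rmult_lt_compat_r; lra).
  replace ((R0 - r) / (2 * r) * (2 * r))%R with (R0 - r)%R in B4 by (field; lra). lra. }
assert (PD : (0 < (R0 - r) / (2 * r))%R) by (apply Rdiv_lt_0_compat; lra).
assert (In0 : forall (u : R) (t : R), (0 <= u <= 1)%R -> (Cmod (z + RtoC u * (circ r t - z)) < R0)%R).
{ intros u t Hu; apply (In u); auto. replace (RtoC u - RtoC u) with (RtoC 0) by ring. now rewrite Cmod_0. }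
assert (CP : forall s t, @continuous R_UniformSpace C_UniformSpace (fun t => z + s * (circ r t - z)) t).
{ intros s t. apply continuous_Cplus; [apply continuous_const | ].
  apply continuous_Cmult; [apply continuous_const | ].
  apply continuous_Cminus; [apply continuous_circ | apply continuous_const]. }
assert (CK : forall (u : R) (s : C) (t : R), (0 <= u <= 1)%R ->
   (Cmod (s - RtoC u) < (R0 - r) / (2 * r))%R -> @continuous R_UniformSpace C_UniformSpace (K s) t).
{ intros u s t Hu Hs. apply continuous_Cmult.
  - apply (continuous_comp (fun t => z + s * (circ r t - z)) f); auto.
    eapply hol_continuous; eauto.
  - apply continuous_Cmult; [apply continuous_circ | ].
    apply continuous_Cinv; auto. apply continuous_Cminus; [apply continuous_circ | apply continuous_const]. }
assert (CK1 : forall (u t : R), (0 <= u <= 1)%R -> @continuous R_UniformSpace C_UniformSpace (K1 (RtoC u)) t).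
{ intros u t Hu. apply continuous_Cmult; [ | apply continuous_circ].
  apply (continuous_comp (fun t => z + RtoC u * (circ r t - z)) f1); auto. now apply Hf, In0. }
assert (EC : Ci * Ci = - (1)) by (unfold Ci, Cmult, RtoC, Copp; simpl; f_equal; ring).
assert (Z : forall u : R, (0 <= u <= 1)%R -> CInt (K1 (RtoC u)) 0 (2 * PI) = RtoC 0).
{ intros u Hu. apply CInt_unique.
  (* The primitive in [t] of the integrand carries the factor [1 / u]; at [u = 0] the integrand is a
     constant times [circ r t] and has a primitive of its own. *)
  destruct (Req_dec u 0) as [-> | U0].
  - apply (is_CInt_derive_loop (fun t => f1 z * (- Ci * circ r t))); [apply two_PI_pos | now rewrite circ_2PI | | ].
    + intros t _. replace (K1 (RtoC 0) t) with (f1 z * (- Ci * 1) * (Ci * circ r t)).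
      * apply (is_derive_C_comp (fun w => f1 z * (- Ci * w)) (circ r)); [ | apply is_derive_circ].
        apply cderiv_scal, cderiv_scal, cderiv_id.
      * unfold K1. replace (z + RtoC 0 * (circ r t - z)) with z by ring.
        replace (f1 z * (- Ci * 1) * (Ci * circ r t)) with (- (Ci * Ci) * (f1 z * circ r t)) by ring.
        rewrite EC; ring.
    + intros t _. apply CK1; lra.
  - assert (U1 : RtoC u <> 0) by (intros E; apply U0; injection E; auto).
    set (G := fun t => - Ci / RtoC u * f (z + RtoC u * (circ r t - z))).
    apply (is_CInt_derive_loop G); [apply two_PI_pos | unfold G; now rewrite circ_2PI | | ].
    + intros t _. unfold G.
      replace (K1 (RtoC u) t) with (- Ci / RtoC u * (f1 (z + RtoC u * (circ r t - z)) * (0 + RtoC u * (1 - 0))) * (Ci * circ r t)).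
      * apply (is_derive_C_comp (fun w => - Ci / RtoC u * f (z + RtoC u * (w - z))) (circ r)); [ | apply is_derive_circ].
        apply cderiv_scal. apply (cderiv_comp f (fun w => z + RtoC u * (w - z))).
        -- now apply Hf, In0.
        -- apply cderiv_plus; [apply cderiv_const | ].
           apply cderiv_scal, cderiv_minus; [apply cderiv_id | apply cderiv_const].
      * unfold K1.
        replace (- Ci / RtoC u * (f1 (z + RtoC u * (circ r t - z)) * (0 + RtoC u * (1 - 0))) * (Ci * circ r t))
         with (- (Ci * Ci) * (f1 (z + RtoC u * (circ r t - z)) * circ r t)) by (field; auto).
        rewrite EC; ring.
    + intros t _. apply CK1; lra. }
assert (E1 : CInt (K (RtoC 1)) 0 (2 * PI) = CInt (K (RtoC 0)) 0 (2 * PI)).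
{ apply (cderiv_zero_segment (fun s => CInt (K s) 0 (2 * PI)) 0 1).
  intros u Hu. replace (0 + RtoC u * (1 - 0)) with (RtoC u) by ring. rewrite <- (Z u Hu).
    apply (cderiv_CInt_param K K1 (RtoC u) 0 (2 * PI) ((R0 - r) / (2 * r))); auto.
    + apply two_PI_pos.
    + intros s t Hs _. unfold K, K1.
      apply cderiv_eq with (f1 (z + s * (circ r t - z)) * (0 + (1 * (circ r t - z) + s * 0)) * (circ r t / (circ r t - z)) + f (z + s * (circ r t - z)) * 0).
      * field; auto.
      * apply (cderiv_mult (fun s => f (z + s * (circ r t - z))) (fun _ => circ r t / (circ r t - z))); [ | apply cderiv_const].
        apply (cderiv_comp f (fun s => z + s * (circ r t - z))); [apply Hf, (In u); auto | ].
        apply cderiv_plus; [apply cderiv_const | ].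
        apply (cderiv_mult (fun s => s) (fun _ => circ r t - z)); [apply cderiv_id | apply cderiv_const].
    + intros s t Hs _. apply (CK u); auto.
    + intros t _. unfold K1. 
      assert (CC : @continuous (prod_UniformSpace C_UniformSpace R_UniformSpace) C_UniformSpace (fun p => circ r (snd p)) (RtoC u, t)).
      { apply (continuous_comp snd (circ r)); [apply continuous_snd | apply continuous_circ]. }
      apply continuous_Cmult; auto.
      apply (continuous_comp (fun p : C * R => z + fst p * (circ r (snd p) - z)) f1); [ | now apply Hf, In0].
      apply continuous_Cplus; [apply continuous_const | ].
      apply continuous_Cmult; [apply continuous_fst | ].
      apply continuous_Cminus; auto. apply continuous_const. }
transitivity (CInt (K (RtoC 1)) 0 (2 * PI)); [ | rewrite E1].
- symmetry. apply CInt_unique.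
  apply is_CInt_ext with (fun t => f (circ r t) * circ r t / (circ r t - z) ^ 1);
   [apply two_PI_pos | | ].
  + intros t _. unfold K. replace (z + 1 * (circ r t - z)) with (circ r t) by ring. simpl. field; auto.
  + apply CInt_correct; [apply two_PI_pos | ]. intros t _.
    apply continuous_Cmult.
    * apply continuous_Cmult; [ | apply continuous_circ].
      apply (continuous_comp (circ r) f); [apply continuous_circ | ].
      eapply hol_continuous; eauto. rewrite Cmod_circ; lra.
    * apply continuous_Cinv; [apply Cpow_neq_0; auto | ].
      apply continuous_Cpow, continuous_Cminus; [apply continuous_circ | apply continuous_const].
- rewrite <- (cauchy_transform_circ r z Hz). apply CInt_unique.
  rewrite Cmult_comm.
  apply is_CInt_ext with (fun t => f z * (circ r t / (circ r t - z) ^ 1)); [apply two_PI_pos | | ].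
  + intros t _. unfold K. replace (z + 0 * (circ r t - z)) with z by ring. simpl. field; auto.
  + apply is_CInt_scal, CInt_correct; [apply two_PI_pos | ]. intros t _.
    apply continuous_Cmult; [apply continuous_circ | ].
    apply continuous_Cinv; [apply Cpow_neq_0; auto | ].
    apply continuous_Cpow, continuous_Cminus; [apply continuous_circ | apply continuous_const].
Qed.

(** * Maximum modulus and the Schwarz lemma *)

Lemma two_PI_neq_0 : RtoC (2 * PI) <> 0.
Proof. intros E. injection E. generalize PI_RGT_0; lra. Qed.

Lemma hol_continuous_circ (R0 r : R) (f f1 : C -> C) (t : R) : hol R0 f f1 -> (0 <= r < R0)%R ->
  @continuous R_UniformSpace C_UniformSpace (fun t => f (circ r t)) t.
Proof.
intros Hf Hr. apply (continuous_comp (circ r) f); [apply continuous_circ | ].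
eapply hol_continuous; eauto. rewrite Cmod_circ; lra.
Qed.

(** Inside each circle of radius [r < R0] Cauchy's formula makes [f], then [f1] and its derivative,
    Cauchy transforms. The circle varies with the point, so [f2] is selected by [epsilon];
    uniqueness of derivatives identifies it locally with any of these transforms. *)
Lemma hol_derivative (R0 : R) (f f1 : C -> C) : hol R0 f f1 -> exists f2, hol R0 f1 f2.
Proof.
intros Hf.
set (F := fun r t => f (circ r t) * circ r t).
set (T2 := fun r => cauchy_transform r 2 (fun t => INR 1 * F r t)).
set (T3 := fun r => cauchy_transform r 3 (fun t => INR 2 * (INR 1 * F r t))).
assert (CF : forall r t, (0 <= r < R0)%R -> @continuous R_UniformSpace C_UniformSpace (F r) t).
{ intros r t Hr. apply continuous_Cmult; [ | apply continuous_circ]. eapply hol_continuous_circ; eauto. }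
assert (Cs : forall (c : C) (G : R -> C), (forall t, @continuous R_UniformSpace C_UniformSpace G t) ->
   forall t, @continuous R_UniformSpace C_UniformSpace (fun t => c * G t) t).
{ intros; apply continuous_Cmult; auto. apply continuous_const. }
assert (E1 : forall r z, (r < R0)%R -> (Cmod z < r)%R -> f1 z = / RtoC (2 * PI) * T2 r z).
{ intros r z Hr Hz.
  assert (0 <= r)%R by (generalize (Cmod_ge_0 z); lra).
  apply (cderiv_unique f z); [apply Hf; lra | ].
  apply cderiv_ext_loc with (fun y => / RtoC (2 * PI) * cauchy_transform r 1 (F r) y) (r - Cmod z)%R; [lra | | ].
  - intros y Hy. apply Cmod_lt_neighborhood in Hy. unfold F.
    rewrite (cauchy_formula R0 r f f1 y Hf Hr Hy). field. apply two_PI_neq_0.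
  - apply cderiv_scal, (cderiv_cauchy_transform r 1 (F r)); auto. }
assert (D2 : forall r z, (r < R0)%R -> (Cmod z < r)%R -> cderiv f1 z (/ RtoC (2 * PI) * T3 r z)).
{ intros r z Hr Hz.
  assert (0 <= r)%R by (generalize (Cmod_ge_0 z); lra).
  apply cderiv_ext_loc with (fun y => / RtoC (2 * PI) * T2 r y) (r - Cmod z)%R; [lra | | ].
  - intros y Hy. apply Cmod_lt_neighborhood in Hy. symmetry; auto.
  - apply cderiv_scal, (cderiv_cauchy_transform r 2 (fun t => INR 1 * F r t)); auto. }
exists (fun z => epsilon (inhabits (RtoC 0)) (fun l => cderiv f1 z l)).
set (f2 := fun z => epsilon _ _).
assert (D : forall z, (Cmod z < R0)%R -> cderiv f1 z (f2 z)).
{ intros z Hz. apply (epsilon_spec (inhabits (RtoC 0)) (fun l => cderiv f1 z l)).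
  eexists; apply (D2 ((Cmod z + R0) / 2)%R); lra. }
intros z Hz; split; auto.
set (r := ((Cmod z + R0) / 2)%R).
assert (Hr : (r < R0)%R) by (unfold r; lra).
assert (Hzr : (Cmod z < r)%R) by (unfold r; lra).
assert (0 <= r)%R by (generalize (Cmod_ge_0 z); lra).
eapply cderiv_continuous.
apply cderiv_ext_loc with (fun y => / RtoC (2 * PI) * T3 r y) (r - Cmod z)%R; [lra | | ].
- intros y Hy. apply Cmod_lt_neighborhood in Hy.
  apply (cderiv_unique f1 y); auto. apply D; lra.
- apply cderiv_scal, (cderiv_cauchy_transform r 3 (fun t => INR 2 * (INR 1 * F r t))); auto.
Qed.

Lemma Cmod_sub_ge (x y : C) : (Cmod x - Cmod y <= Cmod (x - y))%R.
Proof. generalize (Cmod_le_add x y); lra. Qed.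

(* Landau's trick: apply the Cauchy formula to [f ^ n], take [n]-th roots. *)
Lemma hol_max_modulus (R0 r M : R) (f f1 : C -> C) (z : C) :
  hol R0 f f1 -> (r < R0)%R -> (Cmod z < r)%R ->
  (forall t, (Cmod (f (circ r t)) <= M)%R) -> (Cmod (f z) <= M)%R.
Proof.
intros Hf Hr Hz HM.
assert (Hr0 : (0 < r)%R) by (generalize (Cmod_ge_0 z); lra).
assert (M0 : (0 <= M)%R) by (eapply Rle_trans; [apply Cmod_ge_0 | apply (HM 0%R)]).
assert (H : forall n : nat, (Cmod (f z) ^ n <= r / (r - Cmod z) * M ^ n)%R).
{ intros n.
  assert (Hn : hol R0 (fun y => f y ^ n) (fun y => INR n * f y ^ pred n * f1 y)).
  { intros y Hy; split.
    - apply cderiv_pow, Hf, Hy.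
    - apply continuous_Cmult; [ | now apply Hf].
      apply continuous_Cmult; [apply continuous_const | ].
      apply continuous_Cpow. eapply hol_continuous; eauto. }
  assert (B : (Cmod (cauchy_transform r 1 (fun t => f (circ r t) ^ n * circ r t)%C z) <=
     (2 * PI - 0) * (M ^ n * r / (r - Cmod z)))%R).
  { unfold cauchy_transform.
    eapply is_CInt_Cmod_le; [apply two_PI_pos | | apply CInt_correct; [apply two_PI_pos | ]].
    - intros t _. generalize (circ_sub_neq_0 r t z Hz); intros N. simpl. rewrite Cmult_1_r.
      rewrite Cmod_div, Cmod_mult, Cmod_circ, Cmod_pow by (auto; lra).
      assert (Cmod (f (circ r t)) ^ n <= M ^ n)%R by (apply pow_incr; split; [apply Cmod_ge_0 | auto]).
      assert (r - Cmod z <= Cmod (circ r t - z))%R by (generalize (Cmod_sub_ge (circ r t) z); rewrite Cmod_circ; lra).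
      apply Rmult_le_compat.
      + apply Rmult_le_pos; [apply pow_le, Cmod_ge_0 | lra].
      + left; apply Rinv_0_lt_compat; lra.
      + apply Rmult_le_compat_r; lra.
      + apply Rinv_le_contravar; lra.
    - intros t _. apply continuous_Cmult.
      + apply continuous_Cmult; [ | apply continuous_circ].
        apply continuous_Cpow. eapply hol_continuous_circ; eauto; lra.
      + apply continuous_Cinv; [now apply Cpow_neq_0, circ_sub_neq_0 | ].
        apply continuous_Cpow, continuous_Cminus; [apply continuous_circ | apply continuous_const]. }
  rewrite (cauchy_formula R0 r (fun y => f y ^ n) _ z Hn Hr Hz) in B.
  rewrite Cmod_mult, Cmod_R, Cmod_pow, Rabs_pos_eq in B by apply two_PI_pos.
  apply Rmult_le_reg_l with (2 * PI)%R; [generalize PI_RGT_0; lra | ].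
  eapply Rle_trans; [exact B | right; field; lra]. }
destruct (Rle_dec (Cmod (f z)) M) as [L | L]; auto. exfalso.
destruct (Req_dec M 0) as [-> | M1].
- generalize (H 1%nat); simpl; generalize (Cmod_ge_0 (f z)); lra.
- assert (P : (0 < M)%R) by lra.
  assert (X : (Rabs (Cmod (f z) / M) > 1)%R).
  { rewrite Rabs_pos_eq by (apply Rdiv_le_0_compat; [apply Cmod_ge_0 | auto]).
    apply Rmult_lt_reg_r with M; auto. replace (Cmod (f z) / M * M)%R with (Cmod (f z)) by (field; lra). lra. }
  (* Roots are replaced by growth: if [Cmod (f z) > M], the powers of their quotient pass the
     constant [r / (r - Cmod z)], which does not depend on [n]. *)
  destruct (Pow_x_infinity _ X (r / (r - Cmod z) + 1)%R) as [n Hn].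
  specialize (Hn n (le_n n)).
  assert (P' : (0 < M ^ n)%R) by now apply pow_lt.
  assert (Cmod (f z) / M >= 0)%R by (apply Rle_ge, Rdiv_le_0_compat; [apply Cmod_ge_0 | auto]).
  rewrite Rabs_pos_eq in Hn by (apply pow_le; lra).
  unfold Rdiv in Hn at 1; rewrite Rpow_mult_distr, pow_inv in Hn.
  specialize (H n).
  assert (Cmod (f z) ^ n * / M ^ n <= r / (r - Cmod z))%R.
  { apply Rmult_le_reg_r with (M ^ n)%R; auto.
    replace (Cmod (f z) ^ n * / M ^ n * M ^ n)%R with (Cmod (f z) ^ n)%R by (field; lra). exact H. }
  lra.
Qed.

(* The quotient [w z / z] is the Cauchy integral of [w zeta / (zeta - z)], so it is holomorphic at [0]. *)
Lemma schwarz (R0 : R) (w w1 : C -> C) (z : C) :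
  hol R0 w w1 -> w 0 = 0 -> (forall y, (Cmod y < R0)%R -> (Cmod (w y) <= 1)%R) ->
  (Cmod z < R0)%R -> (R0 * Cmod (w z) <= Cmod z)%R.
Proof.
intros Hw W0 W1 Hz.
assert (K : forall r', (Cmod z < r' < R0)%R -> (r' * Cmod (w z) <= Cmod z)%R).
{ intros r' Hr'.
  set (r := ((r' + R0) / 2)%R).
  assert (Hr : (r' < r < R0)%R) by (unfold r; lra).
  assert (Pz := Cmod_ge_0 z).
  set (F := fun t => / RtoC (2 * PI) * w (circ r t)).
  assert (CF : forall t, @continuous R_UniformSpace C_UniformSpace F t).
  { intros t. apply continuous_Cmult; [apply continuous_const | ]. eapply hol_continuous_circ; eauto; lra. }
  set (phi := cauchy_transform r 1 F).
  set (phi1 := cauchy_transform r 2 (fun t => INR 1 * F t)).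
  assert (Hphi : hol r phi phi1).
  { intros y Hy; split; [now apply cderiv_cauchy_transform | ].
    eapply cderiv_continuous, cderiv_cauchy_transform; auto.
    intros t. apply continuous_Cmult; auto. apply continuous_const. }
  assert (E : forall y, (Cmod y < r)%R -> w y = y * phi y).
  { intros y Hy.
    assert (H0r : (Cmod 0 < r)%R) by (rewrite Cmod_0; lra).
    assert (C0 := cauchy_formula R0 r w w1 0 Hw (proj2 Hr) H0r).
    assert (Cy := cauchy_formula R0 r w w1 y Hw (proj2 Hr) Hy).
    rewrite W0, Cmult_0_r in C0.
    assert (CI : forall (n : nat) (G : R -> C) u, (Cmod u < r)%R -> (forall t, @continuous R_UniformSpace C_UniformSpace G t) ->
       is_CInt (fun t => G t / (circ r t - u) ^ n) 0 (2 * PI) (cauchy_transform r n G u)).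
    { intros n G u Hu HG. apply CInt_correct; [apply two_PI_pos | ]. intros t _.
      apply continuous_Cmult; auto. apply continuous_Cinv; [now apply Cpow_neq_0, circ_sub_neq_0 | ].
      apply continuous_Cpow, continuous_Cminus; [apply continuous_circ | apply continuous_const]. }
    assert (CW : forall t, @continuous R_UniformSpace C_UniformSpace (fun t => w (circ r t) * circ r t) t).
    { intros t. apply continuous_Cmult; [ | apply continuous_circ]. eapply hol_continuous_circ; eauto; lra. }
    assert (I1 := CI 1%nat (fun t : R => w (circ r t) * circ r t) y Hy CW). assert (I0 := CI 1%nat (fun t : R => w (circ r t) * circ r t) (RtoC 0) H0r CW).
    rewrite C0 in I0; rewrite Cy in I1.
    (* Subtracting the formula at 0, where [w] vanishes, produces the factor [y]: with
       [zeta = circ r t], [zeta / (zeta - y) - 1 = y / (zeta - y)]. *)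
    assert (I := is_CInt_scal (/ RtoC (2 * PI)) _ _ _ _ (is_CInt_minus _ _ _ _ _ _ I1 I0)).
    replace (w y) with (/ RtoC (2 * PI) * (RtoC (2 * PI) * w y - 0)) by (field; apply two_PI_neq_0).
    apply (is_CInt_unique2 _ _ _ _ _ I).
    apply is_CInt_ext with (fun t => y * (F t / (circ r t - y) ^ 1)); [apply two_PI_pos | | ].
    - intros t _. unfold F. simpl.
      assert (circ r t - y <> 0) by now apply circ_sub_neq_0.
      assert (circ r t <> 0).
      { replace (circ r t) with (circ r t - 0) by ring. now apply circ_sub_neq_0. }
      field; repeat split; auto. apply two_PI_neq_0.
    - apply is_CInt_scal. apply CI; auto. }
  (* Two radii are in play: [phi] is an integral over the circle of radius [r], and its modulus is
     bounded on the smaller circle of radius [r'], where [w y = y * phi y] holds. *)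
  assert (B : (Cmod (phi z) <= / r')%R).
  { apply (hol_max_modulus r r' (/ r') phi phi1 z); auto; try lra.
    intros t. assert (Hc : Cmod (circ r' t) = r') by (apply Cmod_circ; lra).
    specialize (E (circ r' t) ltac:(lra)).
    assert (L := W1 (circ r' t) ltac:(lra)). rewrite E, Cmod_mult, Hc in L.
    apply Rmult_le_reg_l with r'; [lra | ]. rewrite Rinv_r by lra. exact L. }
  rewrite (E z) by lra. rewrite Cmod_mult.
  assert (r' * Cmod (phi z) <= 1)%R.
  { rewrite <- (Rinv_r r') by lra. apply Rmult_le_compat_l; lra. }
  apply Rmult_le_compat_l with (r := Cmod z) in H; auto. lra. }
apply le_epsilon; intros e He.
assert (L := W1 z Hz). assert (Pw := Cmod_ge_0 (w z)).
set (r' := Rmax ((Cmod z + R0) / 2) (R0 - e)).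
assert (L1 : (r' < R0)%R) by (apply Rmax_lub_lt; lra).
assert (L2 : ((Cmod z + R0) / 2 <= r')%R) by apply Rmax_l.
assert (L3 : (R0 - e <= r')%R) by apply Rmax_r.
specialize (K r' ltac:(lra)).
assert ((R0 - r') * Cmod (w z) <= e * 1)%R by (apply Rmult_le_compat; lra).
lra.
Qed.

(** * Injectivity along a chain *)

Lemma near_linear_increment (f f1 : C -> C) (u l : C) (rho M : R) (y y' : C) :
  (forall y, (Cmod (y - u) < rho)%R -> cderiv f y (f1 y) /\ (Cmod (f1 y - l) <= M)%R) ->
  (Cmod (y - u) < rho)%R -> (Cmod (y' - u) < rho)%R ->
  (Cmod (f y' - f y - l * (y' - y)) <= M * Cmod (y' - y))%R.
Proof.
intros H Hy Hy'.
apply (cderiv_mean_value f f1); intros t Ht; apply H; now apply Cmod_segment_lt.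
Qed.

Lemma near_linear_injective (f f1 : C -> C) (u l : C) (rho : R) (y y' : C) : l <> 0 ->
  (forall y, (Cmod (y - u) < rho)%R -> cderiv f y (f1 y) /\ (Cmod (f1 y - l) <= Cmod l / 2)%R) ->
  (Cmod (y - u) < rho)%R -> (Cmod (y' - u) < rho)%R -> f y = f y' -> y = y'.
Proof.
intros L H Hy Hy' E.
assert (K := near_linear_increment f f1 u l rho _ y y' H Hy Hy').
rewrite E in K. replace (f y' - f y' - l * (y' - y)) with (- (l * (y' - y))) in K by ring.
rewrite Cmod_opp, Cmod_mult in K.
assert (PL : (0 < Cmod l)%R) by now apply Cmod_gt_0.
assert (Cmod (y' - y) = 0)%R.
{ apply Rle_antisym; [ | apply Cmod_ge_0]. apply Rmult_le_reg_l with (Cmod l); auto. lra. }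
apply Cmod_eq_0 in H0. replace y' with (y' - y + y) by ring. rewrite H0. ring.
Qed.

(* Newton iterates with the frozen slope [l] make the residual arbitrarily small; by compactness it vanishes. *)
Lemma near_linear_surjective (f f1 : C -> C) (u l w : C) (rho : R) : l <> 0 ->
  (forall y, (Cmod (y - u) < rho)%R -> cderiv f y (f1 y) /\ (Cmod (f1 y - l) <= Cmod l / 2)%R) ->
  (2 * (Cmod (f u - w) / Cmod l) < rho)%R ->
  exists v, (Cmod (v - u) <= 2 * (Cmod (f u - w) / Cmod l))%R /\ f v = w.
Proof.
intros L H Hw.
assert (PL : (0 < Cmod l)%R) by now apply Cmod_gt_0.
set (d := (Cmod (f u - w) / Cmod l)%R) in *.
assert (Pd : (0 <= d)%R) by (apply Rdiv_le_0_compat; auto; apply Cmod_ge_0).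
assert (Z : forall x : C, Cmod (x - x) = 0%R).
{ intros x. replace (x - x) with (RtoC 0) by ring. apply Cmod_0. }
(* The slope error is at most half of [Cmod l], so each step halves the residual; the steps form a
   geometric series of sum at most [2 * d] and stay where the slope is controlled. *)
assert (It : forall k : nat, exists v, (Cmod (v - u) <= 2 * d * (1 - (/ 2) ^ k))%R /\
   (Cmod (f v - w) <= Cmod l * d * (/ 2) ^ k)%R).
{ induction k as [ | k [v [V1 V2]]].
  - exists u. rewrite Z. simpl. split; [lra | ]. unfold d. right; field; lra.
  - assert (Pk : (0 < (/ 2) ^ k)%R) by (apply pow_lt; lra).
    assert (Dk : (0 <= d * (/ 2) ^ k)%R) by (apply Rmult_le_pos; lra).
    set (v' := v - (f v - w) / l).
    assert (St : (Cmod (v' - v) <= d * (/ 2) ^ k)%R).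
    { unfold v'. replace (v - (f v - w) / l - v) with (- ((f v - w) / l)) by ring.
      rewrite Cmod_opp, Cmod_div by auto. apply Rmult_le_reg_r with (Cmod l); auto.
      unfold Rdiv; rewrite Rmult_assoc, Rinv_l by lra. lra. }
    assert (V' : (Cmod (v' - u) <= 2 * d * (1 - (/ 2) ^ S k))%R).
    { eapply Rle_trans; [apply (Cmod_triangle_sub v' v u) | ]. simpl. lra. }
    exists v'; split; auto.
    assert (K := near_linear_increment f f1 u l rho _ v v' H ltac:(nra) ltac:(simpl in V'; nra)).
    replace (f v' - f v - l * (v' - v)) with (f v' - w) in K by (unfold v'; field; auto).
    eapply Rle_trans; [exact K | ]. simpl.
    assert (Cmod l / 2 * Cmod (v' - v) <= Cmod l / 2 * (d * (/ 2) ^ k))%R by (apply Rmult_le_compat_l; lra).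
    lra. }
apply NNPP; intros N.
assert (N' : forall v, (Cmod (v - u) <= 2 * d)%R -> f v <> w).
{ intros v Hv E; apply N; exists v; auto. }
destruct (compact_disc (2 * d) (fun m y => (m <= Cmod (f (u + y)%C - w))%R)) as [m [Pm Hm]].
- intros; lra.
- intros x Hx.
  assert (Hx' : (Cmod (u + x - u) <= 2 * d)%R) by (replace (u + x - u) with x by ring; auto).
  assert (P : (0 < Cmod (f (u + x)%C - w))%R).
  { apply Cmod_gt_0. intros E. apply (N' _ Hx').
    replace (f (u + x)) with (f (u + x) - w + w) by ring. rewrite E; ring. }
  set (m := Cmod (f (u + x) - w)) in *.
  assert (Cf : continuous f (u + x)).
  { eapply cderiv_continuous, H. lra. }
  destruct (proj1 (continuousP f _) Cf (m / 2)%R ltac:(lra)) as [d1 [Pd1 K]].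
  exists (Rmin d1 (m / 2)); split; [apply Rmin_pos; lra | ].
  intros y Hy. specialize (K (u + y)).
  replace (u + y - (u + x)) with (y - x) in K by ring.
  specialize (K ltac:(eapply Rlt_le_trans; [exact Hy | apply Rmin_l])).
  generalize (Cmod_triangle_sub (f (u + x)) (f (u + y)) w). fold m.
  rewrite (Cmod_sub_sym (f (u + x))). generalize (Rmin_r d1 (m / 2)). lra.
- assert (Q : (0 < m / (Cmod l * (d + 1)))%R).
  { apply Rdiv_lt_0_compat; auto. apply Rmult_lt_0_compat; lra. }
  destruct (pow_lt_1_zero (/ 2) ltac:(rewrite Rabs_pos_eq; lra) _ Q) as [k Hk].
  specialize (Hk k (le_n k)).
  assert (Pk : (0 < (/ 2) ^ k)%R) by (apply pow_lt; lra).
  rewrite Rabs_pos_eq in Hk by lra.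
  destruct (It k) as [v [V1 V2]].
  specialize (Hm (v - u) ltac:(nra)). replace (u + (v - u)) with v in Hm by ring.
  apply Rmult_lt_compat_l with (r := (Cmod l * (d + 1))%R) in Hk; [ | apply Rmult_lt_0_compat; lra].
  replace (Cmod l * (d + 1) * (m / (Cmod l * (d + 1))))%R with m in Hk by (field; lra).
  assert (0 < Cmod l * (/ 2) ^ k)%R by now apply Rmult_lt_0_compat. lra.
Qed.

(** Implicit function theorem with first-order expansion, at [t = 0]. The residual at [u] is
    [t * S u], so a solution exists within [2 * t * Cmod (S u) / Cmod l]; near-linearity with the
    smaller constant [eta] then locates it up to [eps * t]. *)
Lemma perturbed_solution (B B1 S S1 : C -> C) (u : C) (R0 eps : R) :
  hol R0 B B1 -> hol R0 S S1 -> (Cmod u < R0)%R -> B1 u <> 0 -> (0 < eps)%R ->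
  exists t0 : R, (0 < t0)%R /\ forall t : R, (0 < t < t0)%R ->
    exists v, B v + RtoC t * S v = B u /\
      (Cmod (v - (u - RtoC t * (S u / B1 u))) <= eps * t)%R /\ (Cmod v < R0)%R.
Proof.
intros HB HS Hu L He.
set (l := B1 u) in *.
assert (PL : (0 < Cmod l)%R) by now apply Cmod_gt_0.
assert (PS := Cmod_ge_0 (S u)).
(* The first entry is what solvability requires; the second makes [eta * Cmod (v - u) / Cmod l] at
   most [eps * t]. *)
set (eta := Rmin (Cmod l / 2) (eps * (Cmod l * Cmod l) / (2 * (Cmod (S u) + 1)))).
assert (Peta : (0 < eta)%R).
{ apply Rmin_pos; [lra | ]. apply Rdiv_lt_0_compat; [ | lra]. repeat apply Rmult_lt_0_compat; auto. }
destruct (proj1 (continuousP B1 u) (proj2 (HB u Hu)) (eta / 2)%R ltac:(lra)) as [d1 [P1 K1]].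
destruct (proj1 (continuousP S1 u) (proj2 (HS u Hu)) 1%R ltac:(lra)) as [d2 [P2 K2]].
set (M := (Cmod (S1 u) + 1)%R).
assert (PM : (0 < M)%R) by (unfold M; generalize (Cmod_ge_0 (S1 u)); lra).
set (rho := Rmin (R0 - Cmod u) (Rmin d1 d2)).
assert (Prho : (0 < rho)%R) by (repeat apply Rmin_pos; auto; lra).
assert (rho <= R0 - Cmod u /\ rho <= d1 /\ rho <= d2)%R as [R1 [R2 R3]].
{ unfold rho. generalize (Rmin_l (R0 - Cmod u) (Rmin d1 d2)) (Rmin_r (R0 - Cmod u) (Rmin d1 d2)) (Rmin_l d1 d2) (Rmin_r d1 d2). lra. }
exists (Rmin (eta / (2 * M)) (rho * Cmod l / (2 * (Cmod (S u) + 1)))); split.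
{ apply Rmin_pos; apply Rdiv_lt_0_compat; try lra. now apply Rmult_lt_0_compat. }
intros t [Pt Ht].
assert (T1 : (t * M <= eta / 2)%R).
{ apply Rle_trans with (eta / (2 * M) * M)%R; [ | right; field; lra].
  apply Rmult_le_compat_r; [lra | ]. eapply Rle_trans; [left; exact Ht | apply Rmin_l]. }
assert (T2 : (2 * (t * (Cmod (S u) + 1)) < rho * Cmod l)%R).
{ assert (t < rho * Cmod l / (2 * (Cmod (S u) + 1)))%R by (eapply Rlt_le_trans; [exact Ht | apply Rmin_r]).
  apply Rmult_lt_compat_r with (r := (2 * (Cmod (S u) + 1))%R) in H; [ | lra].
  replace (rho * Cmod l / (2 * (Cmod (S u) + 1)) * (2 * (Cmod (S u) + 1)))%R with (rho * Cmod l)%R in H by (field; lra). lra. }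
assert (HH : forall y, (Cmod (y - u) < rho)%R ->
  cderiv (fun v => B v + RtoC t * S v) y (B1 y + RtoC t * S1 y) /\
  (Cmod (B1 y + RtoC t * S1 y - l) <= eta)%R).
{ intros y Hy. assert (Hy0 : (Cmod y < R0)%R) by (apply Cmod_lt_neighborhood with u; lra). split.
  - apply cderiv_plus; [ | apply cderiv_scal]; [now apply HB | now apply HS].
  - specialize (K1 y ltac:(lra)); specialize (K2 y ltac:(lra)).
    replace (B1 y + RtoC t * S1 y - l) with ((B1 y - l) + RtoC t * S1 y) by ring.
    eapply Rle_trans; [apply Cmod_triangle | ]. rewrite Cmod_mult, Cmod_R, Rabs_pos_eq by lra.
    fold l in K1.
    assert (t * Cmod (S1 y) <= t * M)%R.
    { apply Rmult_le_compat_l; [lra | ]. generalize (Cmod_le_add (S1 y) (S1 u)). unfold M; lra. }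
    lra. }
assert (Esub : B u + RtoC t * S u - B u = RtoC t * S u) by ring.
assert (Q : (2 * (Cmod (B u + RtoC t * S u - B u) / Cmod l) < rho)%R).
{ rewrite Esub, Cmod_mult, Cmod_R, Rabs_pos_eq by lra.
  apply Rmult_lt_reg_r with (Cmod l); auto.
  replace (2 * (t * Cmod (S u) / Cmod l) * Cmod l)%R with (2 * (t * Cmod (S u)))%R by (field; lra). lra. }
destruct (near_linear_surjective (fun v => B v + RtoC t * S v) (fun v => B1 v + RtoC t * S1 v) u l (B u) rho L) as [v [V1 V2]].
{ intros y Hy. destruct (HH y Hy) as [A1 A2]; split; auto.
  eapply Rle_trans; [exact A2 | apply Rmin_l]. }
{ exact Q. }
exists v; split; auto.
assert (Vr : (Cmod (v - u) < rho)%R) by lra.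
split; [ | apply Cmod_lt_neighborhood with u; lra].
assert (K := near_linear_increment _ _ u l rho eta u v HH).
cbv beta in K; rewrite V2 in K.
specialize (K ltac:(replace (u - u) with (RtoC 0) by ring; rewrite Cmod_0; auto) Vr).
replace (B u - (B u + RtoC t * S u) - l * (v - u)) with (- l * (v - (u - RtoC t * (S u / l)))) in K by (field; auto).
rewrite Cmod_mult, Cmod_opp in K.
rewrite Esub, Cmod_mult, Cmod_R, Rabs_pos_eq in V1 by lra.
assert (E1 : (eta * Cmod (v - u) <= eps * (Cmod l * Cmod l) / (2 * (Cmod (S u) + 1)) * (2 * (t * (Cmod (S u) + 1) / Cmod l)))%R).
{ apply Rmult_le_compat; [lra | apply Cmod_ge_0 | apply Rmin_r | ].
  eapply Rle_trans; [exact V1 | ]. apply Rmult_le_compat_l; [lra | ].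
  apply Rmult_le_compat_r; [left; now apply Rinv_0_lt_compat | ].
  apply Rmult_le_compat_l; lra. }
apply Rmult_le_reg_l with (Cmod l); auto.
eapply Rle_trans; [exact K | ]. eapply Rle_trans; [exact E1 | ]. right; field; lra.
Qed.

(** For [u = s z], division by [s^n] gives the Loewner chain [g (s z) + (s^(-n) - 1) S (s z)]. The
    factor [s^n] makes [s = 0] a regular end when [n >= 1]: only [S] remains there, and only [g] at
    [s = 1]. *)
Definition chain (n : nat) (g S : C -> C) (s : R) (u : C) : C :=
  RtoC (s ^ n) * g u + RtoC (1 - s ^ n) * S u.

Lemma chain_hol (R0 : R) (n : nat) (g g1 S S1 : C -> C) (s : R) :
  hol R0 g g1 -> hol R0 S S1 -> hol R0 (chain n g S s) (chain n g1 S1 s).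
Proof.
intros Hg HS z Hz; destruct (Hg z Hz), (HS z Hz); split; unfold chain.
- apply cderiv_plus; now apply cderiv_scal.
- apply continuous_Cplus; apply continuous_Cmult; auto; apply continuous_const.
Qed.

Lemma hol_mult_id (R0 : R) (k k1 : C -> C) : hol R0 k k1 ->
  hol R0 (fun u => u * k u) (fun u => k u + u * k1 u).
Proof.
intros Hk z Hz; destruct (Hk z Hz) as [D1 C1]; split.
- apply cderiv_eq with (1 * k z + z * k1 z); [ring | ].
  apply (cderiv_mult (fun y => y) k); auto. apply cderiv_id.
- apply continuous_Cplus; [eapply cderiv_continuous; eauto | ].
  apply continuous_Cmult; auto. apply continuous_id.
Qed.

Lemma continuous_pow_real (n : nat) (s : R) : continuous (fun x : R => x ^ n)%R s.
Proof. apply (ex_derive_continuous (fun x : R => x ^ n)%R). auto_derive; auto. Qed.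

Lemma chain_continuous (n : nat) (g S : C -> C) (s0 : R) (u0 : C) :
  continuous g u0 -> continuous S u0 -> forall eps, (0 < eps)%R -> exists d, (0 < d)%R /\
  forall s u, (Rabs (s - s0) < d)%R -> (Cmod (u - u0) < d)%R ->
    (Cmod (chain n g S s u - chain n g S s0 u0) < eps)%R.
Proof.
intros Hg HS eps He.
assert (J : @continuous (prod_UniformSpace R_UniformSpace C_UniformSpace) C_UniformSpace
   (fun p => chain n g S (fst p) (snd p)) (s0, u0)).
{ unfold chain. apply continuous_Cplus; apply continuous_Cmult.
  - apply continuous_RtoC. apply (continuous_comp fst (fun x : R => x ^ n)%R); [apply continuous_fst | apply continuous_pow_real].
  - apply (continuous_comp snd g); [apply continuous_snd | exact Hg].
  - apply continuous_RtoC. apply (continuous_minus (V := R_NormedModule)); [apply continuous_const | ].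
    apply (continuous_comp fst (fun x : R => x ^ n)%R); [apply continuous_fst | apply continuous_pow_real].
  - apply (continuous_comp snd S); [apply continuous_snd | exact HS]. }
destruct (proj1 (continuous_C _ _) J (mkposreal eps He)) as [d Hd].
exists d; split; [apply cond_pos | ]; intros s u Hs Hu.
exact (Hd (s, u) (conj Hs (ball_of_Cmod _ _ _ Hu))).
Qed.

(** The same radius serves all [s] near [s0]: this excludes collisions of nearby points when the
    parameter varies. *)
Lemma chain_locally_injective (R0 : R) (n : nat) (g g1 S S1 : C -> C) (s0 : R) (u0 : C) :
  hol R0 g g1 -> hol R0 S S1 -> (Cmod u0 < R0)%R -> chain n g1 S1 s0 u0 <> 0 ->
  exists d, (0 < d)%R /\ forall s u u', (Rabs (s - s0) < d)%R ->
    (Cmod (u - u0) < d)%R -> (Cmod (u' - u0) < d)%R -> chain n g S s u = chain n g S s u' -> u = u'.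
Proof.
intros Hg HS Hu L.
set (l := chain n g1 S1 s0 u0) in *.
assert (PL : (0 < Cmod l)%R) by now apply Cmod_gt_0.
destruct (chain_continuous n g1 S1 s0 u0 (proj2 (Hg _ Hu)) (proj2 (HS _ Hu)) (Cmod l / 2)%R ltac:(lra)) as [d [Pd Hd]].
exists (Rmin d (R0 - Cmod u0)); split; [apply Rmin_pos; lra | ].
intros s u u' Hs Hu1 Hu2 E.
generalize (Rmin_l d (R0 - Cmod u0)) (Rmin_r d (R0 - Cmod u0)); intros L1 L2.
apply (near_linear_injective (chain n g S s) (chain n g1 S1 s) u0 l (Rmin d (R0 - Cmod u0))); auto.
intros y Hy; split.
- apply (chain_hol R0); auto. apply Cmod_lt_neighborhood with u0; lra.
- left; apply Hd; lra.
Qed.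

(** Bernoulli's inequality. With its companion below it places [t = / (1 - e) ^ n - 1] between
    [INR n * e] and twice that value, once [INR n * e < 1 / 2]. *)
Lemma pow_one_minus_ge (n : nat) (e : R) : (0 <= e <= 1)%R -> (1 - INR n * e <= (1 - e) ^ n)%R.
Proof.
intros He; induction n as [ | n IH]; [simpl; lra | ].
rewrite S_INR; simpl. generalize (pos_INR n); intros Pn.
assert ((1 - e) * (1 - INR n * e) <= (1 - e) * (1 - e) ^ n)%R by (apply Rmult_le_compat_l; lra).
assert (0 <= INR n * e * e)%R by (repeat apply Rmult_le_pos; lra). lra.
Qed.

Lemma pow_one_minus_le (n : nat) (e : R) : (0 <= e <= 1)%R -> ((1 - e) ^ n * (1 + INR n * e) <= 1)%R.
Proof.
intros He; induction n as [ | n IH]; [simpl; lra | ].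
rewrite S_INR; simpl. generalize (pos_INR n); intros Pn.
assert (P := pow_le (1 - e) n ltac:(lra)).
assert ((1 - e) ^ n * ((1 - e) * (1 + (INR n + 1) * e)) <= (1 - e) ^ n * (1 + INR n * e))%R.
{ apply Rmult_le_compat_l; auto.
  assert (0 <= (INR n + 1) * e * e)%R by (repeat apply Rmult_le_pos; lra). lra. }
lra.
Qed.

(** Inversion maps the disc of centre and radius [a / 2] onto the half-plane [Re > 1 / a]: squared,
    the hypothesis reads [|l|^2 < a Re (k conj l)]. *)
Lemma Re_div_gt (k l : C) (a : R) : (0 < a)%R ->
  (Cmod (l - RtoC (a / 2) * k) < a / 2 * Cmod k)%R -> l <> 0 /\ (/ a < Re (k / l))%R.
Proof.
intros Ha H.
assert (L : l <> 0).
{ intros ->. replace (0 - RtoC (a / 2) * k) with (- (RtoC (a / 2) * k)) in H by ring.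
  rewrite Cmod_opp, Cmod_mult, Cmod_R, Rabs_pos_eq in H; lra. }
split; auto.
assert (PL : (0 < Cmod l * Cmod l)%R) by (apply Rmult_lt_0_compat; now apply Cmod_gt_0).
assert (Sq : (Cmod (l - RtoC (a / 2) * k) * Cmod (l - RtoC (a / 2) * k) < (a / 2 * Cmod k) * (a / 2 * Cmod k))%R)
  by (apply Rmult_le_0_lt_compat; auto; apply Cmod_ge_0).
replace ((a / 2 * Cmod k) * (a / 2 * Cmod k))%R with (a / 2 * (a / 2) * (Cmod k * Cmod k))%R in Sq by ring.
rewrite !Cmod_sqr in Sq.
assert (E : (Re (k / l) * (Cmod l * Cmod l) = Re k * Re l + Im k * Im l)%R).
{ rewrite Cmod_sqr in PL. rewrite Cmod_sqr. destruct k as [x y], l as [p q].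
  unfold Cdiv, Cmult, Cinv, Re, Im in *; simpl in *. field. lra. }
apply Rmult_lt_reg_r with (Cmod l * Cmod l)%R; auto. rewrite E.
apply Rmult_lt_reg_l with a; auto. rewrite Cmod_sqr.
replace (a * (/ a * (Re l * Re l + Im l * Im l)))%R with (Re l * Re l + Im l * Im l)%R by (field; lra).
destruct k as [x y], l as [p q]; unfold Cminus, Cplus, Copp, Cmult, RtoC, Re, Im in *; simpl in *. nra.
Qed.

(** From [2 m <= 1 + m^2] for the modulus [m], which leaves the first-order term exact. *)
Lemma Cmod_one_minus_le (t : R) (Y : C) : (0 <= t)%R ->
  (Cmod (1 - RtoC t * Y) <= 1 - t * Re Y + t * t * (Cmod Y * Cmod Y) / 2)%R.
Proof.
intros Ht.
set (m := Cmod (1 - RtoC t * Y)).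
assert (E : (m * m = 1 - 2 * t * Re Y + t * t * (Cmod Y * Cmod Y))%R).
{ unfold m; rewrite !Cmod_sqr. destruct Y; unfold Cminus, Cplus, Copp, Cmult, RtoC, Re, Im; simpl; ring. }
assert (0 <= (m - 1) * (m - 1))%R by apply Rle_0_sqr. lra.
Qed.

(** The radius shrinks with [s] because [u] stands for [s z] with [|z| <= r]. *)
Definition chain_injective (n : nat) (g S : C -> C) (r s : R) : Prop :=
  forall u u', (Cmod u <= r * s)%R -> (Cmod u' <= r * s)%R -> chain n g S s u = chain n g S s u' -> u = u'.

(* The point is moved along the chain: [g + a S] takes at [v] the value it took at [u] for a smaller [a],
   and [Re (k / l) > 1 / n] forces [v] into the shrunken disc. *)
Lemma chain_move (n : nat) (g g1 k k1 : C -> C) (r s eta : R) (u : C) :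
  (1 <= n)%nat -> (0 < r < 1)%R -> (0 < s <= 1)%R -> (0 < eta)%R ->
  hol 1 g g1 -> hol 1 k k1 -> (Cmod u <= r * s)%R ->
  (Cmod (chain n g1 (fun u => k u + u * k1 u)%C s u - RtoC (INR n / 2) * k u) < INR n / 2 * Cmod (k u))%R ->
  exists e0, (0 < e0)%R /\ forall e, (0 < e < e0)%R -> exists v,
    (Cmod (v - u) < eta)%R /\ (Cmod v <= r * (s * (1 - e)))%R /\
    chain n g (fun u => u * k u) (s * (1 - e)) v = RtoC ((1 - e) ^ n) * chain n g (fun u => u * k u) s u.
Proof.
intros Hn Hr Hs Heta Hg Hk Hu HX.
set (S := fun u => u * k u). set (S1 := fun u => k u + u * k1 u) in *.
assert (HS : hol 1 S S1) by now apply hol_mult_id.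
assert (Pn : (1 <= INR n)%R) by (change 1%R with (INR 1); now apply le_INR).
set (B := chain n g S s). set (B1 := chain n g1 S1 s).
assert (HB : hol 1 B B1) by now apply chain_hol.
fold (B1 u) in HX.
destruct (Re_div_gt (k u) (B1 u) (INR n) ltac:(lra) HX) as [L0 HY].
set (Y := k u / B1 u) in *.
assert (Hu1 : (Cmod u < 1)%R) by (assert (r * s <= r * 1)%R by (apply Rmult_le_compat_l; lra); lra).
assert (Prs : (0 < r * s)%R) by (apply Rmult_lt_0_compat; lra).
set (gap := (Re Y - / INR n)%R).
assert (Pgap : (0 < gap)%R) by (unfold gap; lra).
(* To first order [Cmod v] falls below the required bound by [r * s * t * gap]: the quadratic term
   in [t] takes one half of this, the error [eps * t] the other. *)
set (eps := (r * s * gap / 2)%R).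
assert (Peps : (0 < eps)%R) by (unfold eps; assert (0 < r * s * gap)%R by (apply Rmult_lt_0_compat; auto); lra).
destruct (perturbed_solution B B1 S S1 u 1 eps HB HS Hu1 L0 Peps) as [t0 [Pt0 Ht0]].
set (c1 := (eps + Cmod (u * Y) + 1)%R).
assert (Pc1 : (0 < c1)%R) by (unfold c1; generalize (Cmod_ge_0 (u * Y)); lra).
set (c2 := (Cmod Y * Cmod Y + 1)%R).
assert (PYY : (0 <= Cmod Y * Cmod Y)%R) by (apply Rmult_le_pos; apply Cmod_ge_0).
assert (Pc2 : (0 < c2)%R) by (unfold c2; lra).
set (t1 := Rmin t0 (Rmin (eta / c1) (gap / c2))).
assert (Pt1 : (0 < t1)%R) by (repeat apply Rmin_pos; auto; apply Rdiv_lt_0_compat; auto).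
assert (t1 <= t0 /\ t1 <= eta / c1 /\ t1 <= gap / c2)%R as [T1 [T2 T3]].
{ generalize (Rmin_l t0 (Rmin (eta / c1) (gap / c2))) (Rmin_r t0 (Rmin (eta / c1) (gap / c2)))
   (Rmin_l (eta / c1) (gap / c2)) (Rmin_r (eta / c1) (gap / c2)); unfold t1; lra. }
exists (Rmin (/ (2 * INR n)) (t1 / (2 * INR n))); split.
{ apply Rmin_pos; [apply Rinv_0_lt_compat; lra | apply Rdiv_lt_0_compat; lra]. }
intros e [Pe He].
assert (E1 : (INR n * e < 1 / 2)%R).
{ assert (e < / (2 * INR n))%R by (eapply Rlt_le_trans; [exact He | apply Rmin_l]).
  apply Rmult_lt_compat_l with (r := INR n) in H; [ | lra].
  replace (INR n * / (2 * INR n))%R with (1 / 2)%R in H by (field; lra). exact H. }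
assert (E2 : (2 * (INR n * e) < t1)%R).
{ assert (e < t1 / (2 * INR n))%R by (eapply Rlt_le_trans; [exact He | apply Rmin_r]).
  apply Rmult_lt_compat_l with (r := (2 * INR n)%R) in H; [ | lra].
  replace (2 * INR n * (t1 / (2 * INR n)))%R with t1 in H by (field; lra). lra. }
assert (e <= INR n * e)%R by (assert (1 * e <= INR n * e)%R by (apply Rmult_le_compat_r; lra); lra).
assert (Q1 := pow_one_minus_ge n e ltac:(lra)).
assert (Q2 := pow_one_minus_le n e ltac:(lra)).
set (q := ((1 - e) ^ n)%R) in *.
assert (Pq : (1 / 2 < q)%R) by lra.
(* With [q = (1 - e) ^ n], the chain at parameter [s * (1 - e)] is [q * (B v + (/ q - 1) * S v)], so
   the equation to solve is [B v + t * S v = B u]. *)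
set (t := (/ q - 1)%R).
assert (Eq : (q * (1 + t) = 1)%R) by (unfold t; field; lra).
assert (Tn : (INR n * e <= t)%R).
{ apply Rmult_le_reg_l with q; [lra | ]. lra. }
assert (Tt : (t < t1)%R).
{ apply Rle_lt_trans with (2 * (INR n * e))%R; auto.
  apply Rmult_le_reg_l with q; [lra | ].
  assert (1 * (INR n * e) <= (2 * q) * (INR n * e))%R by (apply Rmult_le_compat_r; lra). lra. }
assert (Pt : (0 < t)%R) by lra.
destruct (Ht0 t ltac:(lra)) as [v [V1 [V2 V3]]].
assert (ES : S u / B1 u = u * Y) by (unfold S, Y; field; auto).
rewrite ES in V2.
exists v; split; [ | split].
- replace (v - u) with ((v - (u - RtoC t * (u * Y))) + - (RtoC t * (u * Y))) by ring.
  eapply Rle_lt_trans; [apply Cmod_triangle | ].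
  rewrite Cmod_opp, (Cmod_mult (RtoC t)), Cmod_R, (Rabs_pos_eq t) by lra.
  assert (t * c1 < eta)%R.
  { assert (t < eta / c1)%R by lra. apply Rmult_lt_compat_r with (r := c1) in H0; auto.
    replace (eta / c1 * c1)%R with eta in H0 by (field; lra). exact H0. }
  unfold c1 in H0. lra.
- assert (V4 : (Cmod v <= Cmod u * Cmod (1 - RtoC t * Y) + eps * t)%R).
  { rewrite <- Cmod_mult. replace (u * (1 - RtoC t * Y)) with (u - RtoC t * (u * Y)) by ring.
    eapply Rle_trans; [apply (Cmod_le_add v (u - RtoC t * (u * Y))) | lra]. }
  assert (V5 := Cmod_one_minus_le t Y ltac:(lra)).
  assert (V6 : (t * (Cmod Y * Cmod Y) <= gap)%R).
  { assert (t <= gap / c2)%R by lra. apply Rmult_le_compat_r with (r := c2) in H0; [ | lra].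
    replace (gap / c2 * c2)%R with gap in H0 by (field; lra). unfold c2 in H0. lra. }
  assert (V7 : (Cmod (1 - RtoC t * Y) <= 1 - t * / INR n - t * gap / 2)%R).
  { apply Rmult_le_compat_l with (r := t) in V6; [ | lra]. unfold gap in *. lra. }
  assert (V8 : (Cmod u * Cmod (1 - RtoC t * Y) <= r * s * (1 - t * / INR n - t * gap / 2))%R).
  { apply Rmult_le_compat; auto; apply Cmod_ge_0. }
  assert (V9 : (e <= t * / INR n)%R).
  { apply Rmult_le_reg_l with (INR n); [lra | ].
    replace (INR n * (t * / INR n))%R with t by (field; lra). exact Tn. }
  assert (r * s * e <= r * s * (t * / INR n))%R by (apply Rmult_le_compat_l; lra).
  unfold eps in V4. lra.
- unfold chain. fold S. fold q. rewrite Rpow_mult_distr. fold q.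
  replace (RtoC (s ^ n) * g u + RtoC (1 - s ^ n) * S u) with (B u) by reflexivity.
  rewrite <- V1. unfold B, chain, t.
  rewrite !RtoC_minus, RtoC_mult, RtoC_inv by lra.
  assert (RtoC q <> 0) by (intros E; injection E; lra).
  field; auto.
Qed.

Lemma chain_univalent (n : nat) (g g1 k k1 : C -> C) (r : R) :
  (1 <= n)%nat -> (0 < r < 1)%R -> hol 1 g g1 -> hol 1 k k1 -> k 0 <> 0 ->
  (forall s u, (0 < s <= 1)%R -> (Cmod u <= r * s)%R ->
    (Cmod (chain n g1 (fun u => k u + u * k1 u)%C s u - RtoC (INR n / 2) * k u) < INR n / 2 * Cmod (k u))%R) ->
  forall u u', (Cmod u <= r)%R -> (Cmod u' <= r)%R -> g u = g u' -> u = u'.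
Proof.
intros Hn Hr Hg Hk K0 HX.
set (S := fun u => u * k u). set (S1 := fun u => k u + u * k1 u) in *.
assert (HS : hol 1 S S1) by now apply hol_mult_id.
assert (Pn : (1 <= INR n)%R) by (change 1%R with (INR 1); now apply le_INR).
assert (In1 : forall s u, (0 < s <= 1)%R -> (Cmod u <= r * s)%R -> (Cmod u < 1)%R).
{ intros s u Hs Hu. assert (r * s <= r * 1)%R by (apply Rmult_le_compat_l; lra). lra. }
assert (NZ : forall s u, (0 < s <= 1)%R -> (Cmod u <= r * s)%R -> chain n g1 S1 s u <> 0).
{ intros s u Hs Hu. exact (proj1 (Re_div_gt (k u) (chain n g1 S1 s u) (INR n) ltac:(lra) (HX s u Hs Hu))). }
set (bad := fun s => (0 < s <= 1)%R /\ ~ chain_injective n g S r s).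
assert (NB1 : ~ bad 1%R).
{ intros B1.
  (* [sg] is the infimum of the parameters with a collision, as the supremum of their lower
     bounds. *)
  destruct (completeness (fun x => forall s, bad s -> (x <= s)%R)) as [sg [U1 U2]].
  - exists 1%R; intros x Hx. now apply Hx.
  - exists 0%R; intros s [Hs _]; lra.
  - assert (LB : forall s, bad s -> (sg <= s)%R) by (intros s Hs; apply U2; intros x Hx; now apply Hx).
    (* At [s = 0] the chain is [u * k u], of slope [k 0] at 0; for small [s] the disc of radius
       [r * s] lies in a neighbourhood of local injectivity. *)
    assert (Psg : (0 < sg)%R).
    { assert (H0 : chain n g1 S1 0 0 <> 0).
      { unfold chain, S1. rewrite pow_i by lia. rewrite Rminus_0_r.
        replace (RtoC 0 * g1 0 + RtoC 1 * (k 0 + 0 * k1 0)) with (k 0) by ring. exact K0. }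
      destruct (chain_locally_injective 1 n g g1 S S1 0 0 Hg HS ltac:(rewrite Cmod_0; lra) H0) as [d [Pd Hd]].
      apply Rlt_le_trans with d; auto. apply U1. intros s [Hs Bs].
      destruct (Rle_dec d s) as [ | L]; auto. exfalso; apply Bs.
      intros u u' Hu Hu' E. apply (Hd s); auto.
      - rewrite Rminus_0_r, Rabs_pos_eq; lra.
      - replace (u - 0) with u by ring. nra.
      - replace (u' - 0) with u' by ring. nra. }
    assert (Lsg : (sg <= 1)%R) by now apply LB.
    (* Both cases are absurd: injectivity at [sg] would extend to slightly larger parameters, and a
       collision at [sg] would move to smaller ones. *)
    destruct (classic (chain_injective n g S r sg)) as [I | NI].
    + destruct (compact_disc2 r (fun d u u' => forall s, (s <= 1)%R -> (Rabs (s - sg) < d)%R ->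
         (Cmod u <= r * s)%R -> (Cmod u' <= r * s)%R -> chain n g S s u = chain n g S s u' -> u = u')) as [d [Pd Hd]].
      * intros d d' y y' Hd HQ s Hs1 Hs. apply HQ; auto; lra.
      * intros x x' Hx Hx'.
        assert (Out : forall x : C, ~ (Cmod x <= r * sg)%R -> exists d, (0 < d)%R /\ forall y s,
           (Cmod (y - x) < d)%R -> (Rabs (s - sg) < d)%R -> ~ (Cmod y <= r * s)%R).
        { intros w Hw. exists ((Cmod w - r * sg) / 2)%R; split; [lra | ]. intros y s Hy Hs Hys.
          rewrite Cmod_sub_sym in Hy. generalize (Cmod_le_add w y). apply Rabs_lt_between in Hs.
          assert (r * (s - sg) <= Rabs (s - sg))%R.
          { destruct (Rle_dec 0 (s - sg)).
            - rewrite Rabs_pos_eq by auto. nra.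
            - assert (r * (s - sg) <= r * 0)%R by (apply Rmult_le_compat_l; lra). generalize (Rabs_pos (s - sg)); lra. }
          assert (Rabs (s - sg) < (Cmod w - r * sg) / 2)%R by (apply Rabs_lt_between; lra).
          lra. }
        destruct (Rle_dec (Cmod x) (r * sg)) as [X1 | X1];
          [destruct (Rle_dec (Cmod x') (r * sg)) as [X2 | X2] | ].
        -- destruct (classic (x = x')) as [<- | NE].
           ++ destruct (chain_locally_injective 1 n g g1 S S1 sg x Hg HS (In1 sg x ltac:(lra) X1) (NZ sg x ltac:(lra) X1)) as [d [Pd Hd]].
              exists d; split; auto. intros y y' Hy Hy' s _ Hs _ _. now apply Hd.
           ++ assert (NE' : chain n g S sg x - chain n g S sg x' <> 0).
              { intros E. apply NE, I; auto.
                replace (chain n g S sg x) with (chain n g S sg x - chain n g S sg x' + chain n g S sg x') by ring. rewrite E; ring. }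
              apply Cmod_gt_0 in NE'.
              assert (x1 := In1 sg x ltac:(lra) X1). assert (x1' := In1 sg x' ltac:(lra) X2).
              destruct (chain_continuous n g S sg x (hol_continuous _ _ _ _ Hg x1) (hol_continuous _ _ _ _ HS x1) (Cmod (chain n g S sg x - chain n g S sg x') / 2)%R ltac:(lra)) as [d1 [P1 D1]].
              destruct (chain_continuous n g S sg x' (hol_continuous _ _ _ _ Hg x1') (hol_continuous _ _ _ _ HS x1') (Cmod (chain n g S sg x - chain n g S sg x') / 2)%R ltac:(lra)) as [d2 [P2 D2]].
              exists (Rmin d1 d2); split; [now apply Rmin_pos | ].
              generalize (Rmin_l d1 d2) (Rmin_r d1 d2); intros L1 L2.
              intros y y' Hy Hy' s _ Hs _ _ E. exfalso.
              specialize (D1 s y ltac:(lra) ltac:(lra)). specialize (D2 s y' ltac:(lra) ltac:(lra)).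
              rewrite E, Cmod_sub_sym in D1.
              generalize (Cmod_triangle_sub (chain n g S sg x) (chain n g S s y') (chain n g S sg x')). lra.
        -- destruct (Out x' X2) as [d [Pd Hd]]. exists d; split; auto.
           intros y y' _ Hy' s _ Hs _ F. exfalso. now apply (Hd y' s).
        -- destruct (Out x X1) as [d [Pd Hd]]. exists d; split; auto.
           intros y y' Hy _ s _ Hs F. exfalso. now apply (Hd y s).
      * assert (sg + d <= sg)%R; [ | lra].
        apply U1. intros s [Hs Bs].
        destruct (Rle_dec (sg + d) s) as [ | L]; auto. exfalso; apply Bs.
        assert (Ls := LB s (conj Hs Bs)).
        assert (r * s <= r)%R by nra.
        intros u u' Hu Hu' E. apply (Hd u u' ltac:(lra) ltac:(lra) s); auto; [lra | ].
        rewrite Rabs_pos_eq; lra.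
    + apply NI. intros u u' Hu Hu' E. apply NNPP; intros NE.
      (* Displacements below half the distance keep the two points distinct. Both are moved with the
         same [e], so their images receive the same factor and still agree. *)
      assert (Pe : (0 < Cmod (u - u') / 2)%R).
      { assert (0 < Cmod (u - u'))%R; [ | lra]. apply Cmod_gt_0. intros E0; apply NE.
        replace u with (u - u' + u') by ring. rewrite E0; ring. }
      destruct (chain_move n g g1 k k1 r sg _ u Hn Hr (conj Psg Lsg) Pe Hg Hk Hu (HX sg u (conj Psg Lsg) Hu)) as [e1 [P1 M1]].
      destruct (chain_move n g g1 k k1 r sg _ u' Hn Hr (conj Psg Lsg) Pe Hg Hk Hu' (HX sg u' (conj Psg Lsg) Hu')) as [e2 [P2 M2]].
      set (e := (Rmin (Rmin e1 e2) 1 / 2)%R).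
      generalize (Rmin_l (Rmin e1 e2) 1) (Rmin_r (Rmin e1 e2) 1) (Rmin_l e1 e2) (Rmin_r e1 e2); intros L1 L2 L3 L4.
      assert (Pe0 : (0 < Rmin (Rmin e1 e2) 1)%R) by (repeat apply Rmin_pos; auto; lra).
      destruct (M1 e ltac:(unfold e; lra)) as [v [V1 [V2 V3]]].
      destruct (M2 e ltac:(unfold e; lra)) as [v' [V1' [V2' V3']]].
      assert (Hse : (0 < sg * (1 - e) < sg)%R).
      { assert (0 < e <= 1 / 2)%R by (unfold e; lra). split; nra. }
      assert (BS : bad (sg * (1 - e))%R).
      { split; [lra | ]. intros I.
        assert (v = v').
        { apply I; auto. unfold S; rewrite V3, V3'. fold S. now rewrite E. }
        subst v'. rewrite Cmod_sub_sym in V1.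
        generalize (Cmod_triangle_sub u v u'). lra. }
      apply LB in BS. lra. }
intros u u' Hu Hu' E.
apply NNPP; intros NE. apply NB1. split; [lra | ]. intros I. apply NE, I; try lra.
unfold chain. rewrite pow1, E. replace (1 - 1)%R with 0%R by ring. ring.
Qed.

(** * Sufficiency *)

Lemma Re_plus (x y : C) : Re (x + y) = (Re x + Re y)%R.
Proof. reflexivity. Qed.

Lemma Re_Rmult (a : R) (z : C) : Re (RtoC a * z) = (a * Re z)%R.
Proof. destruct z; unfold Re, Cmult, RtoC; simpl; ring. Qed.

Lemma Im_Rmult (a : R) (z : C) : Im (RtoC a * z) = (a * Im z)%R.
Proof. destruct z; unfold Im, Cmult, RtoC; simpl; ring. Qed.

Lemma Cmod_lt_of_sqr (x y : C) : (Cmod x * Cmod x < Cmod y * Cmod y)%R -> (Cmod x < Cmod y)%R.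
Proof. intros H. generalize (Cmod_ge_0 x) (Cmod_ge_0 y); nra. Qed.

(** Take [w = Q / (Q + 2)] with [Q = z * h1 z]: [Re Q > -1] means that [Q] is nearer to 0 than to
    -2, so [w] maps into the unit disc and fixes 0. *)
Lemma schwarz_half_plane (h h1 : C -> C) :
  hol 1 h h1 -> (forall z, (Cmod z < 1)%R -> (0 < Re (1 + z * h1 z))%R) ->
  forall z, (Cmod z < 1)%R -> exists w, (Cmod w <= Cmod z)%R /\ z * h1 z * (1 - w) = 2 * w.
Proof.
intros Hh HK.
destruct (hol_derivative 1 h h1 Hh) as [h2 Hh1].
set (Q := fun z => z * h1 z).
set (w := fun z => Q z / (Q z + 2)).
assert (RQ : forall z, (Cmod z < 1)%R -> (-1 < Re (Q z))%R).
{ intros z Hz. generalize (HK z Hz). rewrite Re_plus. unfold Q. change (Re 1) with 1%R. lra. }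
assert (Q2 : forall z, (Cmod z < 1)%R -> Q z + 2 <> 0).
{ intros z Hz E. generalize (RQ z Hz). replace (Q z) with (Q z + 2 - 2) by ring. rewrite E.
  unfold Cminus, Cplus, Copp, RtoC, Re; simpl. lra. }
assert (HQ : hol 1 Q (fun z => h1 z + z * h2 z)).
{ now apply hol_mult_id. }
assert (Hw : hol 1 w (fun z => ((h1 z + z * h2 z) * (Q z + 2) - Q z * (h1 z + z * h2 z + 0)) / ((Q z + 2) * (Q z + 2)))).
{ intros z Hz; destruct (HQ z Hz) as [D1 C1]; split.
  - apply (cderiv_div Q (fun z => Q z + 2)); auto. apply cderiv_plus; auto. apply cderiv_const.
  - assert (CQ : continuous Q z) by (eapply cderiv_continuous; eauto).
    assert (CQ2 : continuous (fun z => Q z + 2) z) by (apply continuous_Cplus; auto; apply continuous_const).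
    apply continuous_Cmult.
    + apply continuous_Cminus; apply continuous_Cmult; auto.
      apply continuous_Cplus; auto; apply continuous_const.
    + apply continuous_Cinv; [ | now apply continuous_Cmult]. apply Cmult_neq_0; auto. }
intros z Hz. exists (w z); split.
- assert (S := schwarz 1 w _ z Hw). rewrite Rmult_1_l in S. apply S; auto.
  + unfold w, Q, Cdiv. ring.
  + intros y Hy. unfold w. rewrite Cmod_div by auto.
    assert (P : (0 < Cmod (Q y + 2))%R) by (apply Cmod_gt_0; auto).
    apply Rmult_le_reg_r with (Cmod (Q y + 2)); auto.
    unfold Rdiv; rewrite Rmult_assoc, Rinv_l, Rmult_1_r, Rmult_1_l by lra.
    left; apply Cmod_lt_of_sqr. rewrite !Cmod_sqr.
    generalize (RQ y Hy). destruct (Q y); unfold Cplus, RtoC, Re, Im; simpl. nra.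
- fold (Q z). unfold w. field. auto.
Qed.

(** With [m = Cmod w] and [x = Re w], the difference of squared moduli is [(1 + a^2 - m (1 + b)) (1
    - a^2 - m (1 - b)) + 2 (m - x) (1 - a^2 b)]. The worst case is [x = m], where it factors. *)
Lemma disc_estimate (a b : R) (w : C) : (0 <= a < 1)%R -> (a * a <= b <= 1)%R -> (Cmod w <= a)%R ->
  (Cmod (RtoC b * w - RtoC (a * a)) < Cmod (1 - w))%R.
Proof.
intros Ha Hb Hw.
apply Cmod_lt_of_sqr. rewrite !Cmod_sqr.
assert (M := Cmod_ge_0 w). assert (E := Cmod_sqr w).
assert (X : (Re w <= Cmod w)%R) by (eapply Rle_trans; [apply Rle_abs | apply re_le_Cmod]).
set (m := Cmod w) in *.
assert (A2 : (0 <= a * a)%R) by nra.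
replace (Re (RtoC b * w - RtoC (a * a)) * Re (RtoC b * w - RtoC (a * a)) + Im (RtoC b * w - RtoC (a * a)) * Im (RtoC b * w - RtoC (a * a)))%R
  with (b * b * (m * m) - 2 * (a * a) * b * Re w + a * a * (a * a))%R
  by (rewrite E; destruct w; unfold Cminus, Cplus, Copp, Cmult, RtoC, Re, Im; simpl; ring).
replace (Re (1 - w) * Re (1 - w) + Im (1 - w) * Im (1 - w))%R with (1 - 2 * Re w + m * m)%R
  by (rewrite E; destruct w; unfold Cminus, Cplus, Copp, Cmult, RtoC, Re, Im; simpl; ring).
assert (F1 : (0 < 1 + a * a - m * (1 + b))%R).
{ assert (m * (1 + b) <= a * 2)%R by (apply Rmult_le_compat; lra). nra. }
assert (F2 : (0 < 1 - a * a - m * (1 - b))%R).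
{ assert (m * (1 - b) <= a * (1 - a * a))%R by (apply Rmult_le_compat; lra).
  assert (0 < (1 - a) * (1 - a * a))%R by (apply Rmult_lt_0_compat; nra). lra. }
assert (F := Rmult_lt_0_compat _ _ F1 F2).
assert (G : (0 <= (m - Re w) * (1 - a * a * b))%R) by (apply Rmult_le_pos; nra).
lra.
Qed.

Lemma hol_exp_scal (R0 : R) (h h1 : C -> C) (c : C) : hol R0 h h1 ->
  hol R0 (fun z => Cexp (c * h z)) (fun z => Cexp (c * h z) * (c * h1 z)).
Proof.
intros Hh z Hz; destruct (Hh z Hz) as [D1 C1]; split.
- apply (cderiv_exp (fun z => c * h z)). now apply cderiv_scal.
- apply continuous_Cmult.
  + apply continuous_Cexp, continuous_Cmult; [apply continuous_const | eapply cderiv_continuous; eauto].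
  + apply continuous_Cmult; auto; apply continuous_const.
Qed.

Lemma hol_scal (R0 : R) (f f1 : C -> C) (c : C) : hol R0 f f1 ->
  hol R0 (fun z => c * f z) (fun z => c * f1 z).
Proof.
intros Hf z Hz; destruct (Hf z Hz); split; [now apply cderiv_scal | ].
apply continuous_Cmult; auto; apply continuous_const.
Qed.

Lemma univalent_small_exponent (h h1 g : C -> C) (kap : C) :
  hol 1 h h1 -> (forall z, (Cmod z < 1)%R -> (0 < Re (1 + z * h1 z))%R) ->
  hol 1 g (fun z => Cexp (kap * h z)) -> (Cmod kap <= 1 / 2)%R ->
  forall r u u', (0 < r < 1)%R -> (Cmod u <= r)%R -> (Cmod u' <= r)%R -> g u = g u' -> u = u'.
Proof.
intros Hh HK Hg Hkap r u u' Hr.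
(* For [r] near 1 and [w = s], the term [(1 - s^2) kap 2 w / (1 - w)] equals [2 kap s (1 + s)],
   about twice too large; adding [c s^2] brings it close to [2 kap s]. The factor [r * r] keeps
   [1 + c] away from 0 at [kap = 1/2]. *)
set (c := - (2 * kap * RtoC (r * r))).
assert (Pc : (Cmod c < 1)%R).
{ unfold c. rewrite Cmod_opp, !Cmod_mult, !Cmod_R, !Rabs_pos_eq by nra.
  assert (0 <= Cmod kap)%R by apply Cmod_ge_0. assert (r * r < 1)%R by nra.
  assert (0 < r * r)%R by nra. nra. }
assert (C1 : 1 + c <> 0).
{ intros E. assert (c = - (1)) as Ec by (replace c with (1 + c - 1) by ring; rewrite E; ring).
  rewrite Ec, Cmod_m1 in Pc. lra. }
apply (chain_univalent 2 g (fun z => Cexp (kap * h z)) (fun z => / (1 + c) * Cexp (kap * h z))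
  (fun z => / (1 + c) * (Cexp (kap * h z) * (kap * h1 z)))); auto.
- apply hol_scal, hol_exp_scal, Hh.
- apply Cmult_neq_0; [now apply Cinv_nonzero | apply Cexp_neq_0].
- intros s z Hs Hz.
  assert (Hz1 : (Cmod z < 1)%R) by nra.
  destruct (schwarz_half_plane h h1 Hh HK z Hz1) as [w [W1 W2]].
  assert (W0 : 1 - w <> 0).
  { intros E. assert (w = 1) as Ew by (replace w with (1 - (1 - w)) by ring; rewrite E; ring).
    rewrite Ew, Cmod_1 in W1. lra. }
  unfold chain.
  set (E := Cexp (kap * h z)). set (K := / (1 + c) * E).
  assert (EK : E = (1 + c) * K) by (unfold K; field; auto).
  change (INR 2) with 2%R. replace (2 / 2)%R with 1%R by field.
  set (s2 := (s ^ 2)%R).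
  assert (Es2 : s2 = (s * s)%R) by (unfold s2; ring).
  (* Numerator of the deviation from the centre of the disc, over the denominator [1 - w] and
     without the factor [2 * kap]. It has the shape of [disc_estimate] with [a = r * s]. *)
  set (p := RtoC (1 - s2 + r * r * s2) * w - RtoC (r * r * s2)).
  assert (Ep : RtoC s2 * E + RtoC (1 - s2) * (K + z * (/ (1 + c) * (E * (kap * h1 z)))) - RtoC 1 * K
     = K * (2 * kap * p / (1 - w))).
  { replace (K + z * (/ (1 + c) * (E * (kap * h1 z)))) with (K * (1 + kap * (z * h1 z))) by (unfold K; ring).
    replace (z * h1 z) with (2 * w / (1 - w)).
    - rewrite EK. unfold p, c. rewrite !RtoC_plus, !RtoC_minus, !RtoC_mult. field; auto.
    - rewrite <- W2. field; auto. }
  rewrite Ep, Cmod_mult, Rmult_1_l.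
  assert (PK : (0 < Cmod K)%R) by (apply Cmod_gt_0, Cmult_neq_0; [now apply Cinv_nonzero | apply Cexp_neq_0]).
  assert (HP : (Cmod p < Cmod (1 - w))%R).
  { unfold p. replace (r * r * s2)%R with ((r * s) * (r * s))%R by (rewrite Es2; ring).
    assert (0 < r * s)%R by (apply Rmult_lt_0_compat; lra).
    assert (r * s <= r)%R by nra.
    assert (s2 <= 1 /\ 0 < s2)%R as [S1 S2] by (rewrite Es2; split; nra).
    assert (r * s <= s)%R by nra.
    assert (r * s * (r * s) <= s2)%R by (rewrite Es2; apply Rmult_le_compat; lra).
    apply disc_estimate; lra. }
  assert (PW : (0 < Cmod (1 - w))%R) by now apply Cmod_gt_0.
  assert (HQ : (Cmod (2 * kap * p / (1 - w)) < 1)%R).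
  { rewrite Cmod_div, !Cmod_mult, Cmod_R, Rabs_pos_eq by (auto; lra).
    apply Rmult_lt_reg_r with (Cmod (1 - w)); auto.
    unfold Rdiv; rewrite Rmult_assoc, Rinv_l, Rmult_1_r, Rmult_1_l by lra.
    assert (2 * Cmod kap * Cmod p <= 1 * Cmod p)%R by (apply Rmult_le_compat_r; [apply Cmod_ge_0 | lra]).
    lra. }
  nra.
Qed.

(** * The argument of the derivative of a convex function *)

Lemma Re_neg_two_div (w : C) : Cmod w = 1%R -> 1 - w <> 0 -> Re (- (2) * w / (1 - w)) = 1%R.
Proof.
intros H N.
assert (E := Cmod_sqr w). rewrite H in E.
assert (P : (0 < Cmod (1 - w) * Cmod (1 - w))%R) by (apply Rmult_lt_0_compat; now apply Cmod_gt_0).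
rewrite Cmod_sqr in P.
destruct w as [x y]; unfold Cdiv, Cinv, Cminus, Cplus, Copp, Cmult, RtoC, Re, Im in *; simpl in *.
field_simplify_eq; [nra | nra].
Qed.

(* Jack's lemma at the first point where [|w| = 1], differentiated in the direction
   [- c z0] with [c = -2 w0 / (1 - w0)], for which [z0 h1 z0 = - c conj(w0) z0 w1 z0]. *)
Lemma marx_strohhacker (h h1 : C -> C) :
  hol 1 h h1 -> h 0 = 0 -> (forall z, (Cmod z < 1)%R -> (0 < Re (1 + z * h1 z))%R) ->
  forall z, (Cmod z < 1)%R -> (Cmod (1 - Cexp (RtoC (- / 2) * h z)) < 1)%R.
Proof.
intros Hh H0 HK z Hz.
(* [|1 - 1 / p| < 1] means [Re p > 1 / 2]; with [p = exp (h / 2)] this is the Marx-Strohhacker bound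
   for the square root of the derivative of a convex function. *)
set (v := fun z => Cexp (RtoC (- / 2) * h z)).
set (v1 := fun z => v z * (RtoC (- / 2) * h1 z)).
assert (Hv : hol 1 v v1) by now apply hol_exp_scal.
set (w := fun z => 1 - v z).
assert (Hw : hol 1 w (fun z => 0 - v1 z)).
{ intros y Hy; destruct (Hv y Hy); split.
  - apply cderiv_minus; auto. apply cderiv_const.
  - apply continuous_Cminus; auto. apply continuous_const. }
assert (W0 : w 0 = 0).
{ unfold w, v. rewrite H0, Cmult_0_r, Cexp_0. ring. }
fold (v z). fold (w z).
destruct (Rlt_dec (Cmod (w z)) 1) as [ | NL]; auto. exfalso.
set (bad := fun y => (Cmod y < 1)%R /\ (1 <= Cmod (w y))%R).
destruct (completeness (fun x => forall y, bad y -> (x <= Cmod y)%R)) as [rho [U1 U2]].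
- exists 1%R; intros x Hx. assert (x <= Cmod z)%R by (apply Hx; split; lra). lra.
- exists 0%R; intros y _. apply Cmod_ge_0.
- assert (LB : forall y, bad y -> (rho <= Cmod y)%R) by (intros y Hy; apply U2; intros x Hx; now apply Hx).
  assert (R1 : (rho < 1)%R) by (apply Rle_lt_trans with (Cmod z); auto; apply LB; split; lra).
  assert (Cw : forall y, (Cmod y < 1)%R -> continuous w y) by (intros; eapply hol_continuous; eauto).
  assert (R0 : (0 < rho)%R).
  { destruct (proj1 (continuousP w 0) (Cw 0 ltac:(rewrite Cmod_0; lra)) 1%R ltac:(lra)) as [d [Pd Hd]].
    apply Rlt_le_trans with d; auto. apply U1. intros y [B1 B2].
    destruct (Rle_dec d (Cmod y)) as [ | L]; auto. exfalso.
    specialize (Hd y). rewrite W0 in Hd.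
    replace (y - 0) with y in Hd by ring. replace (w y - 0) with (w y) in Hd by ring.
    specialize (Hd ltac:(lra)). lra. }
  assert (Sch : forall y, (Cmod y < rho)%R -> (rho * Cmod (w y) <= Cmod y)%R).
  { intros y Hy. apply (schwarz rho w (fun z => 0 - v1 z)); auto.
    - intros x Hx; apply Hw; lra.
    - intros x Hx. destruct (Rle_dec (Cmod (w x)) 1) as [ | L]; auto. exfalso.
      assert (rho <= Cmod x)%R by (apply LB; split; lra). lra. }
  assert (Touch : exists z0, Cmod z0 = rho /\ (1 <= Cmod (w z0))%R).
  { apply NNPP; intros N.
    assert (In : forall y, (Cmod y <= rho)%R -> (Cmod (w y) < 1)%R).
    { intros y Hy. destruct (Rlt_dec (Cmod (w y)) 1) as [ | L]; auto. exfalso; apply N.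
      exists y; split; [ | lra]. apply Rle_antisym; auto. apply LB; split; lra. }
    (* Without a contact on [Cmod y = rho], the bound [Cmod (w y) < 1] would persist beyond [rho].
       The radius [(1 + rho) / 2] exceeds [rho] and keeps the compact disc inside the unit disc. *)
    destruct (compact_disc ((1 + rho) / 2) (fun d y => (Cmod y < rho + d)%R -> (Cmod (w y) < 1)%R)) as [d [Pd Hd]].
    - intros d d' y Hd Q Hy; apply Q; lra.
    - intros x Hx. destruct (Rle_dec (Cmod x) rho) as [Lx | Lx].
      + specialize (In x Lx).
        destruct (proj1 (continuousP w x) (Cw x ltac:(lra)) (1 - Cmod (w x))%R ltac:(lra)) as [d [Pd Hd]].
        exists d; split; auto. intros y Hy _. specialize (Hd y Hy).
        generalize (Cmod_le_add (w y) (w x)); lra.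
      + exists ((Cmod x - rho) / 2)%R; split; [lra | ]. intros y Hy Hy'. exfalso.
        rewrite Cmod_sub_sym in Hy. generalize (Cmod_le_add x y); lra.
    - assert (Rmin (rho + d) ((1 + rho) / 2) <= rho)%R.
      { apply U1. intros y [B1 B2].
        destruct (Rle_dec (Rmin (rho + d) ((1 + rho) / 2)) (Cmod y)) as [ | L]; auto. exfalso.
        generalize (Rmin_l (rho + d) ((1 + rho) / 2)) (Rmin_r (rho + d) ((1 + rho) / 2)); intros.
        specialize (Hd y ltac:(lra) ltac:(lra)). lra. }
      revert H. apply Rlt_not_le, Rmin_glb_lt; lra. }
  destruct Touch as [z0 [Z0 Z1]].
  assert (Hz0 : (Cmod z0 < 1)%R) by lra.
  set (w0 := w z0) in *. set (D := 0 - v1 z0).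
  assert (Dw : cderiv w z0 D) by (apply Hw; lra).
  (* radial continuity turns the Schwarz bound into [|w0| <= 1] *)
  assert (Z2 : (Cmod w0 <= 1)%R).
  { apply le_epsilon; intros e He.
    destruct (proj1 (continuousP w z0) (Cw z0 Hz0) e He) as [d [Pd Hd]].
    set (x := (Rmin (d / 2) (1 / 2))%R).
    assert (0 < x /\ x <= d / 2 /\ x <= 1 / 2)%R as [X1 [X2 X3]].
    { split; [apply Rmin_pos; lra | split; [apply Rmin_l | apply Rmin_r]]. }
    set (y := RtoC (1 - x) * z0).
    assert (My : Cmod y = ((1 - x) * rho)%R).
    { unfold y. rewrite Cmod_mult, Cmod_R, Rabs_pos_eq, Z0; lra. }
    assert (Hy : (Cmod (y - z0) < d)%R).
    { unfold y. replace (RtoC (1 - x) * z0 - z0) with (- (RtoC x * z0)) by (rewrite RtoC_minus; ring).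
      rewrite Cmod_opp, Cmod_mult, Cmod_R, Rabs_pos_eq, Z0 by lra. nra. }
    specialize (Hd y Hy). specialize (Sch y ltac:(rewrite My; nra)). rewrite My in Sch.
    assert (Cmod (w y) <= 1)%R by nra.
    rewrite Cmod_sub_sym in Hd. generalize (Cmod_le_add w0 (w y)). fold w0 in Hd. lra. }
  assert (Mw : Cmod w0 = 1%R) by lra.
  assert (Nw : 1 - w0 <> 0).
  { unfold w0, w. replace (1 - (1 - v z0)) with (v z0) by ring. apply Cexp_neq_0. }
  (* Differentiating [1 - w = exp (- h / 2)] gives [z h' = 2 z w' / (1 - w)]. At [z0], with
     [z0 w' = k w0], this is [- k c]. *)
  set (c := - (2) * w0 / (1 - w0)).
  assert (Rc : Re c = 1%R) by now apply Re_neg_two_div.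
  set (k := Cconj w0 * (z0 * D)).
  assert (Ck : Cconj w0 * w0 = 1).
  { assert (E := Cmod_sqr w0). rewrite Mw in E. destruct w0 as [p q].
    unfold Cconj, Cmult, RtoC, Re, Im in *; simpl in *. f_equal; lra. }
  assert (Ekc : k * c = - (z0 * h1 z0)).
  { unfold k, c. replace (Cconj w0 * (z0 * D) * (- (2) * w0 / (1 - w0))) with
      ((Cconj w0 * w0) * (- (2) * (z0 * D) / (1 - w0))) by (field; auto).
    rewrite Ck. unfold D, v1, w0, w in *.
    replace (1 - (1 - v z0)) with (v z0) in * by ring.
    replace (RtoC (- / 2)) with (- / (2)) by (rewrite RtoC_opp, RtoC_inv by lra; reflexivity).
    field; auto. }
  (* The contradiction: at [z0 (1 - e c)] the real part of [conj w0 * w] is [1 - e Re (k c)] to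
     first order, while Schwarz bounds it by [|1 - e c|], which is at most [1 - e] plus a quadratic
     term because [Re c = 1]. *)
  assert (Gap : (Re (k * c) < 1)%R).
  { rewrite Ekc. generalize (HK z0 Hz0). rewrite Re_plus. change (Re 1) with 1%R.
    unfold Copp, Re; simpl. lra. }
  set (gap := (1 - Re (k * c))%R).
  assert (Pgap : (0 < gap)%R) by (unfold gap; lra).
  assert (Pc := Cmod_ge_0 c).
  assert (Pcc : (0 <= Cmod c * Cmod c)%R) by now apply Rmult_le_pos.
  assert (Peta : (0 < gap / (4 * (Cmod c + 1)))%R) by (apply Rdiv_lt_0_compat; lra).
  destruct (proj1 (cderivP w z0 D) Dw _ Peta) as [d [Pd Hd]].
  set (e := Rmin (d / (2 * (Cmod c + 1))) (Rmin (gap / (2 * (Cmod c * Cmod c + 1))) (/ (Cmod c * Cmod c + 1)))).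
  assert (Pe : (0 < e)%R).
  { repeat apply Rmin_pos; try (apply Rdiv_lt_0_compat; lra). apply Rinv_0_lt_compat; lra. }
  assert (e <= d / (2 * (Cmod c + 1)) /\ e <= gap / (2 * (Cmod c * Cmod c + 1)) /\ e <= / (Cmod c * Cmod c + 1))%R as [E1 [E2 E3]].
  { unfold e. set (p := (d / _)%R). set (q := (gap / _)%R). set (s := (/ _)%R).
    generalize (Rmin_l p (Rmin q s)) (Rmin_r p (Rmin q s)) (Rmin_l q s) (Rmin_r q s). lra. }
  assert (F1 : (e * Cmod c < d)%R).
  { apply Rmult_le_compat_r with (r := (Cmod c + 1)%R) in E1; [ | lra].
    replace (d / (2 * (Cmod c + 1)) * (Cmod c + 1))%R with (d / 2)%R in E1 by (field; lra). lra. }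
  assert (F2 : (e * (Cmod c * Cmod c) <= gap / 2)%R).
  { apply Rmult_le_compat_r with (r := (Cmod c * Cmod c + 1)%R) in E2; [ | lra].
    replace (gap / (2 * (Cmod c * Cmod c + 1)) * (Cmod c * Cmod c + 1))%R with (gap / 2)%R in E2 by (field; lra). lra. }
  assert (F3 : (e * (Cmod c * Cmod c) < 1)%R).
  { apply Rmult_le_compat_r with (r := (Cmod c * Cmod c + 1)%R) in E3; [ | lra].
    rewrite Rinv_l in E3 by lra. lra. }
  set (y := z0 * (1 - RtoC e * c)).
  assert (Ey : y - z0 = - (RtoC e * c * z0)) by (unfold y; ring).
  assert (My : Cmod (y - z0) = (e * Cmod c * rho)%R).
  { rewrite Ey, Cmod_opp, !Cmod_mult, Cmod_R, Rabs_pos_eq, Z0; lra. }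
  assert (Ly : (Cmod (y - z0) < d)%R) by (rewrite My; assert (0 <= e * Cmod c)%R by (apply Rmult_le_pos; lra); nra).
  specialize (Hd y Ly).
  assert (M1 := Cmod_one_minus_le e c ltac:(lra)). rewrite Rc, Rmult_1_r in M1.
  assert (Cy : Cmod y = (rho * Cmod (1 - RtoC e * c))%R) by (unfold y; rewrite Cmod_mult, Z0; auto).
  assert (M2 : (e * e * (Cmod c * Cmod c) <= e * (gap / 2))%R).
  { rewrite Rmult_assoc. apply Rmult_le_compat_l; lra. }
  assert (M3 : (e * e * (Cmod c * Cmod c) < e * 1)%R).
  { rewrite Rmult_assoc. apply Rmult_lt_compat_l; lra. }
  specialize (Sch y ltac:(rewrite Cy; nra)).
  rewrite Cy in Sch. apply Rmult_le_reg_l in Sch; auto.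
  assert (B : (Re (Cconj w0 * w y) <= Cmod (w y))%R).
  { eapply Rle_trans; [apply Rle_abs | ]. eapply Rle_trans; [apply re_le_Cmod | ].
    rewrite Cmod_mult, Cmod_conj, Mw. lra. }
  set (err := w y - w0 - D * (y - z0)).
  fold w0 in Hd. fold err in Hd.
  assert (Ew : Cconj w0 * w y = 1 - RtoC e * (k * c) + Cconj w0 * err).
  { unfold err. rewrite Ey. replace (1 : C) with (Cconj w0 * w0). unfold k. ring. }
  rewrite Ew, Re_plus in B.
  replace (Re (1 - RtoC e * (k * c))) with (1 - e * Re (k * c))%R in B
    by (unfold Cminus; rewrite Re_plus; generalize (Re_Rmult e (k * c)); unfold Copp, Re; simpl; lra).
  assert (Be : (- Cmod err <= Re (Cconj w0 * err))%R).
  { generalize (re_le_Cmod (Cconj w0 * err)). rewrite Cmod_mult, Cmod_conj, Mw, Rmult_1_l.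
    intros X; apply Rabs_le_between in X; lra. }
  assert (Be2 : (Cmod err <= e * (gap / 4))%R).
  { eapply Rle_trans; [exact Hd | ]. rewrite My.
    apply Rle_trans with (gap / (4 * (Cmod c + 1)) * (e * (Cmod c + 1)))%R.
    - apply Rmult_le_compat_l; [lra | ]. rewrite Rmult_assoc. apply Rmult_le_compat_l; [lra | ]. nra.
    - right; field; lra. }
  unfold gap in *. nra.
Qed.

(** The disc of the preceding lemma lies in the right half-plane, so [cos (Im h / 2) > 0]. On the
    segment from 0 to [z], [Im h / 2] starts at 0 and cannot reach [PI / 2] or its opposite. *)
Lemma Im_log_lt_PI (h h1 : C -> C) :
  hol 1 h h1 -> h 0 = 0 -> (forall z, (Cmod z < 1)%R -> (0 < Re (1 + z * h1 z))%R) ->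
  forall z, (Cmod z < 1)%R -> (Rabs (Im (h z)) < PI)%R.
Proof.
intros Hh H0 HK z Hz.
assert (In : forall t : R, (0 <= t <= 1)%R -> (Cmod (RtoC t * z) < 1)%R).
{ intros t Ht. rewrite Cmod_mult, Cmod_R, Rabs_pos_eq by lra. generalize (Cmod_ge_0 z); nra. }
assert (P : forall t : R, (0 <= t <= 1)%R -> (0 < cos (Im (h (RtoC t * z)%C) / 2))%R).
{ intros t Ht. assert (M := marx_strohhacker h h1 Hh H0 HK _ (In t Ht)).
  set (y := h (RtoC t * z)) in *.
  assert (Re (1 - Cexp (RtoC (- / 2) * y)) < 1)%R.
  { eapply Rle_lt_trans; [apply Rle_abs | ]. eapply Rle_lt_trans; [apply re_le_Cmod | exact M]. }
  assert (0 < Re (Cexp (RtoC (- / 2) * y)))%R.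
  { revert H. unfold Cminus, Cplus, Copp, RtoC, Re; simpl. lra. }
  unfold Cexp in H1. rewrite Im_Rmult in H1.
  change (0 < exp (Re (RtoC (- / 2) * y)) * cos (- / 2 * Im y))%R in H1.
  replace (- / 2 * Im y)%R with (- (Im y / 2))%R in H1 by field. rewrite cos_neg in H1.
  generalize (exp_pos (Re (RtoC (- / 2) * y))); intros. nra. }
assert (C : forall (a b t : R), (0 <= t <= 1)%R -> continuity_pt (fun t => a * Im (h (RtoC t * z)%C) - b)%R t).
{ intros a b t Ht. apply continuity_pt_filterlim.
  apply (continuous_minus (V := R_NormedModule) (fun t => a * Im (h (RtoC t * z)%C))%R (fun _ => b)); [ | apply continuous_const].
  apply (continuous_mult (K := R_AbsRing) (fun _ => a) (fun t => Im (h (RtoC t * z)%C))); [apply continuous_const | ].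
  apply (continuous_Im (fun t => h (RtoC t * z))).
  apply (continuous_comp (fun t : R => RtoC t * z) h).
  - apply continuous_Cmult; [apply continuous_RtoC, continuous_id | apply continuous_const].
  - eapply hol_continuous; eauto. }
assert (E0 : Im (h (RtoC 0 * z)) = 0%R) by (replace (RtoC 0 * z) with (RtoC 0) by ring; rewrite H0; reflexivity).
assert (E1 : h (RtoC 1 * z) = h z) by (f_equal; ring).
generalize PI_RGT_0; intros HPI.
assert (K : forall a, (a = 1 \/ a = -1)%R -> (a * Im (h z) < PI)%R).
{ intros a Ha. apply Rnot_le_lt; intros L.
  assert (X : exists t, (0 <= t <= 1)%R /\ (a * Im (h (RtoC t * z)%C) = PI)%R).
  { destruct (Req_dec (a * Im (h z)) PI) as [E | NE].
    - exists 1%R; split; [lra | ]. now rewrite E1.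
    - destruct (IVT_interv (fun t => a * Im (h (RtoC t * z)%C) - PI)%R 0 1) as [t [Ht Et]].
      + intros; now apply C.
      + lra.
      + rewrite E0; lra.
      + rewrite E1; lra.
      + exists t; split; auto. lra. }
  destruct X as [t [Ht Et]]. specialize (P t Ht).
  destruct Ha as [-> | ->].
  - replace (Im (h (RtoC t * z)%C) / 2)%R with (PI / 2)%R in P by lra. rewrite cos_PI2 in P. lra.
  - replace (Im (h (RtoC t * z)%C) / 2)%R with (- (PI / 2))%R in P by lra. rewrite cos_neg, cos_PI2 in P. lra. }
apply Rabs_def1.
- specialize (K 1%R ltac:(auto)). lra.
- specialize (K (-1)%R ltac:(auto)). lra.
Qed.

(* [g] is close-to-convex with respect to the primitive of [exp h]; for large [n] the disc of centre and
   radius [n / 2] contains any given compact part of the right half-plane. *)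
Lemma univalent_real_exponent (h h1 g : C -> C) (kap : R) :
  hol 1 h h1 -> h 0 = 0 -> (forall z, (Cmod z < 1)%R -> (0 < Re (1 + z * h1 z))%R) ->
  hol 1 g (fun z => Cexp (RtoC kap * h z)) -> (1 / 2 <= kap <= 3 / 2)%R ->
  forall r u u', (0 < r < 1)%R -> (Cmod u <= r)%R -> (Cmod u' <= r)%R -> g u = g u' -> u = u'.
Proof.
intros Hh H0 HK Hg Hkap r u u' Hr.
set (X1 := fun z => Cexp (RtoC (kap - 1) * h z)). set (X2 := fun z => 1 + z * h1 z).
(* Here both ends of the segment enter: [Rabs (kap - 1) <= 1 / 2] brings the argument below
   [PI / 2]. *)
assert (Re1 : forall z, (Cmod z < 1)%R -> (0 < Re (X1 z))%R).
{ intros z Hz. unfold X1, Cexp. rewrite Im_Rmult.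
  change (0 < exp (Re (RtoC (kap - 1) * h z)) * cos ((kap - 1) * Im (h z)))%R.
  apply Rmult_lt_0_compat; [apply exp_pos | ].
  assert (B := Im_log_lt_PI h h1 Hh H0 HK z Hz).
  assert (A : (Rabs (kap - 1) <= 1 / 2)%R) by (apply Rabs_le_between; lra).
  assert (AB : (Rabs ((kap - 1) * Im (h z)) < PI / 2)%R).
  { rewrite Rabs_mult.
    apply Rle_lt_trans with (1 / 2 * Rabs (Im (h z)))%R; [ | lra].
    apply Rmult_le_compat_r; [apply Rabs_pos | exact A]. }
  apply Rabs_lt_between in AB. apply cos_gt_0; lra. }
assert (Cont : forall z, (Cmod z < 1)%R -> continuous X1 z /\ continuous X2 z).
{ intros z Hz; split; unfold X1, X2.
  - apply continuous_Cexp, continuous_Cmult; [apply continuous_const | eapply hol_continuous; eauto].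
  - apply continuous_Cplus; [apply continuous_const | ].
    apply continuous_Cmult; [apply continuous_id | now apply Hh]. }
(* A single [d] bounds the real part below by [d] and the modulus above by [1 / d], so only one
   constant passes through compactness. *)
assert (Cpt : forall X : C -> C, (forall z, (Cmod z < 1)%R -> (0 < Re (X z))%R /\ continuous X z) ->
  exists d, (0 < d)%R /\ forall z, (Cmod z <= r)%R -> (d <= Re (X z))%R /\ (Cmod (X z) * d <= 1)%R).
{ intros X HX. apply (compact_disc r (fun d z => (d <= Re (X z))%R /\ (Cmod (X z) * d <= 1)%R)).
  - intros d d' y Hd [A1 A2]; split; [lra | ].
    eapply Rle_trans; [ | exact A2]. apply Rmult_le_compat_l; [apply Cmod_ge_0 | lra].
  - intros x Hx. destruct (HX x ltac:(lra)) as [P1 P2].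
    set (a := Re (X x)) in *. set (m := (Cmod (X x) + a)%R).
    assert (Pm : (0 < m)%R) by (unfold m; generalize (Cmod_ge_0 (X x)); lra).
    destruct (proj1 (continuousP X x) P2 (a / 2)%R ltac:(lra)) as [d [Pd Hd]].
    exists (Rmin d (Rmin (a / 2) (/ m))); split.
    + repeat apply Rmin_pos; auto; [lra | now apply Rinv_0_lt_compat].
    + intros y Hy.
      generalize (Rmin_l d (Rmin (a / 2) (/ m))) (Rmin_r d (Rmin (a / 2) (/ m)))
        (Rmin_l (a / 2) (/ m)) (Rmin_r (a / 2) (/ m)); intros L1 L2 L3 L4.
      specialize (Hd y ltac:(lra)). split.
      * generalize (re_le_Cmod (X y - X x)); intros B. apply Rabs_le_between in B.
        change (Re (X y - X x)) with (Re (X y) - a)%R in B. lra.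
      * apply Rle_trans with (m * / m)%R; [ | right; field; lra].
        assert (0 < Rmin d (Rmin (a / 2) (/ m)))%R.
        { repeat apply Rmin_pos; auto; [lra | now apply Rinv_0_lt_compat]. }
        apply Rmult_le_compat; [apply Cmod_ge_0 | lra | | lra].
        generalize (Cmod_le_add (X y) (X x)); unfold m; lra. }
destruct (Cpt X1) as [d1 [P1 D1]]; [intros z Hz; split; [auto | now apply Cont] | ].
destruct (Cpt X2) as [d2 [P2 D2]]; [intros z Hz; split; [now apply HK | now apply Cont] | ].
(* The disc condition reads [|x|^2 < n Re x]. As [|x|^2 <= 1 / d^2] and [Re x >= d], it suffices
   that [n > 1 / d^3]. *)
assert (Big : forall d, (0 < d)%R -> exists N : nat, forall n, (N <= n)%nat -> forall x : C,
   (d <= Re x)%R -> (Cmod x * d <= 1)%R -> (Cmod (x - RtoC (INR n / 2)) < INR n / 2)%R).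
{ intros d Pd.
  assert (Pd3 : (0 < d * d * d)%R) by (repeat apply Rmult_lt_0_compat; auto).
  destruct (archimed_cor1 (d * d * d) Pd3) as [N [HN PN]].
  exists N. intros n Hn x B1 B2.
  assert (0 < INR N)%R by now apply lt_0_INR.
  assert (INR N <= INR n)%R by now apply le_INR.
  assert (HN' : (1 < INR n * (d * d * d))%R).
  { apply Rmult_lt_compat_l with (r := INR N) in HN; auto. rewrite Rinv_r in HN by lra.
    apply Rlt_le_trans with (1 := HN). apply Rmult_le_compat_r; lra. }
  assert (Mx := Cmod_ge_0 x).
  assert (Sq : (Cmod x * Cmod x * (d * d) <= 1)%R).
  { replace (Cmod x * Cmod x * (d * d))%R with ((Cmod x * d) * (Cmod x * d))%R by ring.
    assert (0 <= Cmod x * d)%R by (apply Rmult_le_pos; lra). nra. }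
  assert (L : (Cmod x * Cmod x < INR n * d)%R).
  { apply Rmult_lt_reg_r with (d * d)%R; [nra | ]. nra. }
  assert (Pn2 : Cmod (RtoC (INR n / 2)) = (INR n / 2)%R) by (rewrite Cmod_R; apply Rabs_pos_eq; lra).
  rewrite <- Pn2 at 2. apply Cmod_lt_of_sqr. rewrite Pn2.
  rewrite Cmod_sqr. rewrite Cmod_sqr in L.
  assert (INR n * d <= INR n * Re x)%R by (apply Rmult_le_compat_l; lra).
  destruct x; unfold Cminus, Cplus, Copp, RtoC, Re, Im in *; simpl in *. nra. }
destruct (Big d1 P1) as [N1 B1]. destruct (Big d2 P2) as [N2 B2].
set (n := S (N1 + N2)).
apply (chain_univalent n g (fun z => Cexp (RtoC kap * h z)) (fun z => Cexp (1 * h z))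
  (fun z => Cexp (1 * h z) * (1 * h1 z))); auto.
- unfold n; lia.
- now apply hol_exp_scal.
- apply Cexp_neq_0.
- intros s z Hs Hz.
  assert (Hz1 : (Cmod z <= r)%R) by nra.
  unfold chain. set (E := Cexp (1 * h z)).
  assert (PE : (0 < Cmod E)%R) by apply Cmod_gt_0, Cexp_neq_0.
  assert (Ek : Cexp (RtoC kap * h z) = E * X1 z).
  { unfold E, X1. rewrite <- Cexp_add. f_equal. rewrite RtoC_minus. ring. }
  set (q := (s ^ n)%R).
  assert (Hq : (0 < q <= 1)%R).
  { unfold q; split; [now apply pow_lt | ]. rewrite <- (pow1 n). apply pow_incr; lra. }
  replace (RtoC q * Cexp (RtoC kap * h z) + RtoC (1 - q) * (E + z * (E * (1 * h1 z))) - RtoC (INR n / 2) * E)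
    with (E * (RtoC q * (X1 z - RtoC (INR n / 2)) + RtoC (1 - q) * (X2 z - RtoC (INR n / 2))))
    by (rewrite Ek; unfold X2; rewrite RtoC_minus; ring).
  rewrite Cmod_mult, (Rmult_comm (INR n / 2)). apply Rmult_lt_compat_l; auto.
  eapply Rle_lt_trans; [apply Cmod_triangle | ].
  rewrite !Cmod_mult, !Cmod_R, !Rabs_pos_eq by lra.
  assert (A1 := B1 n ltac:(unfold n; lia) (X1 z) (proj1 (D1 z Hz1)) (proj2 (D1 z Hz1))).
  assert (A2 := B2 n ltac:(unfold n; lia) (X2 z) (proj1 (D2 z Hz1)) (proj2 (D2 z Hz1))).
  assert (q * Cmod (X1 z - RtoC (INR n / 2)) < q * (INR n / 2))%R by (apply Rmult_lt_compat_l; lra).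
  assert ((1 - q) * Cmod (X2 z - RtoC (INR n / 2)) <= (1 - q) * (INR n / 2))%R by (apply Rmult_le_compat_l; lra).
  lra.
Qed.

(** * The Hornich multiple *)

Lemma Cmod_Rmult_lt_1 (t : R) (z : C) : (0 <= t <= 1)%R -> (Cmod z < 1)%R -> (Cmod (RtoC t * z) < 1)%R.
Proof.
intros Ht Hz. rewrite Cmod_mult, Cmod_R, Rabs_pos_eq by lra. generalize (Cmod_ge_0 z); nra.
Qed.

Lemma is_derive_RtoC (t : R) : @is_derive R_AbsRing C_R_NormedModule RtoC t (RtoC 1).
Proof.
apply is_derive_CP; intros eps He; exists 1%R; split; [lra | ]; intros s _.
replace (RtoC s - RtoC t - RtoC (s - t) * 1) with (RtoC 0) by (rewrite RtoC_minus; ring).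
rewrite Cmod_0. apply Rmult_le_pos; [lra | apply Rabs_pos].
Qed.

(** Under the integral sign the derivative of [K (t z) z] in [z] equals that of [t K (t z)] in [t],
    so it integrates over [[0, 1]] to [K z]. *)
Lemma hol_primitive (K K1 : C -> C) : hol 1 K K1 ->
  hol 1 (fun z => CInt (fun t => K (RtoC t * z) * z) 0 1) K.
Proof.
intros HK z Hz; split; [ | eapply hol_continuous; eauto].
assert (Cpath : forall (y : C) (t : R), (0 <= t <= 1)%R -> (Cmod y < 1)%R -> forall F : C -> C,
  (forall x, (Cmod x < 1)%R -> continuous F x) ->
  @continuous R_UniformSpace C_UniformSpace (fun t => F (RtoC t * y)) t).
{ intros y t Ht Hy F HF. apply (continuous_comp (fun t : R => RtoC t * y) F).
  - apply continuous_Cmult; [apply continuous_RtoC, continuous_id | apply continuous_const].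
  - now apply HF, Cmod_Rmult_lt_1. }
assert (CK : forall x, (Cmod x < 1)%R -> continuous K x) by (intros; eapply hol_continuous; eauto).
assert (CK1 : forall x, (Cmod x < 1)%R -> continuous K1 x) by (intros; now apply HK).
apply cderiv_eq with (CInt (fun t => K1 (RtoC t * z) * (RtoC t * 1) * z + K (RtoC t * z) * 1) 0 1).
- apply CInt_unique.
  replace (K z) with (RtoC 1 * K (RtoC 1 * z) - RtoC 0 * K (RtoC 0 * z))
    by (replace (RtoC 1 * z) with z by ring; ring).
  apply (is_CInt_derive (fun t => RtoC t * K (RtoC t * z))); [lra | | ].
  + intros t Ht.
    replace (K1 (RtoC t * z) * (RtoC t * 1) * z + K (RtoC t * z) * 1) with
      ((1 * K (RtoC t * z) + RtoC t * (K1 (RtoC t * z) * (1 * z + RtoC t * 0))) * 1) by ring.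
    apply (is_derive_C_comp (fun x => x * K (x * z)) RtoC); [ | apply is_derive_RtoC].
    apply (cderiv_mult (fun x => x) (fun x => K (x * z))); [apply cderiv_id | ].
    apply (cderiv_comp K (fun x => x * z)); [now apply HK, Cmod_Rmult_lt_1 | ].
    apply (cderiv_mult (fun x => x) (fun _ => z)); [apply cderiv_id | apply cderiv_const].
  + intros t Ht. apply continuous_Cplus; apply continuous_Cmult;
     try apply continuous_const; try apply continuous_Cmult; try (apply Cpath; auto; fail).
    apply continuous_Cmult; [apply continuous_RtoC, continuous_id | apply continuous_const].
- apply (cderiv_CInt_param (fun z t => K (RtoC t * z) * z)
    (fun z t => K1 (RtoC t * z) * (RtoC t * 1) * z + K (RtoC t * z) * 1) z 0 1 (1 - Cmod z)); try lra.
  + intros y t Hy Ht. apply Cmod_lt_neighborhood in Hy.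
    apply (cderiv_mult (fun y => K (RtoC t * y)) (fun y => y)); [ | apply cderiv_id].
    apply (cderiv_comp K (fun y => RtoC t * y)); [now apply HK, Cmod_Rmult_lt_1 | ].
    apply cderiv_scal, cderiv_id.
  + intros y t Hy Ht. apply Cmod_lt_neighborhood in Hy.
    apply continuous_Cmult; [now apply Cpath | apply continuous_const].
  + intros t Ht.
    assert (J : forall F : C -> C, (forall x, (Cmod x < 1)%R -> continuous F x) ->
      @continuous (prod_UniformSpace C_UniformSpace R_UniformSpace) C_UniformSpace (fun p => F (RtoC (snd p) * fst p)) (z, t)).
    { intros F HF. apply (continuous_comp (fun p : C * R => RtoC (snd p) * fst p) F).
      - apply continuous_Cmult; [apply continuous_RtoC, continuous_snd | apply continuous_fst].
      - now apply HF, Cmod_Rmult_lt_1. }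
    apply continuous_Cplus; apply continuous_Cmult; auto; try apply continuous_const; [ | apply continuous_fst].
    apply continuous_Cmult; auto.
    apply continuous_Cmult; [apply continuous_RtoC, continuous_snd | apply continuous_const].
Qed.

Lemma hol_Hornich (gam : C) (g g1 : C -> C) : hol 1 g g1 ->
  hol 1 (Hornich gam g) (fun z => Cexp (gam * g z)).
Proof.
intros Hg. apply (hol_primitive (fun z => Cexp (gam * g z)) (fun z => Cexp (gam * g z) * (gam * g1 z))).
now apply hol_exp_scal.
Qed.

Lemma classA_Hornich (gam : C) (g g1 : C -> C) : hol 1 g g1 -> g 0 = 0 -> classA (Hornich gam g).
Proof.
intros Hg G0. assert (HH := hol_Hornich gam g g1 Hg).
split; [ | split].
- intros z Hz. eexists; apply HH, Hz.
- unfold Hornich. transitivity (RtoC (1 - 0) * 0); [apply CInt_unique | ring].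
  apply is_CInt_ext with (fun _ => RtoC 0); [lra | intros; ring | apply is_CInt_const].
- apply cderiv_eq with (Cexp (gam * g 0)).
  + rewrite G0, Cmult_0_r. apply Cexp_0.
  + apply HH. rewrite Cmod_0; lra.
Qed.

(** The derivative of [g] is [f'' / f']. Its continuity, part of [hol], comes from [hol_derivative]
    applied to [f]. *)
Lemma classK_log (lam : R) (f f1 g : C -> C) : classK lam f ->
  (forall z, inD z -> cderiv f z (f1 z)) -> log_branch f1 g ->
  exists g1, hol 1 g g1 /\ forall z, inD z -> (lam < Re (1 + z * g1 z))%R.
Proof.
intros [HA [F1 [F2 [HF1 [HF2 [NZ HRe]]]]]] Hf1 [Gc [Ge G0]].
assert (Hf : hol 1 f F1).
{ intros z Hz; split; [now apply HF1 | eapply cderiv_continuous, HF2, Hz]. }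
destruct (hol_derivative 1 f F1 Hf) as [f2 Hf2].
assert (E2 : forall z, inD z -> f2 z = F2 z).
{ intros z Hz. apply (cderiv_unique F1 z); [now apply Hf2 | now apply HF2]. }
exists (fun z => f2 z / F1 z). split.
- intros z Hz; split.
  + apply (cderiv_log_branch F1 g z (f2 z) (1 - Cmod z)); [lra | | now apply Gc | now apply Hf2].
    intros y Hy. apply Cmod_lt_neighborhood in Hy.
    rewrite Ge by exact Hy. apply (cderiv_unique f y); auto.
  + apply continuous_Cmult; [now apply Hf2 | ].
    apply continuous_Cinv; [now apply NZ | ]. eapply cderiv_continuous, HF2, Hz.
- intros z Hz. rewrite E2 by auto. unfold Cdiv. rewrite Cmult_assoc. now apply HRe.
Qed.

Lemma Hornich_univalent (lam : R) (gam : C) (f f1 g : C -> C) : (lam < 1)%R ->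
  ((Cmod gam <= 1 / (2 * (1 - lam)))%R \/
   (Im gam = 0 /\ 1 / (2 * (1 - lam)) <= Re gam <= 3 / (2 * (1 - lam)))%R) ->
  classK lam f -> (forall z, inD z -> cderiv f z (f1 z)) -> log_branch f1 g ->
  classS (Hornich gam g).
Proof.
intros Hlam Hgam HK Hf1 Hg.
destruct (classK_log lam f f1 g HK Hf1 Hg) as [g1 [Hg1 HRe]].
assert (G0 : g 0 = 0) by apply Hg.
split; [now apply (classA_Hornich gam g g1) | ].
set (L := (1 - lam)%R) in *. assert (PL : (0 < L)%R) by (unfold L; lra).
assert (NL : RtoC L <> 0) by (intros E; injection E; lra).
set (h := fun z => RtoC (/ L) * g z). set (h1 := fun z => RtoC (/ L) * g1 z).
assert (Hh : hol 1 h h1) by now apply hol_scal.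
assert (H0 : h 0 = 0) by (unfold h; rewrite G0; ring).
assert (HKh : forall z, (Cmod z < 1)%R -> (0 < Re (1 + z * h1 z))%R).
{ intros z Hz. generalize (HRe z Hz). rewrite !Re_plus. unfold h1.
  replace (z * (RtoC (/ L) * g1 z)) with (RtoC (/ L) * (z * g1 z)) by ring.
  rewrite Re_Rmult. change (Re 1) with 1%R. intros X.
  assert (- L * / L < Re (z * g1 z) * / L)%R.
  { apply Rmult_lt_compat_r; [now apply Rinv_0_lt_compat | unfold L; lra]. }
  replace (- L * / L)%R with (-1)%R in H by (field; lra). lra. }
set (kap := gam * RtoC L).
assert (Ek : forall z, kap * h z = gam * g z).
{ intros z. unfold kap, h. rewrite RtoC_inv by lra. field; auto. }
assert (HG : hol 1 (Hornich gam g) (fun z => Cexp (kap * h z))).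
{ intros z Hz; split.
  - rewrite Ek. now apply (hol_Hornich gam g g1).
  - eapply hol_continuous; [ | exact Hz]. apply hol_exp_scal, Hh. }
intros z w Hz Hw E.
(* A closed disc holding both points; the entry 1/2 keeps [r] positive when both are 0. *)
set (r := Rmax (1 / 2) (Rmax (Cmod z) (Cmod w))).
generalize (Rmax_l (1 / 2) (Rmax (Cmod z) (Cmod w))) (Rmax_r (1 / 2) (Rmax (Cmod z) (Cmod w)))
  (Rmax_l (Cmod z) (Cmod w)) (Rmax_r (Cmod z) (Cmod w)); fold r; intros L1 L2 L3 L4.
assert (Hr : (0 < r < 1)%R).
{ split; [lra | ]. unfold r. apply Rmax_lub_lt; [lra | ]. apply Rmax_lub_lt; [exact Hz | exact Hw]. }
destruct Hgam as [Hgam | [I [Rl Ru]]].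
- apply (univalent_small_exponent h h1 (Hornich gam g) kap) with (r := r); auto; try lra.
  unfold kap. rewrite Cmod_mult, Cmod_R, Rabs_pos_eq by lra.
  apply Rmult_le_compat_r with (r := L) in Hgam; [ | lra].
  replace (1 / (2 * L) * L)%R with (1 / 2)%R in Hgam by (field; lra). exact Hgam.
- set (x := (Re gam * L)%R).
  assert (Ex : kap = RtoC x).
  { unfold kap, x. destruct gam as [a b]; unfold Im in I; simpl in I; subst b.
    unfold Cmult, RtoC, Re; simpl; f_equal; ring. }
  apply (univalent_real_exponent h h1 (Hornich gam g) x) with (r := r); auto; try lra.
  + rewrite <- Ex. exact HG.
  + unfold x. apply Rmult_le_compat_r with (r := L) in Rl; [ | lra].
    apply Rmult_le_compat_r with (r := L) in Ru; [ | lra].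
    replace (1 / (2 * L) * L)%R with (1 / 2)%R in Rl by (field; lra).
    replace (3 / (2 * L) * L)%R with (3 / 2)%R in Ru by (field; lra). lra.
Qed.

(** * Necessity *)

(** The principal logarithm on the right half-plane, which contains every [1 - z] with [z] in the
    unit disc. *)
Definition Clog (z : C) : C := (ln (Cmod z), atan (Im z / Re z)).

Lemma Clog_Cexp (z : C) : (- (PI / 2) < Im z < PI / 2)%R -> Clog (Cexp z) = z.
Proof.
intros H. unfold Clog. rewrite Cmod_Cexp, ln_exp.
replace (Im (Cexp z) / Re (Cexp z))%R with (tan (Im z)).
- rewrite atan_tan by lra. now destruct z.
- assert (0 < cos (Im z))%R by (apply cos_gt_0; lra).
  unfold Cexp, tan. change (sin (Im z) / cos (Im z) = (exp (Re z) * sin (Im z)) / (exp (Re z) * cos (Im z)))%R.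
  field. generalize (exp_pos (Re z)); lra.
Qed.

Lemma Cexp_Clog (z : C) : (0 < Re z)%R -> Cexp (Clog z) = z.
Proof.
intros H. destruct z as [x y]; unfold Re in H; simpl in H.
assert (P : (0 < Cmod (x, y))%R).
{ generalize (re_le_Cmod (x, y)) (Rle_abs x); unfold Re; simpl; lra. }
unfold Cexp, Clog. change (Re (ln (Cmod (x, y)), atan (Im (x, y) / Re (x, y)))) with (ln (Cmod (x, y))).
change (Im (ln (Cmod (x, y)), atan (Im (x, y) / Re (x, y)))) with (atan (y / x)).
rewrite exp_ln by auto. rewrite cos_atan, sin_atan.
assert (Q : (0 < 1 + Rsqr (y / x))%R) by (generalize (Rle_0_sqr (y / x)); lra).
assert (E : Cmod (x, y) = (x * sqrt (1 + Rsqr (y / x)))%R).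
{ unfold Cmod; simpl. rewrite <- (sqrt_Rsqr x) at 3 by lra.
  rewrite <- sqrt_mult by (try apply Rle_0_sqr; lra). f_equal. unfold Rsqr. field. lra. }
assert (Ps : (0 < sqrt (1 + Rsqr (y / x)))%R) by now apply sqrt_lt_R0.
rewrite E. f_equal; field; lra.
Qed.

Lemma continuous_Cmod (z : C) : @continuous C_UniformSpace R_UniformSpace Cmod z.
Proof.
intros P [d Hd]. apply (proj2 (locally_CmodP z _)). exists d; intros y Hy. apply Hd.
unfold ball; simpl; unfold AbsRing_ball, abs, minus, plus, opp; simpl.
generalize (Cmod_le_add y z) (Cmod_le_add z y). rewrite (Cmod_sub_sym z y).
intros. apply Rabs_def1; lra.
Qed.

Lemma continuous_Clog (z : C) : (0 < Re z)%R -> continuous Clog z.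
Proof.
intros H. apply continuous_Cpair.
- apply (continuous_comp (U := C_UniformSpace) (V := R_UniformSpace) Cmod ln).
  + apply continuous_Cmod.
  + apply continuity_pt_filterlim. apply derivable_continuous_pt.
    exists (/ Cmod z)%R. apply derivable_pt_lim_ln.
    generalize (re_le_Cmod z) (Rle_abs (Re z)); lra.
- apply (continuous_comp (fun z : C => Im z / Re z)%R atan).
  + apply (continuous_mult (K := R_AbsRing) (fun z : C => Im z) (fun z : C => / Re z)%R).
    * apply continuous_snd.
    * apply (continuous_comp (fun z : C => Re z) Rinv); [apply continuous_fst | ].
      apply continuous_Rinv. lra.
  + apply continuity_pt_filterlim. apply derivable_continuous_pt, derivable_pt_atan.
Qed.

Lemma Re_one_minus_pos (z : C) : (Cmod z < 1)%R -> (0 < Re (1 - z))%R.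
Proof.
intros H. generalize (re_le_Cmod z) (Rle_abs (Re z)).
change (Re (1 - z)) with (1 - Re z)%R. lra.
Qed.

Lemma one_minus_neq_0 (z : C) : (Cmod z < 1)%R -> 1 - z <> 0.
Proof.
intros H E. generalize (Re_one_minus_pos z H). rewrite E. change (Re 0) with 0%R. lra.
Qed.

Lemma hol_log_one_minus : hol 1 (fun z => Clog (1 - z)) (fun z => - / (1 - z)).
Proof.
intros z Hz.
assert (N := one_minus_neq_0).
assert (D : forall y, cderiv (fun y => 1 - y) y (- (1))).
{ intros y. apply cderiv_eq with (0 - 1); [ring | ]. apply cderiv_minus; [apply cderiv_const | apply cderiv_id]. }
split.
- apply cderiv_eq with (- (1) / (1 - z)); [field; auto | ].
  apply (cderiv_log_branch (fun y => 1 - y) (fun y => Clog (1 - y)) z (- (1)) (1 - Cmod z)); [lra | | | apply D].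
  + intros y Hy. apply Cmod_lt_neighborhood in Hy. now apply Cexp_Clog, Re_one_minus_pos.
  + apply (continuous_comp (fun y => 1 - y) Clog); [eapply cderiv_continuous, D | ].
    now apply continuous_Clog, Re_one_minus_pos.
- apply continuous_Copp, continuous_Cinv; auto. eapply cderiv_continuous, D.
Qed.

Lemma Clog_1 : Clog 1 = 0.
Proof.
unfold Clog. rewrite Cmod_1, ln_1. change (Im 1) with 0%R. unfold Rdiv. rewrite Rmult_0_l, atan_0. reflexivity.
Qed.

Lemma Re_div_one_minus (z : C) : (Cmod z < 1)%R -> (- (1 / 2) < Re (z / (1 - z)))%R.
Proof.
intros H.
assert (P := Re_one_minus_pos z H).
assert (E := Cmod_sqr z). assert (Cmod z * Cmod z < 1)%R by (generalize (Cmod_ge_0 z); nra).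
destruct z as [x y]; unfold Cdiv, Cinv, Cminus, Cplus, Copp, Cmult, RtoC, Re, Im in *; simpl in *.
assert (Q : (0 < (1 + - x) * ((1 + - x) * 1) + (0 + - y) * ((0 + - y) * 1))%R) by nra.
set (D := ((1 + - x) * ((1 + - x) * 1) + (0 + - y) * ((0 + - y) * 1))%R) in *.
apply Rmult_lt_reg_r with D; auto.
replace ((x * ((1 + - x) / D) - y * (- (0 + - y) / D)) * D)%R with (x * (1 + - x) - y * y)%R by (field; lra).
unfold D. nra.
Qed.

Lemma classK_power (lam a : R) : (0 < a <= 2 * (1 - lam))%R ->
  let g := fun z => RtoC (- a) * Clog (1 - z) in
  classK lam (Hornich 1 g) /\ (forall z, inD z -> cderiv (Hornich 1 g) z (Cexp (1 * g z))) /\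
  log_branch (fun z => Cexp (1 * g z)) g.
Proof.
intros Ha g.
assert (Hg : hol 1 g (fun z => RtoC (- a) * - / (1 - z))) by apply hol_scal, hol_log_one_minus.
assert (G0 : g 0 = 0).
{ unfold g. replace (1 - 0) with (RtoC 1) by ring. rewrite Clog_1. ring. }
assert (HH := hol_Hornich 1 g _ Hg).
assert (N := one_minus_neq_0).
split; [ | split].
- split; [eapply classA_Hornich; eauto | ].
  exists (fun z => Cexp (1 * g z)), (fun z => Cexp (1 * g z) * (1 * (RtoC (- a) * - / (1 - z)))).
  split; [ | split; [ | split]]; intros z Hz.
  + now apply HH.
  + now apply (hol_exp_scal 1 g _ 1 Hg).
  + apply Cexp_neq_0.
  + replace (z * (Cexp (1 * g z) * (1 * (RtoC (- a) * - / (1 - z)))) / Cexp (1 * g z)) with (RtoC a * (z / (1 - z))).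
    * rewrite Re_plus, Re_Rmult. change (Re 1) with 1%R.
      generalize (Re_div_one_minus z Hz). nra.
    * rewrite RtoC_opp. field. split; [now apply N | apply Cexp_neq_0].
- intros z Hz. now apply HH.
- split; [ | split]; auto.
  + intros z Hz. eapply hol_continuous; eauto.
  + intros z Hz. now rewrite Cmult_1_l.
Qed.

(* [1 - z1] and [1 - z2] are [exp (+- d / 2 - T)] with [d = 2 pi i / beta]. *)
Lemma power_not_injective (beta : C) : (1 < Cmod (beta - 1))%R -> (1 < Cmod (beta + 1))%R ->
  exists z1 z2, inD z1 /\ inD z2 /\ z1 <> z2 /\
    Cexp (beta * Clog (1 - z1)) = Cexp (beta * Clog (1 - z2)).
Proof.
intros H1 H2.
assert (S1 : (1 < Cmod (beta - 1) * Cmod (beta - 1))%R) by nra.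
assert (S2 : (1 < Cmod (beta + 1) * Cmod (beta + 1))%R) by nra.
rewrite Cmod_sqr in S1, S2.
assert (Nb : beta <> 0).
{ intros ->. replace (0 - 1) with (- (1)) in H1 by ring. rewrite Cmod_m1 in H1. lra. }
set (d := RtoC (2 * PI) * Ci / beta).
generalize PI_RGT_0; intros HPI.
assert (Dd : beta * d = RtoC (2 * PI) * Ci) by (unfold d; field; auto).
assert (Nd : d <> 0).
{ intros E. rewrite E, Cmult_0_r in Dd. apply (f_equal Im) in Dd.
  unfold Ci, RtoC, Cmult, Im in Dd; simpl in Dd. lra. }
(* The two hypotheses on [beta] together say [2 |Re beta| < |beta|^2], and
   [Im d = 2 PI Re beta / |beta|^2]. The points [+- d / 2] then lie in the strip where [Clog]
   inverts [Cexp]. *)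
assert (Bd : (Rabs (Im d) < PI)%R).
{ assert (PB : (0 < Cmod beta * Cmod beta)%R) by (apply Rmult_lt_0_compat; now apply Cmod_gt_0).
  rewrite Cmod_sqr in PB.
  replace (Im d) with (2 * PI * Re beta / (Re beta * Re beta + Im beta * Im beta))%R.
  - destruct beta as [x y]. unfold Cminus, Cplus, Copp, RtoC, Re, Im in *; simpl in *.
    set (m := (x * x + y * y)%R) in *.
    assert (B1 : (2 * x < m)%R) by (unfold m; lra). assert (B2 : (- m < 2 * x)%R) by (unfold m; lra).
    apply Rabs_def1.
    + apply Rmult_lt_reg_r with m; auto. unfold Rdiv; rewrite Rmult_assoc, Rinv_l by lra. nra.
    + apply Rmult_lt_reg_r with m; auto. unfold Rdiv; rewrite Rmult_assoc, Rinv_l by lra. nra.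
  - unfold d. destruct beta as [x y]. unfold Cdiv, Cinv, Ci, RtoC, Cmult, Re, Im in *; simpl in *. field. lra. }
apply Rabs_lt_between in Bd.
set (m := (2 * cos (Im d / 2))%R).
assert (Pm : (0 < m)%R) by (unfold m; assert (0 < cos (Im d / 2))%R by (apply cos_gt_0; lra); lra).
(* [|1 - exp a| < 1] holds exactly when [exp (Re a) < 2 cos (Im a)], a bound equal to [m] for both
   points; this shift gives [Re a <= ln m - 1]. *)
set (T := (Rabs (Re d) / 2 - ln m + 1)%R).
assert (Q : forall sg : R, (sg = 1 \/ sg = -1)%R ->
  let a := RtoC (sg / 2) * d - RtoC T in inD (1 - Cexp a) /\ Clog (1 - (1 - Cexp a)) = a).
{ intros sg Hsg a.
  assert (Ia : Im a = (sg / 2 * Im d)%R).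
  { unfold a, Cminus, Cplus, Copp. rewrite <- (Im_Rmult (sg / 2) d). unfold Im, RtoC; simpl. ring. }
  assert (Ra : Re a = (sg / 2 * Re d - T)%R).
  { unfold a, Cminus, Cplus, Copp. rewrite <- (Re_Rmult (sg / 2) d). unfold Re, RtoC; simpl. ring. }
  assert (Ca : cos (Im a) = cos (Im d / 2)).
  { rewrite Ia. destruct Hsg as [-> | ->].
    - f_equal; field.
    - rewrite <- cos_neg. f_equal; field. }
  split.
  - assert (Lm : (exp (Re a) < m)%R).
    { rewrite <- (exp_ln m Pm). apply exp_increasing. rewrite Ra. unfold T.
      generalize (Rle_abs (Re d)) (Rle_abs (- Re d)). rewrite Rabs_Ropp.
      destruct Hsg as [-> | ->]; lra. }
    unfold inD. rewrite <- Cmod_1. apply Cmod_lt_of_sqr. rewrite Cmod_1, Cmod_sqr.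
    change (Re (1 - Cexp a)) with (1 - exp (Re a) * cos (Im a))%R.
    replace (Im (1 - Cexp a)) with (- (exp (Re a) * sin (Im a)))%R by (unfold Im, Cminus, Cplus, Copp, RtoC, Cexp; simpl; ring).
    assert (E2 := sin2_cos2 (Im a)). unfold Rsqr in E2. rewrite Ca in *.
    unfold m in Lm. generalize (exp_pos (Re a)); intros Pe.
    set (ee := exp (Re a)) in *. set (cc := cos (Im d / 2)) in *. set (ss := sin (Im a)) in *.
    replace ((1 - ee * cc) * (1 - ee * cc) + - (ee * ss) * - (ee * ss))%R with
      (1 - 2 * ee * cc + ee * ee * (ss * ss + cc * cc))%R by ring.
    rewrite E2. nra.
  - replace (1 - (1 - Cexp a)) with (Cexp a) by ring. apply Clog_Cexp. rewrite Ia.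
    destruct Hsg as [-> | ->]; lra. }
destruct (Q 1%R ltac:(auto)) as [D1 E1]. destruct (Q (-1)%R ltac:(auto)) as [D2 E2].
set (a1 := RtoC (1 / 2) * d - RtoC T) in *. set (a2 := RtoC (-1 / 2) * d - RtoC T) in *.
assert (Ead : a1 = a2 + d).
{ unfold a1, a2. replace (RtoC (1 / 2)) with (RtoC (-1 / 2) + 1); [ring | ].
  rewrite <- RtoC_plus. f_equal; field. }
exists (1 - Cexp a1), (1 - Cexp a2). split; [ | split; [ | split]]; auto.
- intros E. apply Nd. rewrite E, E2 in E1. replace d with (a2 + d - a2) by ring. rewrite <- Ead, E1. ring.
- rewrite E1, E2, Ead.
  replace (beta * (a2 + d)) with (beta * a2 + beta * d) by ring.
  rewrite Cexp_add, Dd.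
  replace (Cexp (RtoC (2 * PI) * Ci)) with (RtoC 1); [ring | ].
  unfold Cexp. rewrite Re_Rmult, Im_Rmult. change (Re Ci) with 0%R. change (Im Ci) with 1%R.
  rewrite Rmult_0_r, Rmult_1_r, exp_0, cos_2PI, sin_2PI. unfold RtoC. f_equal; ring.
Qed.

(* The discs [|v| <= 1] and [|v - 2| <= 1] only touch at [1], so a non-real ray from [0] meets their exterior
   as soon as it leaves the first one. *)
Lemma ray_leaves_discs (v : C) : (1 < Cmod v)%R -> ~ (Im v = 0 /\ 1 <= Re v <= 3)%R ->
  exists mu, (0 < mu <= 1)%R /\ (1 < Cmod (RtoC mu * v))%R /\ (1 < Cmod (RtoC mu * v - 2))%R.
Proof.
intros H1 HN.
destruct (Rlt_dec 1 (Cmod (v - 2))) as [H2 | H2].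
- exists 1%R. rewrite Cmult_1_l. repeat split; lra.
- set (m := Cmod v) in *. assert (E := Cmod_sqr v). fold m in E.
  assert (RV : (Re v < m)%R).
  { assert (Re v <= m)%R by (eapply Rle_trans; [apply Rle_abs | apply re_le_Cmod]).
    destruct (Req_dec (Re v) m) as [Em | NE]; [ | lra]. exfalso; apply HN.
    assert (I0 : Im v = 0%R) by (rewrite Em in E; nra).
    split; auto.
    assert (Cmod (v - 2) = Rabs (m - 2)).
    { assert (Ev : v = RtoC m) by (apply injective_projections; [exact Em | exact I0]).
      clearbody m. rewrite <- Cmod_R, Ev, RtoC_minus. reflexivity. }
    rewrite H0 in H2. apply Rnot_lt_le, Rabs_le_between in H2. lra. }
  set (c := (Re v / m)%R).
  assert (Pc : (c < 1)%R).
  { unfold c. apply Rmult_lt_reg_r with m; [lra | ]. unfold Rdiv; rewrite Rmult_assoc, Rinv_l; lra. }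
  assert (Ec : (Re v = c * m)%R) by (unfold c; field; lra).
  (* The new modulus is [1 + e]: [e <= m - 1] gives [mu <= 1], and [c <= 1 - e] gives
     [|mu v - 2|^2 >= (1 + e)^2 + 4 e^2 > 1]. *)
  set (e := Rmin (m - 1) (1 - c)).
  assert (Pe : (0 < e)%R) by (apply Rmin_pos; lra).
  assert (e <= m - 1 /\ e <= 1 - c)%R as [e1 e2] by (split; [apply Rmin_l | apply Rmin_r]).
  exists ((1 + e) / m)%R.
  assert (Pmu : (0 < (1 + e) / m)%R) by (apply Rdiv_lt_0_compat; lra).
  assert (Emu : ((1 + e) / m * m = 1 + e)%R) by (field; lra).
  set (mu := ((1 + e) / m)%R) in *.
  assert (M : Cmod (RtoC mu * v) = (1 + e)%R) by (rewrite Cmod_mult, Cmod_R, Rabs_pos_eq by lra; exact Emu).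
  split; [ | split].
  + split; auto. apply Rmult_le_reg_r with m; lra.
  + rewrite M; lra.
  + rewrite <- Cmod_1 at 1. apply Cmod_lt_of_sqr. rewrite Cmod_1, Cmod_sqr.
    assert (Sq := Cmod_sqr (RtoC mu * v)). rewrite M in Sq.
    change (Re (RtoC mu * v - 2)) with (Re (RtoC mu * v) - 2)%R.
    replace (Im (RtoC mu * v - 2)) with (Im (RtoC mu * v)) by (unfold Im, Cminus, Cplus, Copp, RtoC; simpl; ring).
    assert (Er : Re (RtoC mu * v) = ((1 + e) * c)%R) by (rewrite Re_Rmult, Ec, <- Emu; ring).
    assert (0 <= e * (1 - c))%R by (apply Rmult_le_pos; lra).
    nra.
Qed.

Lemma Hornich_not_univalent (lam : R) (gam : C) : (lam < 1)%R ->
  ~ ((Cmod gam <= 1 / (2 * (1 - lam)))%R \/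
   (Im gam = 0 /\ 1 / (2 * (1 - lam)) <= Re gam <= 3 / (2 * (1 - lam)))%R) ->
  exists f f1 g, classK lam f /\ (forall z, inD z -> cderiv f z (f1 z)) /\ log_branch f1 g /\
    ~ classS (Hornich gam g).
Proof.
intros Hlam N.
set (L := (1 - lam)%R) in *. assert (PL : (0 < L)%R) by (unfold L; lra).
(* Rescaling turns the admissible set into the unit disc together with [[1, 3]]; the exponent below
   is [beta = 1 - mu v], so its two conditions become [|mu v| > 1] and [|mu v - 2| > 1]. *)
set (v := RtoC (2 * L) * gam).
assert (V1 : (1 < Cmod v)%R).
{ apply Rnot_le_lt; intros V; apply N; left.
  unfold v in V. rewrite Cmod_mult, Cmod_R, Rabs_pos_eq in V by lra.
  apply Rmult_le_reg_l with (2 * L)%R; [lra | ].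
  replace (2 * L * (1 / (2 * L)))%R with 1%R by (field; lra). exact V. }
assert (V2 : ~ (Im v = 0 /\ 1 <= Re v <= 3)%R).
{ intros [I [A B]]; apply N; right. unfold v in *. rewrite Im_Rmult in I. rewrite Re_Rmult in A, B.
  split; [ | split].
  - apply Rmult_integral in I. destruct I; lra.
  - apply Rmult_le_reg_l with (2 * L)%R; [lra | ].
    replace (2 * L * (1 / (2 * L)))%R with 1%R by (field; lra). exact A.
  - apply Rmult_le_reg_l with (2 * L)%R; [lra | ].
    replace (2 * L * (3 / (2 * L)))%R with 3%R by (field; lra). exact B. }
destruct (ray_leaves_discs v V1 V2) as [mu [Pmu [M1 M2]]].
set (beta := 1 - RtoC mu * v).
destruct (power_not_injective beta) as [z1 [z2 [D1 [D2 [NE E]]]]].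
{ unfold beta. replace (1 - RtoC mu * v - 1) with (- (RtoC mu * v)) by ring. now rewrite Cmod_opp. }
{ unfold beta. replace (1 - RtoC mu * v + 1) with (- (RtoC mu * v - 2)) by ring. now rewrite Cmod_opp. }
set (a := (2 * L * mu)%R).
assert (Ha : (0 < a <= 2 * (1 - lam))%R).
{ fold L. unfold a. assert (0 < 2 * L * mu)%R by (apply Rmult_lt_0_compat; lra).
  assert (2 * L * mu <= 2 * L * 1)%R by (apply Rmult_le_compat_l; lra). lra. }
destruct (classK_power lam a Ha) as [K1 [K2 K3]].
set (g := fun z => RtoC (- a) * Clog (1 - z)) in *.
exists (Hornich 1 g), (fun z => Cexp (1 * g z)), g.
split; [ | split; [ | split]]; auto.
intros [_ Inj]. apply NE, Inj; auto.
assert (Hg : hol 1 g (fun z => RtoC (- a) * - / (1 - z))) by apply hol_scal, hol_log_one_minus.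
assert (HH := hol_Hornich gam g _ Hg).
assert (Nb : beta <> 0).
{ intros B. assert (X : RtoC mu * v = 1) by (replace (RtoC mu * v) with (1 - beta) by (unfold beta; ring); rewrite B; ring).
  rewrite X, Cmod_1 in M1. lra. }
assert (N1 := one_minus_neq_0).
set (W := fun z => / beta * Cexp (beta * Clog (1 - z))).
(* Since [a gam = mu v = 1 - beta], the multiple has derivative [(1 - z)^(beta - 1)] and differs
   from [- (1 - z)^beta / beta] by a constant. *)
assert (DW : forall z, (Cmod z < 1)%R -> cderiv (fun z => Hornich gam g z + W z) z 0).
{ intros z Hz.
  apply cderiv_eq with (Cexp (gam * g z) + / beta * (Cexp (beta * Clog (1 - z)) * (beta * - / (1 - z)))).
  - assert (Ez : Cexp (beta * Clog (1 - z)) = Cexp (gam * g z) * (1 - z)).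
    { rewrite <- (Cexp_Clog (1 - z)) at 2 by now apply Re_one_minus_pos.
      rewrite <- Cexp_add. f_equal. unfold g, beta, v, a. rewrite RtoC_opp, !RtoC_mult. ring. }
    rewrite Ez. field. split; auto.
  - apply cderiv_plus; [now apply HH | ].
    apply cderiv_scal. apply (hol_exp_scal 1 (fun z => Clog (1 - z)) (fun z => - / (1 - z)) beta hol_log_one_minus z Hz). }
assert (C1 := cderiv_zero_const _ 1 z1 DW D1). assert (C2 := cderiv_zero_const _ 1 z2 DW D2).
cbv beta in C1, C2.
replace (Hornich gam g z1) with (Hornich gam g z1 + W z1 - W z1) by ring.
replace (Hornich gam g z2) with (Hornich gam g z2 + W z2 - W z2) by ring.
rewrite C1, C2. unfold W. now rewrite E.
Qed.

Theorem theorem2p1 (lam : R) (hlam : (lam < 1)%R) (gam : C) :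
  (forall f : C -> C, classK lam f ->
     forall f1 g : C -> C,
       (forall z, inD z -> cderiv f z (f1 z)) ->
       log_branch f1 g ->
       classS (Hornich gam g))
  <->
  ((Cmod gam <= 1 / (2 * (1 - lam)))%R \/
   (Im gam = 0 /\ 1 / (2 * (1 - lam)) <= Re gam <= 3 / (2 * (1 - lam)))%R).
Proof.
split.
- intros H. apply NNPP; intros N.
  destruct (Hornich_not_univalent lam gam hlam N) as [f [f1 [g [K [D [B NS]]]]]].
  apply NS, (H f K f1 g D B).
- intros Hgam f K f1 g D B. exact (Hornich_univalent lam gam f f1 g hlam Hgam K D B).
Qed.
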